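(* Let $\mathcal Z\subseteq\mathbb R^d$ be a nonempty closed convex set, let $F_{i,j}:\mathcal Z\to\mathbb R^d$ for $i\in\{1,\dots,n\}$, $j\in\{1,\dots,M\}$, let $F_i=\frac1M\sum_{j=1}^MF_{i,j}$ and $F=\frac1n\sum_{i=1}^nF_i$, and let $\tilde L,\mu,\tilde\delta>0$. Assume: (1) $F$ is $\mu$-strongly monotone on $\mathcal Z$: $\langle F(u)-F(v),u-v\rangle\ge\mu\|u-v\|^2$ for all $u,v\in\mathcal Z$, and each $F_i$ is monotone on $\mathcal Z$; (2) for every $i$ and all $u,v\in\mathcal Z$, $\frac1M\sum_{j=1}^M\|F_{i,j}(u)-F_{i,j}(v)\|^2\le\tilde L^2\|u-v\|^2$; (3) for every $i_1\in\{1,\dots,n\}$ and all $u,v\in\mathcal Z$, $\frac{1}{nM^2}\sum_{i_2=1}^n\sum_{j_1,j_2=1}^M\|F_{i_1,j_1}(u)-F_{i_2,j_2}(u)-F_{i_1,j_1}(v)+F_{i_2,j_2}(v)\|^2\le\tilde\delta^2\|u-v\|^2$. Let $z^*\in\mathcal Z$ be the solution of the variational inequality $\langle F(z^* ),z-z^*\rangle\ge0$ for all $z\in\mathcal Z$. Let $\{z^k\}_{k\ge0}$ be the iterates of the Three Pillars Algorithm with Variance Reduction (defined in the context, with permutation compressors) with parameters $$\tau=p\le\tfrac14,\quad \gamma=\min\left\{\frac{p}{3\mu},\ \frac{\sqrt p}{4\tilde\delta},\ \frac{1}{\tilde L}\left(\frac{H}{12\sqrt M\log\frac{40\tilde L}{\mu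 p}}-1\right)\right\},\quad \eta=\frac{1}{2\sqrt M\left(\tilde L+\frac1\gamma\right)},$$ $$q=\frac1M,\quad \alpha=1-\frac1M,\quad H\ge16M\log\frac{40\tilde L}{\mu p}.$$ Then for every $K\ge0$, $$\mathbb E\left[\|z^K-z^*\|^2\right]\le\left(1-\frac{\gamma\mu}{2}\right)^K\cdot2\|z^0-z^*\|^2 .$$
   Context: $\|\cdot\|$ is the Euclidean norm, $\mathrm{proj}_{\mathcal Z}$ the Euclidean projection onto $\mathcal Z$, $\log$ the natural logarithm. Permutation compressors $Q_1,\dots,Q_n:\mathbb R^d\to\mathbb R^d$ (random maps). If $d\ge n$, assume $d=rn$ with $r\ge1$ an integer; let $\pi$ be a uniformly random permutation of $\{1,\dots,d\}$ and set $Q_i(u)=n\sum_{j=r(i-1)+1}^{ri}u_{\pi_j}e_{\pi_j}$. If $d\le n$, $n>1$, assume $n=rd$ with $r\ge1$ an integer; let $\pi=(\pi_1,\dots,\pi_n)$ be a uniformly random permutation of the multiset in which each of $1,\dots,d$ occurs exactly $r$ times and set $Q_i(u)=d\,u_{\pi_i}e_{\pi_i}$. Here $e_j$ is the $j$-th standard basis vector. The same $\pi$ is used by all $i$ within one iteration. Three Pillars Algorithm with Variance Reduction. Parameters: $\gamma,\eta>0$, $\tau$, $\alpha$, $p,q\in(0,1]$, integer $H\ge1$. Start from any $z^0=m^0\in\mathcal Z$. For $k=0,1,2,\dots$: (a) set $u^k_0=w^k_0=z^k$; for $t=0,\dots,H-1$: compute $u^k_{t+1/2}=\mathrm{proj}_{\mathcal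 Z}\big[\alpha u^k_t+(1-\alpha)w^k_t-\eta\big(F_1(w^k_t)-F_1(m^k)+F(m^k)+\frac1\gamma(w^k_t-z^k-\tau(m^k-z^k))\big)\big]$, draw $j_t$ uniformly from $\{1,\dots,M\}$ and compute $u^k_{t+1}=\mathrm{proj}_{\mathcal Z}\big[\alpha u^k_t+(1-\alpha)w^k_t-\eta\big(F_{1,j_t}(u^k_{t+1/2})-F_{1,j_t}(w^k_t)+F_1(w^k_t)-F_1(m^k)+F(m^k)+\frac1\gamma(u^k_{t+1/2}-z^k-\tau(m^k-z^k))\big)\big]$, and set $w^k_{t+1}=u^k_{t+1}$ with probability $q$, $w^k_{t+1}=w^k_t$ with probability $1-q$; (b) draw $j_k^1,\dots,j_k^n$ independently and uniformly from $\{1,\dots,M\}$ and fresh permutation compressors $Q_1,\dots,Q_n$, and set $z^{k+1}=\mathrm{proj}_{\mathcal Z}\big[u^k_H+\gamma\cdot\frac1n\sum_{i=1}^nQ_i\big(F_{i,j_k^i}(m^k)-F_{1,j_k^1}(m^k)-F_{i,j_k^i}(u^k_H)+F_{1,j_k^1}(u^k_H)\big)\big]$; (c) set $m^{k+1}=z^k$ with probability $p$ and $m^{k+1}=m^k$ with probability $1-p$. All random draws are independent of each other and of the past. *)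

(* Defs.v *)
From HB Require Import structures.
From mathcomp Require Import all_boot all_order all_fingroup all_algebra.
From mathcomp Require Import all_classical all_reals all_analysis.
Import Order.TTheory GRing.Theory Num.Theory.
Import numFieldNormedType.Exports.

Set Implicit Arguments.
Unset Strict Implicit.
Unset Printing Implicit Defensive.

Local Open Scope classical_set_scope.
Local Open Scope ring_scope.

Section Euclidean.
Variables (R : realType) (d : nat).
Implicit Types (u v : 'rV[R]_d) (Z : set 'rV[R]_d) (G : 'rV[R]_d -> 'rV[R]_d).

Definition dot u v : R := \sum_(j < d) u 0 j * v 0 j.

(* The library norm `|u| on matrices is the sup norm, hence this one; both
   induce the same topology, so [closed] has its usual meaning. *)
Definition enorm u : R := Num.sqrt (dot u u).

(* The minimizer exists and is unique when Z is nonempty, closed and convex;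
   0 is a dummy value for the other sets. *)
Definition proj Z v : 'rV[R]_d :=
  xget 0 [set x | Z x /\ forall y, Z y -> enorm (v - x) <= enorm (v - y)].

Definition monotone_on Z G :=
  forall u v, Z u -> Z v -> 0 <= dot (G u - G v) (u - v).

Definition strongly_monotone_on Z G (mu : R) :=
  forall u v, Z u -> Z v -> mu * enorm (u - v) ^+ 2 <= dot (G u - G v) (u - v).

Definition solves_VI Z G (x : 'rV[R]_d) :=
  Z x /\ forall z, Z z -> 0 <= dot (G x) (z - x).

End Euclidean.

Section Operators.
Variables (R : realType) (d n M : nat).

(* Operators are total functions, but the hypotheses only constrain them on Z,
   and the algorithm only evaluates them there. *)
Variables (Z : set 'rV[R]_d) (F : 'I_n -> 'I_M -> 'rV[R]_d -> 'rV[R]_d).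

Definition node_op (i : 'I_n) (u : 'rV[R]_d) : 'rV[R]_d :=
  M%:R^-1 *: \sum_(j < M) F i j u.

Definition full_op (u : 'rV[R]_d) : 'rV[R]_d :=
  n%:R^-1 *: \sum_(i < n) node_op i u.

Definition mean_square_lipschitz (L : R) :=
  forall (i : 'I_n) u v, Z u -> Z v ->
    M%:R^-1 * \sum_(j < M) enorm (F i j u - F i j v) ^+ 2
      <= L ^+ 2 * enorm (u - v) ^+ 2.

Definition mean_square_similar (delta : R) :=
  forall (i1 : 'I_n) u v, Z u -> Z v ->
    (n%:R * M%:R ^+ 2)^-1 *
      \sum_(i2 < n) \sum_(j1 < M) \sum_(j2 < M)
        enorm (F i1 j1 u - F i2 j2 u - F i1 j1 v + F i2 j2 v) ^+ 2
      <= delta ^+ 2 * enorm (u - v) ^+ 2.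

End Operators.

(* The two cases in which permutation compressors are defined; when d = n > 1
   both apply. *)
Inductive regime := NodesLeDim | DimLeNodes.

Definition regime_ok (c : regime) (d n r : nat) : Prop :=
  match c with
  | NodesLeDim => (0 < r)%N /\ d = (r * n)%N
  | DimLeNodes => [/\ (0 < r)%N, (1 < n)%N & n = (r * d)%N]
  end.

(* For d <= n, the permutations of the multiset in which every coordinate
   occurs r times are the words of length n with that content. *)
Definition shuffle (c : regime) (d n r : nat) : finType :=
  match c with
  | NodesLeDim => {perm 'I_d}
  | DimLeNodes => {f : {ffun 'I_n -> 'I_d} |
                    [forall a, #|[set i | f i == a]%SET| == r]}
  end.

(* Nodes and coordinates are numbered from 0. *)
Definition compressor (R : realType) (c : regime) (d n r : nat) :
    shuffle c d n r -> 'I_n -> 'rV[R]_d -> 'rV[R]_d :=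
  match c return shuffle c d n r -> 'I_n -> 'rV[R]_d -> 'rV[R]_d with
  | NodesLeDim => fun s i u =>
      n%:R *: \sum_(j < d | (r * i <= j < r * i.+1)%N)
                u 0 (s j) *: delta_mx 0 (s j)
  | DimLeNodes => fun s i u =>
      d%:R *: (u 0 (val s i) *: delta_mx 0 (val s i))
  end.

(* Names of the random draws: [InnerIndex k t] and [AnchorCoin k t] are j_t and
   the coin deciding w_(t+1) in the inner loop of iteration k; [NodeIndex k i],
   [Shuffle k] and [RefCoin k] are j_k^i, the permutation shared by all the
   compressors, and the coin deciding m^(k+1). *)
Inductive draw (n H : nat) :=
  | InnerIndex of nat & 'I_H
  | AnchorCoin of nat & 'I_H
  | NodeIndex of nat & 'I_n
  | Shuffle of nat
  | RefCoin of nat.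
Arguments InnerIndex {n H} _ _.
Arguments AnchorCoin {n H} _ _.
Arguments NodeIndex {n H} _ _.
Arguments Shuffle {n H} _.
Arguments RefCoin {n H} _.

HB.instance Definition _ (n H : nat) := gen_eqMixin (draw n H).

Section Draws.
Variables (c : regime) (d n r M H : nat).

Definition outcome (a : draw n H) : finType :=
  match a with
  | InnerIndex _ _ | NodeIndex _ _ => 'I_M
  | AnchorCoin _ _ | RefCoin _ => bool
  | Shuffle _ => shuffle c d n r
  end.

Definition draw_law (R : realType) (p q : R) (a : draw n H) : outcome a -> R :=
  match a return outcome a -> R with
  | InnerIndex _ _ | NodeIndex _ _ => fun=> M%:R^-1
  | AnchorCoin _ _ => fun b => if b then q else 1 - q
  | RefCoin _ => fun b => if b then p else 1 - p
  | Shuffle _ => fun=> #|shuffle c d n r|%:R^-1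
  end.

End Draws.

Section Probability.
Context {disp : measure_display} {Omega : measurableType disp} {R : realType}.
Variables (P : probability Omega R) (I : eqType) (E : I -> finType).
Variable (X : forall a : I, Omega -> E a).

Definition has_law (law : forall a, E a -> R) :=
  forall a (x : E a), measurable [set w | X a w = x] /\
    P [set w | X a w = x] = (law a x)%:E.

Definition mutually_independent :=
  forall (s : seq I) (A : forall a, set (E a)), uniq s ->
    P [set w | forall a, a \in s -> A a (X a w)] =
    (\prod_(a <- s) P [set w | A a (X a w)])%E.

End Probability.

Section ThreePillars.
Variables (R : realType) (c : regime) (d n r M H : nat).
Variables (Z : set 'rV[R]_d) (F : 'I_n -> 'I_M -> 'rV[R]_d -> 'rV[R]_d).
Variable (i1 : 'I_n). (* the node numbered 1 in the algorithm *)
Variables (gamma eta tau alpha : R).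

(* From (u_t, w_t) to (u_(t+1), w_(t+1)). *)
Definition inner_step (z m : 'rV[R]_d) (j : 'I_M) (coin : bool)
    (uw : 'rV[R]_d * 'rV[R]_d) : 'rV[R]_d * 'rV[R]_d :=
  let: (u, w) := uw in
  let base := alpha *: u + (1 - alpha) *: w in
  let u_half := proj Z (base - eta *:
    (node_op F i1 w - node_op F i1 m + full_op F m
     + gamma^-1 *: (w - z - tau *: (m - z)))) in
  let u_next := proj Z (base - eta *:
    (F i1 j u_half - F i1 j w + node_op F i1 w - node_op F i1 m + full_op F m
     + gamma^-1 *: (u_half - z - tau *: (m - z)))) in
  (u_next, if coin then u_next else w).

(* u_H *)
Definition inner_loop (z m : 'rV[R]_d) (j : 'I_H -> 'I_M) (coin : 'I_H -> bool) :
    'rV[R]_d :=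
  (foldl (fun uw t => inner_step z m (j t) (coin t) uw) (z, z) (enum 'I_H)).1.

(* From (z^k, m^k) to (z^(k+1), m^(k+1)). *)
Definition outer_step (x : forall a : draw n H, outcome c d r M a) (k : nat)
    (zm : 'rV[R]_d * 'rV[R]_d) : 'rV[R]_d * 'rV[R]_d :=
  let: (z, m) := zm in
  let uH := inner_loop z m (fun t => x (InnerIndex k t))
                           (fun t => x (AnchorCoin k t)) in
  let j i : 'I_M := x (NodeIndex k i) in
  let correction := n%:R^-1 *: \sum_(i < n) compressor (x (Shuffle k)) i
    (F i (j i) m - F i1 (j i1) m - F i (j i) uH + F i1 (j i1) uH) in
  (proj Z (uH + gamma *: correction), if x (RefCoin k) then z else m).

(* (z^k, m^k) *)
Fixpoint iterates (z0 : 'rV[R]_d) (x : forall a : draw n H, outcome c d r M a)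
    (k : nat) : 'rV[R]_d * 'rV[R]_d :=
  if k is k'.+1 then outer_step x k' (iterates z0 x k') else (z0, z0).

End ThreePillars.

(* Main.v *)
(* The inner loop is variance-reduced extragradient on the strongly monotone
   inclusion whose solution uh satisfies N := z + p (m - z) - uh - gamma f(uh)
   normal to Z at uh, f being the operator of node 1 corrected at the anchor m.
   It contracts E |u_H - uh|^2 to a multiple X^-3 of |z - uh|^2, where
   X = 40 L / (mu p).  The permutation compressors act as unbiased estimators
   whose second moment is controlled by the similarity constant.

   If gamma mu >= 14 X^-3, the inner error is absorbed in a single outer step and
   |z - x|^2 + |m - x|^2 decreases by the factor 1 - gamma mu / 2 on average.

   If gamma mu < 14 X^-3, which happens when delta is very large, the inner error
   is of first order and no such one-step estimate holds.  The similarity constant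
   2 L then replaces delta, and u_H - uh is split into a deterministic-direction
   part theta (zh - uh), with zh a reference point in Z and theta depending on the
   coins only, and a deviation that does contract.  Taking for zh a shadow iterate
   that starts at the solution x and moves without error, one shows that the
   distance to x plus time-dependent multiples of the energy and of the velocity
   of the shadow iterate, and of the distance to it, decreases at the claimed
   rate. *)
Require Import Defs.
From mathcomp Require Import all_boot all_order all_fingroup all_algebra.
From mathcomp Require Import all_classical all_reals all_analysis.
From mathcomp Require Import measurable_realfun.
From mathcomp Require Import ring lra.
Import Order.TTheory GRing.Theory Num.Theory.
Import numFieldNormedType.Exports.

Set Implicit Arguments.
Unset Strict Implicit.
Unset Printing Implicit Defensive.

Local Open Scope classical_set_scope.
Local Open Scope ring_scope.

Local Notation proj := Defs.proj.
Local Notation dfwith := eqtype.dfwith.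

(** * Euclidean geometry and projections *)

(** The obstacle is the cross term 2 <uh - x, u_H - uh>. Young's inequality against strong
    monotonicity costs X^-3 / (gamma mu), whence the threshold between the regimes. For smaller
    gamma mu the part along zh - uh is kept exactly: optimality of uh rewrites <uh - x, zh - uh> by
    terms already dominated, by z - zh, and by a shift of the weight of |m - x|^2 to 1 - E theta.
    Only what is left meets Young's inequality, with a parameter of order 1 / (p t^2), whose losses
    are summable over the time t. The deviation is then multiplied by p t^2, so its sources must
    decay; this is the use of the shadow iterate. Up to its distance to (z, m) it is an anchored
    proximal point method for the linear function <F(x), .> on Z, started at a minimizer, and t
    energy + t^2 residual is the classical Lyapunov function of such a method. Once 1 / (p t^2) is a
    small fraction of gamma mu, strong monotonicity pays alone and the weights stop growing. This
    bounds |z - x|^2 + (1 - E theta) |m - x|^2 with constant 37/10; the constant 2 for z alone needs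
    a separate bound on E |z - x|^2 - E |m - x|^2. *)

Section EuclideanTheory.
Variables (R : realType) (d : nat).
Implicit Types (u v w x y : 'rV[R]_d) (a : R).

Lemma dotC u v : dot u v = dot v u.
Proof. by apply: eq_bigr => j _; rewrite mulrC. Qed.

Lemma dotDl u v w : dot (u + v) w = dot u w + dot v w.
Proof. by rewrite /dot -big_split; apply: eq_bigr => j _; rewrite mxE mulrDl. Qed.

Lemma dotZl a u v : dot (a *: u) v = a * dot u v.
Proof. by rewrite /dot mulr_sumr; apply: eq_bigr => j _; rewrite mxE mulrA. Qed.

Lemma dotDr u v w : dot u (v + w) = dot u v + dot u w.
Proof. by rewrite dotC dotDl dotC (dotC w). Qed.

Lemma dotZr a u v : dot u (a *: v) = a * dot u v.
Proof. by rewrite dotC dotZl dotC. Qed.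

Lemma dotNl u v : dot (- u) v = - dot u v.
Proof. by rewrite -scaleN1r dotZl mulN1r. Qed.

Lemma dotNr u v : dot u (- v) = - dot u v.
Proof. by rewrite dotC dotNl dotC. Qed.

Lemma dot0l v : dot 0 v = 0.
Proof. by rewrite -(scale0r v) dotZl mul0r. Qed.

Lemma dot0r v : dot v 0 = 0.
Proof. by rewrite dotC dot0l. Qed.

Lemma dot_suml (I : Type) (r : seq I) (P : pred I) (f : I -> 'rV[R]_d) v :
  dot (\sum_(i <- r | P i) f i) v = \sum_(i <- r | P i) dot (f i) v.
Proof. by elim/big_rec2: _ => [|i y x _ <-]; rewrite ?dot0l ?dotDl. Qed.

Lemma dot_sumr (I : Type) (r : seq I) (P : pred I) (f : I -> 'rV[R]_d) v :
  dot v (\sum_(i <- r | P i) f i) = \sum_(i <- r | P i) dot v (f i).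
Proof. by rewrite dotC dot_suml; apply: eq_bigr => i _; rewrite dotC. Qed.

Definition dotE :=
  (dotDl, dotDr, dotZl, dotZr, dotNl, dotNr, dot0l, dot0r).

Lemma dot_ge0 u : 0 <= dot u u.
Proof. by apply: sumr_ge0 => j _; rewrite -expr2 sqr_ge0. Qed.

Lemma dot_eq0 u : (dot u u == 0) = (u == 0).
Proof.
apply/eqP/eqP => [|->]; last exact: dot0l.
move/eqP; rewrite /dot psumr_eq0 => [/allP u0|j _]; last by rewrite -expr2 sqr_ge0.
apply/rowP => j; rewrite mxE; apply/eqP.
by have := u0 j (mem_index_enum _); rewrite /= mulf_eq0 orbb.
Qed.

Lemma enorm_sqr u : enorm u ^+ 2 = dot u u.
Proof. by rewrite sqr_sqrtr// dot_ge0. Qed.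

Lemma ler_enorm u v : (enorm u <= enorm v) = (dot u u <= dot v v).
Proof. by rewrite ler_psqrt// nnegrE dot_ge0. Qed.

Lemma dot_subC u v : dot (u - v) (u - v) = dot (v - u) (v - u).
Proof. by rewrite -(opprB v u) dotNl dotNr opprK. Qed.

Lemma dot_young u v a : 0 < a -> 2 * dot u v <= a * dot u u + a^-1 * dot v v.
Proof.
move=> a0; have := dot_ge0 (a *: u - v); rewrite !dotE (dotC v u) => h.
rewrite -(ler_pM2l a0) mulrDr mulrA mulVKf ?gt_eqF//; lra.
Qed.

Lemma dot_CS u v : dot u v ^+ 2 <= dot u u * dot v v.
Proof.
have [->|u0] := eqVneq u 0; first by rewrite !dot0l expr0n mul0r.
have pu : 0 < dot u u by rewrite lt_def dot_eq0 u0 dot_ge0.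
have := dot_ge0 (dot u u *: v - dot u v *: u); rewrite !dotE (dotC v u) => h.
rewrite -(ler_pM2l pu); lra.
Qed.

Lemma dot_addr_le u v a : 0 < a ->
  dot (u + v) (u + v) <= (1 + a) * dot u u + (1 + a^-1) * dot v v.
Proof.
move=> /(dot_young u v) h; rewrite !dotE (dotC v u); lra.
Qed.

Lemma dot_addr_le2 u v :
  dot (u + v) (u + v) <= 2 * dot u u + 2 * dot v v.
Proof. by have := dot_addr_le u v ltr01; rewrite invr1 => h; lra. Qed.

(** The variance of [f] about its mean [m] is nonnegative; for an empty family both sides vanish
    because [0^-1 = 0]. The count [n] is a separate variable so that factors such as [M%:R^-1] match
    as they stand. *)
Lemma jensen_dot (I : finType) (f : I -> 'rV[R]_d) (n : nat) : n = #|I| ->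
  dot (n%:R^-1 *: \sum_i f i) (n%:R^-1 *: \sum_i f i)
  <= n%:R^-1 * \sum_i dot (f i) (f i).
Proof.
move=> nI; have [m mE] : exists m, m = n%:R^-1 *: \sum_i f i by exists (n%:R^-1 *: \sum_i f i).
rewrite -mE.
have [n0|n0] := posnP n.
  by rewrite mE n0 invr0 scale0r dot0l mul0r.
have nR : (n%:R : R) != 0 by rewrite pnatr_eq0 -lt0n.
suff : 0 <= n%:R^-1 * \sum_i dot (f i - m) (f i - m).
  have -> : \sum_i dot (f i - m) (f i - m) =
      \sum_i dot (f i) (f i) - 2 * dot (\sum_i f i) m + n%:R * dot m m.
    rewrite dot_suml mulr_sumr -sumrB.
    have -> : n%:R * dot m m = \sum_(i : I) dot m m.
      by rewrite sumr_const -nI mulr_natl.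
    rewrite -big_split; apply: eq_bigr => i _ /=.
    by rewrite !dotE (dotC m); ring.
  have -> : \sum_i f i = n%:R *: m by rewrite mE scalerA mulfV// scale1r.
  rewrite dotZl; set D := dot m m; set S := \sum_i _.
  have -> : n%:R^-1 * (S - 2 * (n%:R * D) + n%:R * D) = n%:R^-1 * S - D by field.
  by rewrite subr_ge0.
by rewrite mulr_ge0 ?invr_ge0 ?ler0n// sumr_ge0// => i _; apply: dot_ge0.
Qed.

(** With [dot_le_mx_norm]: equivalence of the sup norm, which carries the topology, and the
    Euclidean norm; compactness and continuity reach [enorm] through it. *)
Lemma mx_norm_le_dot u : `|u| ^+ 2 <= dot u u.
Proof.
rewrite /Num.norm /= mx_normrE.
have [->|[i ->]] : \big[Order.max/0]_ij `|u ij.1 ij.2| = 0 \/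
    exists i, \big[Order.max/0]_ij `|u ij.1 ij.2| = `|u 0 i|.
  elim/big_rec: _ => [|[i0 i] x _ [->|[j ->]]]; first by left.
  - by rewrite maxEle; case: ifP; [left|right; exists i; rewrite (ord1 i0)].
  - by rewrite maxEle; case: ifP => _; right; [exists j|exists i; rewrite (ord1 i0)].
- by rewrite expr0n dot_ge0.
rewrite /dot (bigD1 i)//= real_normK ?num_real// expr2 lerDl.
by apply: sumr_ge0 => j _; rewrite -expr2 sqr_ge0.
Qed.

Lemma dot_le_mx_norm u : dot u u <= d%:R * `|u| ^+ 2.
Proof.
rewrite /dot -[d in d%:R]card_ord -sum1_card natr_sum mulr_suml ler_sum// => j _.
rewrite mul1r -expr2 -(real_normK (num_real (u 0 j))) lerXn2r ?nnegrE//.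
rewrite [leRHS]/Num.norm /= mx_normrE.
by apply/bigmax_geP; right => /=; exists (0, j).
Qed.

End EuclideanTheory.

Section Projection.
Variables (R : realType) (d : nat).
Variable Z : set 'rV[R]_d.
Implicit Types (u v w x y : 'rV[R]_d).
Hypotheses (Z_nonempty : Z !=set0) (Z_closed : closed Z) (Z_convex : convex_set Z).

(** [convex_set] quantifies over scalars bundled with their membership in the unit interval; the
    bundle is unpacked here. *)
Lemma convex_mem x y (t : R) : 0 <= t -> t <= 1 -> Z x -> Z y ->
  Z (t *: x + (1 - t) *: y).
Proof.
move=> t0 t1 zx zy.
have t01 : Itv.spec (@Itv.num_sem R) (Itv.Real `[0%Z, 1%Z]) t.
  by rewrite /= /Itv.num_sem/= num_real/= in_itv/= t0 t1.
have := Z_convex (Itv.mk t01) (mem_set zx) (mem_set zy).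
by move/set_mem.
Qed.

End Projection.

Section EnormTheory.
Variables (R : realType) (d : nat).
Implicit Types (u v w x y : 'rV[R]_d) (a : R).

Lemma enorm_ge0 u : 0 <= enorm u.
Proof. exact: sqrtr_ge0. Qed.

Lemma dot_le_enorm u v : dot u v <= enorm u * enorm v.
Proof.
rewrite -sqrtrM ?dot_ge0// (le_trans (ler_norm _))// -sqrtr_sqr ler_wsqrtr//.
exact: dot_CS.
Qed.

Lemma enorm_le a u : 0 <= a -> (enorm u <= a) = (dot u u <= a ^+ 2).
Proof.
by move=> a0; rewrite -enorm_sqr ler_pXn2r ?nnegrE ?enorm_ge0.
Qed.

Lemma enormD u v : enorm (u + v) <= enorm u + enorm v.
Proof.
rewrite enorm_le ?addr_ge0 ?enorm_ge0// sqrrD !enorm_sqr !dotE (dotC v u).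
have := dot_le_enorm u v; lra.
Qed.

Lemma enormN u : enorm (- u) = enorm u.
Proof. by rewrite /enorm dotNl dotNr opprK. Qed.

Lemma enorm_dist u v : `|enorm u - enorm v| <= enorm (u - v).
Proof.
rewrite ler_norml; apply/andP; split.
  by have := enormD u (v - u); rewrite addrC subrK -(enormN (v - u)) opprB; lra.
by have := enormD v (u - v); rewrite addrC subrK; lra.
Qed.

Lemma enorm_le_norm u : enorm u <= Num.sqrt d%:R * `|u|.
Proof.
rewrite enorm_le ?mulr_ge0 ?sqrtr_ge0// exprMn sqr_sqrtr ?ler0n//.
exact: dot_le_mx_norm.
Qed.

Lemma norm_le_enorm u : `|u| <= enorm u.
Proof.
by rewrite -(@ler_pXn2r _ 2) ?nnegrE ?enorm_ge0// enorm_sqr mx_norm_le_dot.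
Qed.

Lemma enorm_lipschitz_continuous (A : set 'rV[R]_d) (f : 'rV[R]_d -> R) (C : R) :
  0 <= C -> (forall x y, A x -> A y -> `|f x - f y| <= C * enorm (x - y)) ->
  {within A, continuous f}.
Proof.
move=> C0 fC; apply/subspace_continuousP => x Ax.
apply/cvgrPdist_le => e e0; rewrite near_withinE.
have D0 : 0 < C * Num.sqrt d%:R + 1 by rewrite ltr_wpDl// mulr_ge0// sqrtr_ge0.
near=> y => Ay; rewrite (le_trans (fC _ _ Ax Ay))//.
rewrite (@le_trans _ _ ((C * Num.sqrt d%:R + 1) * `|x - y|))//.
  by rewrite mulrDl mul1r ler_wpDr// -mulrA ler_wpM2l// enorm_le_norm.
rewrite mulrC -ler_pdivlMr//; near: y.
by apply: cvgr_dist_le; [exact: cvg_id|rewrite divr_gt0].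
Unshelve. all: by end_near. Qed.

Lemma enorm_ball_bounded (x : 'rV[R]_d) (r : R) :
  bounded_set [set y | enorm (x - y) <= r].
Proof.
exists (`|x| + r); split; first exact: num_real.
move=> s rs y /= xyr.
have : `|y| <= `|x| + `|x - y|.
  by rewrite -[in leLHS](subrK x y) -(normrN (x - y)) opprB addrC ler_normD.
by have := norm_le_enorm (x - y); lra.
Qed.

Lemma enorm_ball_closed (x : 'rV[R]_d) (r : R) :
  closed [set y | enorm (x - y) <= r].
Proof.
apply: (@preimage_closed _ _ (fun y => enorm (x - y)) [set t | t <= r]).
  have : continuous (fun y => enorm (x - y)).
    apply/continuous_subspace_setT.
    apply: (enorm_lipschitz_continuous ler01) => u v _ _.
    rewrite mul1r (le_trans (enorm_dist _ _))//.
    by rewrite -enormN (_ : - _ = u - v)//; apply/rowP => j; rewrite !mxE; ring.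
  by move=> h y _; exact: h.
exact: closed_le.
Qed.

End EnormTheory.

Lemma dot_sub_scale (R : realType) (d : nat) (u v : 'rV[R]_d) (t : R) :
  dot (u - t *: v) (u - t *: v) = dot u u - 2 * t * dot u v + t ^+ 2 * dot v v.
Proof. by rewrite !dotE (dotC v u); ring. Qed.


Section Projection.
Variables (R : realType) (d : nat).
Variable Z : set 'rV[R]_d.
Implicit Types (u v w x y : 'rV[R]_d).
Hypotheses (Z_nonempty : Z !=set0) (Z_closed : closed Z) (Z_convex : convex_set Z).

(** A closed set cut by a ball is compact in finite dimension. The ball replaces compactness of [Z];
    both later uses choose a radius for which minimizing on the ball is enough. *)
Lemma closed_ball_EVT_min x0 (r : R) (f : 'rV[R]_d -> R) (C : R) :
  0 <= r -> Z x0 -> 0 <= C ->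
  (forall x y, Z x -> Z y -> `|f x - f y| <= C * enorm (x - y)) ->
  exists x, [/\ Z x, enorm (x0 - x) <= r &
    forall y, Z y -> enorm (x0 - y) <= r -> f x <= f y].
Proof.
move=> r0 Zx0 C0 fC.
pose A := Z `&` [set y | enorm (x0 - y) <= r].
have A0 : A !=set0.
  by exists x0; split => //=; rewrite subrr /enorm dot0l sqrtr0.
have cA : compact A.
  apply: bounded_closed_compact.
    have [N [Nr hN]] := enorm_ball_bounded x0 r.
    by exists N; split => // s sN y [_ yr]; exact: hN.
  by apply: closedI => //; exact: enorm_ball_closed.
have fA : {within A, continuous f}.
  apply: (@enorm_lipschitz_continuous _ _ _ _ C) => // x y [Zx _] [Zy _].
  exact: fC.
have [x /set_mem[Zx xr] fx] := EVT_min_rV A0 cA fA.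
by exists x; split => // y Zy yr; apply: fx; apply/mem_set.
Qed.

Lemma proj_exists v : exists x, Z x /\ forall y, Z y -> enorm (v - x) <= enorm (v - y).
Proof.
have [x0 Zx0] := Z_nonempty.
(* Outside the ball of radius 2 |v - x0| about [x0], every point is farther from [v] than [x0]
   is. *)
have [|x y Zx Zy|x [Zx _ fx]] := @closed_ball_EVT_min x0 (enorm (v - x0) *+ 2)
    (fun y => enorm (v - y)) 1 _ Zx0 ler01.
- by rewrite mulrn_wge0// enorm_ge0.
- rewrite mul1r (le_trans (enorm_dist _ _))// -enormN (_ : - _ = x - y)//.
  by apply/rowP => j; rewrite !mxE; ring.
exists x; split=> // y Zy.
have [yr|yr] := leP (enorm (x0 - y)) (enorm (v - x0) *+ 2); first exact: fx.
have x0x : enorm (v - x) <= enorm (v - x0).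
  by apply: fx => //; rewrite subrr /enorm dot0l sqrtr0 mulrn_wge0// sqrtr_ge0.
have : enorm (x0 - y) <= enorm (v - x0) + enorm (v - y).
  rewrite -(enormN (v - x0)) (_ : x0 - y = - (v - x0) + (v - y)) ?enormD//.
  by apply/rowP => j; rewrite !mxE; ring.
move: yr; rewrite mulr2n; lra.
Qed.

Lemma proj_spec v : Z (proj Z v) /\ forall y, Z y -> enorm (v - proj Z v) <= enorm (v - y).
Proof.
rewrite /proj; case: xgetP => [x _ //|/= h].
by have [x xP] := proj_exists v; case: (h x).
Qed.

Lemma proj_in v : Z (proj Z v).
Proof. by have [] := proj_spec v. Qed.

Lemma proj_vi v y : Z y -> dot (v - proj Z v) (y - proj Z v) <= 0.
Proof.
move=> Zy; have [Zp pmin] := proj_spec v; move: Zp pmin; set x := proj Z v.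
clearbody x => Zp pmin; rewrite leNgt; apply/negP => h.
set D := dot (v - x) (y - x) in h; set S := dot (y - x) (y - x).
have S0 : 0 <= S by exact: dot_ge0.
have key (t : R) : 0 <= t -> t <= 1 -> 2 * t * D <= t ^+ 2 * S.
  move=> t0 t1; have := pmin _ (convex_mem Z_convex t0 t1 Zy Zp).
  have -> : v - (t *: y + (1 - t) *: x) = (v - x) - t *: (y - x).
    by apply/rowP => j; rewrite !mxE; ring.
  rewrite ler_enorm.
  rewrite dot_sub_scale -/D -/S; lra.
(* Minimality along the segment gives 2 D <= t S for t in (0, 1]; this [t] has t S < D, a
   contradiction. The denominator D + S is positive even if S = 0. *)
pose t := D / (D + S).
have DS : 0 < D + S by rewrite ltr_pwDl.
have t0 : 0 < t by rewrite divr_gt0.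
have t1 : t <= 1 by rewrite ler_pdivrMr// mul1r lerDl.
have : t * (2 * D) <= t * (t * S) by have := key _ (ltW t0) t1; lra.
rewrite ler_pM2l//.
have : t * S < D.
  by rewrite /t mulrAC ltr_pdivrMr// ltr_pM2l// ltrDr.
lra.
Qed.

Lemma proj_dot_le v y : Z y -> dot (proj Z v - y) (proj Z v - y) <= dot (v - y) (v - y).
Proof.
move=> Zy; have := proj_vi v Zy; have := dot_ge0 (v - proj Z v).
set p := proj Z v; clearbody p.
rewrite !dotE (dotC p v) (dotC y v) (dotC y p); lra.
Qed.

Lemma proj_nonexpansive v w :
  dot (proj Z v - proj Z w) (proj Z v - proj Z w) <= dot (v - w) (v - w).
Proof.
have := proj_vi v (proj_in w); have := proj_vi w (proj_in v).
set p := proj Z v; set q := proj Z w; have := dot_ge0 ((v - p) - (w - q)).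
clearbody p q; rewrite !dotE (dotC p v) (dotC w v) (dotC q v) (dotC w p)
  (dotC q p) (dotC q w); lra.
Qed.

End Projection.

(** * Existence of solutions of strongly monotone variational inequalities *)

Section VariationalInequality.
Variables (R : realType) (d : nat) (Z : set 'rV[R]_d).
Hypotheses (Z_nonempty : Z !=set0) (Z_closed : closed Z) (Z_convex : convex_set Z).
Variables (G : 'rV[R]_d -> 'rV[R]_d) (c K : R).
Hypotheses (c_gt0 : 0 < c) (K_ge0 : 0 <= K).
Hypothesis G_strong :
  forall u v, Z u -> Z v -> c * dot (u - v) (u - v) <= dot (G u - G v) (u - v).
Hypothesis G_lipschitz :
  forall u v, Z u -> Z v -> dot (G u - G v) (G u - G v) <= K * dot (u - v) (u - v).

(* The map [u |-> proj (u - t G u)] is a contraction for small t; a point that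
   minimizes its displacement on a large enough ball is a fixed point. *)
Lemma vi_exists : exists x, solves_VI Z G x.
Proof.
have [x0 Zx0] := Z_nonempty.
have Kc0 : 0 < K + c ^+ 2 by rewrite ltr_wpDl// exprn_gt0.
(* One step multiplies squared distances by at most 1 - 2 t c + t^2 K, which is at most 1 - t c as t
   K <= c. Adding c^2 to the denominator ensures t c <= 1 and admits K = 0. *)
pose t : R := c / (K + c ^+ 2); have t0 : 0 < t by rewrite divr_gt0.
have tE : t * (K + c ^+ 2) = c by rewrite /t divfK ?gt_eqF.
pose T (u : 'rV[R]_d) : 'rV[R]_d := proj Z (u - t *: G u).
have TE u : T u = proj Z (u - t *: G u) by [].
have ZT u : Z (T u) by exact: proj_in.
pose k : R := 1 - t * c.
have tc1 : t * c <= 1.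
  by rewrite /t mulrAC -expr2 ler_pdivrMr// mul1r lerDr.
have k0 : 0 <= k by rewrite subr_ge0.
have k1 : k < 1 by rewrite /k ltrBlDr ltrDl mulr_gt0.
have Tk u v : Z u -> Z v -> dot (T u - T v) (T u - T v) <= k * dot (u - v) (u - v).
  move=> Zu Zv; apply: (le_trans (proj_nonexpansive Z_nonempty Z_closed Z_convex _ _)).
  have -> : u - t *: G u - (v - t *: G v) = (u - v) - t *: (G u - G v).
    by apply/rowP => j; rewrite !mxE; ring.
  rewrite dot_sub_scale (dotC (u - v)).
  have h1 := G_strong Zu Zv; have h2 := G_lipschitz Zu Zv; have h3 := dot_ge0 (u - v).
  have e1 : 0 <= t * (dot (G u - G v) (u - v) - c * dot (u - v) (u - v)).
    by rewrite mulr_ge0 ?subr_ge0 ?(ltW t0).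
  have e2 : 0 <= t ^+ 2 * (K * dot (u - v) (u - v) - dot (G u - G v) (G u - G v)).
    by rewrite mulr_ge0 ?subr_ge0 ?exprn_ge0 ?(ltW t0).
  have e3 : t ^+ 2 * K * dot (u - v) (u - v) + (t * c) ^+ 2 * dot (u - v) (u - v)
      = t * c * dot (u - v) (u - v) by rewrite -[in RHS]tE; ring.
  have e4 : 0 <= (t * c) ^+ 2 * dot (u - v) (u - v) by rewrite mulr_ge0// sqr_ge0.
  rewrite /k; lra.
clearbody T.
pose s : R := Num.sqrt k.
have s0 : 0 <= s by exact: sqrtr_ge0.
have s1 : s < 1 by rewrite -sqrtr1 ltr_sqrt.
have Ts u v : Z u -> Z v -> enorm (T u - T v) <= s * enorm (u - v).
  move=> Zu Zv; rewrite enorm_le ?mulr_ge0 ?enorm_ge0// exprMn sqr_sqrtr//.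
  by rewrite enorm_sqr Tk.
pose g (u : 'rV[R]_d) : R := enorm (u - T u).
(* The ball of this radius about [x0] is mapped into itself by [T], so [T x] competes with the
   minimizer [x]. *)
have r0 : 0 <= g x0 / (1 - s) by rewrite divr_ge0 ?enorm_ge0// subr_ge0 ltW.
have [|x [Zx xr xmin]] := closed_ball_EVT_min (f := g) Z_closed r0 Zx0 (ler0n _ 2).
  move=> u v Zu Zv; rewrite /g (le_trans (enorm_dist _ _))//.
  have -> : u - T u - (v - T v) = (u - v) + - (T u - T v).
    by apply/rowP => j; rewrite !mxE; ring.
  apply: (le_trans (enormD _ _)); rewrite enormN.
  have := Ts _ _ Zu Zv; have := enorm_ge0 (u - v) => h.
  have : s * enorm (u - v) <= 1 * enorm (u - v) by rewrite ler_wpM2r ?enorm_ge0 ?(ltW s1).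
  lra.
have gx0 : g x = 0.
  have : g x <= g (T x).
    apply: xmin => //.
    have -> : x0 - T x = (x0 - T x0) + (T x0 - T x) by rewrite addrA subrK.
    have hA := Ts _ _ Zx0 Zx.
    have hB : s * enorm (x0 - x) <= s * (g x0 / (1 - s)) by rewrite ler_wpM2l.
    have hC : g x0 + s * (g x0 / (1 - s)) = g x0 / (1 - s).
      by field; rewrite subr_eq0 eq_sym lt_eqF.
    apply: (le_trans (enormD (x0 - T x0) (T x0 - T x))).
    by rewrite -hC; apply: lerD; [exact: lexx|exact: le_trans hA hB].
  have h2 : g (T x) <= s * g x by exact: Ts _ _ Zx (ZT x).
  have h1 : 0 <= g x by exact: enorm_ge0.
  move=> h3.
  apply/eqP; rewrite eq_le h1 andbT leNgt; apply/negP => gx.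
  have : s * g x < 1 * g x by rewrite ltr_pM2r.
  lra.
have Tx : T x = x.
  apply/eqP; rewrite eq_sym -subr_eq0 -dot_eq0 -enorm_sqr -/(g x) gx0 expr0n.
  by [].
exists x; split => // y Zy.
have := proj_vi Z_nonempty Z_closed Z_convex (x - t *: G x) Zy.
rewrite -TE Tx addrAC subrr add0r dotNl dotZl oppr_le0 pmulr_rge0//.
Qed.

End VariationalInequality.

(** * Expectations as iterated averages *)

Section IteratedAverage.
Variables (R : realType) (I : eqType) (E : I -> finType) (law : forall a, E a -> R).
Implicit Types (l s : seq I) (x y v : forall a, E a) (f g : (forall a, E a) -> R).

(** Expectation under independent draws, written as nested finite sums; draws outside [l] keep their
    value in [v]. After [expectation_avg] the argument is purely algebraic. *)
Fixpoint avg l f v : R :=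
  if l is a :: l' then \sum_(o : E a) law o * avg l' f (dfwith v o) else f v.

(** The assignments [y] that averaging over [l] can reach from [x]; the comparison lemmas ask for
    hypotheses on these only. *)
Definition agree_off l x y := forall a, a \notin l -> x a = y a.

Lemma agree_off_dfwith l a v (o : E a) y : a \notin l ->
  agree_off l (dfwith v o) y -> y a = o.
Proof. by move=> al /(_ a al) <-; rewrite dfwith_in. Qed.

Lemma agree_off_cons l a v (o : E a) y :
  agree_off l (dfwith v o) y -> agree_off (a :: l) v y.
Proof.
move=> h b; rewrite inE negb_or => /andP[ba bl].
by rewrite -h// dfwith_out// eq_sym.
Qed.

Lemma avg_eq l f g v : (forall y, agree_off l v y -> f y = g y) ->
  avg l f v = avg l g v.
Proof.
elim: l v => [|a l ih] v fg /=; first exact: fg.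
apply: eq_bigr => o _; congr (_ * _); apply: ih => y hy; apply: fg.
exact: agree_off_cons hy.
Qed.

Lemma avg_cat l1 l2 f v : avg (l1 ++ l2) f v = avg l1 (avg l2 f) v.
Proof. by elim: l1 v => [|a l ih] v //=; apply: eq_bigr => o _; rewrite ih. Qed.

Lemma avgD l f g v : avg l (fun x => f x + g x) v = avg l f v + avg l g v.
Proof.
elim: l v => [|a l ih] v //=; rewrite -big_split; apply: eq_bigr => o _ /=.
by rewrite ih mulrDr.
Qed.

Lemma avgZ l (c : R) f v : avg l (fun x => c * f x) v = c * avg l f v.
Proof.
elim: l v => [|a l ih] v //=; rewrite mulr_sumr; apply: eq_bigr => o _ /=.
by rewrite ih mulrCA.
Qed.

Lemma avg_sum (T : Type) (r : seq T) (P : pred T) l (f : T -> _ -> R) v :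
  avg l (fun x => \sum_(t <- r | P t) f t x) v = \sum_(t <- r | P t) avg l (f t) v.
Proof.
elim: l v => [|a l ih] v //=; rewrite exchange_big; apply: eq_bigr => o _ /=.
by rewrite ih mulr_sumr.
Qed.

Hypothesis law_ge0 : forall a (o : E a), 0 <= law o.
Hypothesis law_sum : forall a, \sum_(o : E a) law o = 1.

Lemma avg_le l f g v : (forall y, agree_off l v y -> f y <= g y) ->
  avg l f v <= avg l g v.
Proof.
elim: l v => [|a l ih] v fg /=; first exact: fg.
apply: ler_sum => o _; rewrite ler_wpM2l//; apply: ih => y hy; apply: fg.
exact: agree_off_cons hy.
Qed.

Lemma avg_cst l (c : R) v : avg l (fun=> c) v = c.
Proof.
elim: l v => [|a l ih] v //=.
by under eq_bigr do rewrite ih; rewrite -mulr_suml law_sum mul1r.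
Qed.

Lemma avg_const l f v (c : R) : (forall y, agree_off l v y -> f y = c) ->
  avg l f v = c.
Proof. by move=> fc; rewrite -(avg_cst l c v); exact: avg_eq. Qed.

End IteratedAverage.

Section ExpectationAverage.
Context {disp : measure_display} {Omega : measurableType disp} {R : realType}.
Variables (P : probability Omega R) (I : eqType) (E : I -> finType).
Variable (X : forall a : I, Omega -> E a).
Variable (law : forall a, E a -> R).
Hypotheses (X_law : has_law P X law) (X_indep : mutually_independent P X).
Implicit Types (l s : seq I) (v : forall a, E a) (f : (forall a, E a) -> R).

Let Xv w : forall a, E a := fun a => X a w.

Definition depends_on l f := forall x y, (forall a, a \in l -> x a = y a) -> f x = f y.

Lemma depends_on_dfwith a l f (o : E a) :
  depends_on (a :: l) f -> depends_on l (fun x => f (dfwith x o)).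
Proof.
move=> fl x y xy; apply: fl => b; rewrite inE => /orP[/eqP->|bl].
  by rewrite !dfwith_in.
by case: (eqVneq a b) => [ab|ab]; [subst b; rewrite !dfwith_in|rewrite !dfwith_out// xy].
Qed.

Lemma dfwith_Xv a w : dfwith (Xv w) (X a w) = Xv w.
Proof.
apply: functional_extensionality_dep => b.
by case: (eqVneq a b) => [ab|ab]; [subst b; rewrite dfwith_in|rewrite dfwith_out].
Qed.

Lemma measurable_fiber a (o : E a) : measurable [set w | X a w = o].
Proof. by have [] := X_law o. Qed.

Lemma law_ge0 a (o : E a) : 0 <= law o.
Proof. by have [_ h] := X_law o; rewrite -lee_fin -h. Qed.

Lemma fiber_split a (g : Omega -> E a -> \bar R) w :
  g w (X a w) = (\sum_(o : E a) ((fun w => g w o) \_ [set w | X a w = o]) w)%E.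
Proof.
rewrite (bigD1 (X a w))//= big1 ?adde0.
  by rewrite patchE mem_set.
by move=> o oX; rewrite patchE memNset//= => h; rewrite h eqxx in oX.
Qed.

Lemma measurable_fun_fiber a (o : E a) (A : set Omega) (g : Omega -> \bar R) :
  measurable_fun setT g -> measurable_fun A (g \_ [set w | X a w = o]).
Proof.
move=> mg; apply: (@measurable_funS _ _ _ _ setT) => //.
apply/(measurable_restrictT _ (measurable_fiber o)).
exact: (@measurable_funS _ _ _ _ setT).
Qed.

(** The total mass of [P], split along the fibres of [X a]. *)
Lemma law_sum a : \sum_(o : E a) law o = 1.
Proof.
apply: EFin_inj; rewrite -(@probability_setT _ _ _ P).
transitivity (\int[P]_w (cst 1%E w))%E; last by rewrite integral_cst// mul1e.
have -> : cst 1%E = (fun w => \sum_(o : E a) (cst 1 \_ [set w | X a w = o]) w)%E :> (Omega -> \bar R).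
  by apply/funext => w; rewrite -(fiber_split (fun _ _ => 1%E)).
rewrite ge0_integral_sum//; last 2 first.
- by move=> o; apply: measurable_fun_fiber; exact: measurable_cst.
- by move=> o w _; rewrite patchE; case: ifP.
rewrite -sumEFin; apply: eq_bigr => o _.
rewrite -integral_mkcondr setTI integral_cst//; last exact: measurable_fiber.
by rewrite mul1e; have [_] := X_law o => <-.
Qed.

(** Peeling off one draw at a time writes the function as a finite sum of restrictions to fibres,
    until nothing is left to depend on. *)
Lemma depends_on_measurable l f : depends_on l f ->
  measurable_fun setT (fun w => (f (Xv w))%:E).
Proof.
elim: l f => [|a l ih] f fl.
  rewrite (_ : (fun w => _) = cst (f (Xv point))%:E); first exact: measurable_cst.
  by apply/funext => w /=; congr EFin; apply: fl.
rewrite (_ : (fun w => _) = (fun w => \sum_(o : E a)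
    ((fun w => (f (dfwith (Xv w) o))%:E) \_ [set w | X a w = o]) w)%E).
  apply: emeasurable_sum => o; apply: measurable_fun_fiber.
  exact: ih _ (depends_on_dfwith o fl).
apply/funext => w; rewrite -(fiber_split (fun w o => (f (dfwith (Xv w) o))%:E)).
by rewrite dfwith_Xv.
Qed.

Let cyl s v := [set w | forall a, a \in s -> X a w = v a].

Lemma measurable_cyl s v : measurable (cyl s v).
Proof.
elim: s => [|a s ih].
  by rewrite (_ : cyl _ _ = setT)//; apply/seteqP; split => w //= _ b; rewrite in_nil.
rewrite (_ : cyl _ _ = [set w | X a w = v a] `&` cyl s v).
  by apply: measurableI => //; exact: measurable_fiber.
apply/seteqP; split => w /=.
  move=> h; split; first by apply: h; rewrite mem_head.
  by move=> b bs; apply: h; rewrite inE bs orbT.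
by move=> [h1 h2] b; rewrite inE => /orP[/eqP->//|/h2].
Qed.

(** Draws pass one by one from the free list [l] to the conditioned list [s]. When none is free, the
    function is constant on the cylinder, whose mass is a product by independence. *)
Lemma integral_cyl l s v f : uniq (s ++ l) -> depends_on (s ++ l) f ->
  (forall x, 0 <= f x) ->
  (\int[P]_(w in cyl s v) (f (Xv w))%:E =
   ((\prod_(a <- s) law (v a)) * avg law l f v)%:E)%E.
Proof.
elim: l s v => [|a l ih] s v us fs f0 /=.
  have -> : (\int[P]_(w in cyl s v) (f (Xv w))%:E =
      \int[P]_(w in cyl s v) (cst (f v)%:E w))%E.
    apply: eq_integral => w /set_mem ws /=; congr EFin; apply: fs => b.
    by rewrite cats0 => /ws.
  rewrite integral_cst; last exact: measurable_cyl.
  rewrite mulrC EFinM; congr (_ * _)%E.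
  have := X_indep (fun b => [set v b]) (s := s); rewrite cats0 in us => /(_ us).
  rewrite /cyl /= => ->; rewrite -prodEFin; apply: eq_bigr => b _.
  by have [_ ->] := X_law (v b).
have mf := depends_on_measurable fs.
have -> : (fun w => (f (Xv w))%:E) = (fun w => \sum_(o : E a)
    ((fun w => (f (dfwith (Xv w) o))%:E) \_ [set w | X a w = o]) w)%E.
  apply/funext => w; rewrite -(fiber_split (fun w o => (f (dfwith (Xv w) o))%:E)).
  by rewrite dfwith_Xv.
have := us; rewrite cat_uniq /= negb_or => /and3P[us1 /andP[as_ _] /andP[al ul]].
have us' : uniq ((a :: s) ++ l).
  by rewrite -cat_rcons in us; rewrite -(@perm_uniq _ (rcons s a ++ l))// perm_cat2r perm_rcons.
have fs' : depends_on ((a :: s) ++ l) f.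
  move=> x y xy; apply: fs => b hb; apply: xy; move: hb.
  by rewrite !(mem_cat, inE) orbCA orbA.
rewrite ge0_integral_sum//; last 3 first.
- exact: measurable_cyl.
- move=> o; apply: measurable_fun_fiber.
  apply: (depends_on_measurable (f := fun x => f (dfwith x o))).
  exact: depends_on_dfwith fs'.
- by move=> o w _; rewrite patchE; case: ifP => // _; rewrite lee_fin.
rewrite mulr_sumr -sumEFin; apply: eq_bigr => o _.
rewrite -integral_mkcondr.
have -> : cyl s v `&` [set w | X a w = o] = cyl (a :: s) (dfwith v o).
  apply/seteqP; split => w /=.
    move=> [h1 h2] b; rewrite inE => /orP[/eqP->|bs]; first by rewrite dfwith_in.
    by rewrite dfwith_out ?h1//; apply: contraNneq as_ => ->.
  move=> h; split; last by rewrite h ?mem_head// dfwith_in.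
  move=> b bs; rewrite h ?inE ?bs ?orbT// dfwith_out//.
  by apply: contraNneq as_ => ->.
have -> : (\int[P]_(w in cyl (a :: s) (dfwith v o)) (f (dfwith (Xv w) o))%:E =
    \int[P]_(w in cyl (a :: s) (dfwith v o)) (f (Xv w))%:E)%E.
  apply: eq_integral => w /set_mem /(_ a (mem_head _ _)).
  by rewrite dfwith_in => <-; rewrite dfwith_Xv.
rewrite ih// big_cons dfwith_in; congr EFin.
rewrite mulrCA mulrA; congr (_ * _ * _); apply: eq_big_seq => b bs.
by rewrite dfwith_out//; apply: contraNneq as_ => ->.
Qed.

Lemma expectation_avg l v f : uniq l -> depends_on l f -> (forall x, 0 <= f x) ->
  ('E_P[fun w => f (Xv w)] = (avg law l f v)%:E)%E.
Proof.
move=> ul fl f0; rewrite unlock.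
have := @integral_cyl l [::] v f ul fl f0; rewrite big_nil mul1r => <-.
by congr integral; apply/seteqP; split => w //= _ b; rewrite in_nil.
Qed.

End ExpectationAverage.

(** * Permutation compressors *)

Section ShuffleSymmetry.
Variables (R : realType) (S J A : finType) (ev : S -> J -> A) (r : nat).
Variable move_index : J -> J -> S -> S.
Hypothesis move_indexK : forall i j, involutive (move_index i j).
Hypothesis ev_move : forall i j s, ev (move_index i j s) i = ev s j.
Hypothesis ev_multiset : forall s (g : A -> R), \sum_j g (ev s j) = r%:R * \sum_a g a.

(** Double counting over positions: [move_index] shows that all positions contribute equally, and
    for a fixed shuffle the sum over positions runs [r] times through [A]. *)
Lemma shuffle_uniform (i : J) (g : A -> R) :
  #|J|%:R * \sum_s g (ev s i) = #|S|%:R * (r%:R * \sum_a g a).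
Proof.
transitivity (\sum_(j : J) \sum_s g (ev s j)).
  rewrite mulr_natl -sumr_const; apply: eq_bigr => j _.
  rewrite [RHS](reindex_inj (inv_inj (move_indexK j i))).
  by apply: eq_bigr => s _; rewrite ev_move.
rewrite exchange_big /=; under eq_bigr do rewrite ev_multiset.
by rewrite sumr_const -[LHS]mulr_natl.
Qed.

End ShuffleSymmetry.

Section Compressors.
Variables (R : realType) (d n r : nat).
Implicit Types u v : 'rV[R]_d.

Lemma dot_delta u a : dot u (delta_mx 0 a) = u 0 a.
Proof.
rewrite /dot (bigD1 a)//= !mxE !eqxx mulr1 big1 ?addr0// => i ia.
by rewrite !mxE eqxx (negPf ia) mulr0.
Qed.

Lemma word_tperm (f : {ffun 'I_n -> 'I_d}) i j a :
  #|[set k | [ffun k => f (tperm i j k)] k == a]%SET| = #|[set k | f k == a]%SET|.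
Proof.
rewrite -(card_imset _ (@perm_inj _ (tperm i j))).
congr (#|pred_of_set _|); apply/setP => k; rewrite [RHS]inE.
apply/imsetP/idP => [[k']|ks]; first by rewrite inE ffunE => /eqP <- ->.
by exists (tperm i j k); rewrite ?tpermK// inE ffunE tpermK.
Qed.

Lemma move_shuffleP i j (s : shuffle DimLeNodes d n r) :
  [forall a, #|[set k | [ffun k => val s (tperm i j k)] k == a]%SET| == r].
Proof. by apply/forallP => a; rewrite word_tperm; have /forallP := valP s. Qed.

Definition move_shuffle i j (s : shuffle DimLeNodes d n r) : shuffle DimLeNodes d n r :=
  exist _ [ffun k => val s (tperm i j k)] (move_shuffleP i j s).

Lemma word_count (f : {ffun 'I_n -> 'I_d}) (g : 'I_d -> R) :
  (forall a, #|[set i | f i == a]%SET| = r) -> \sum_i g (f i) = r%:R * \sum_a g a.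
Proof.
move=> fr; rewrite (partition_big f predT)//= mulr_sumr; apply: eq_bigr => a _.
rewrite -(fr a) mulr_natl -sumr_const; apply: eq_big => [k|k /eqP -> //].
by rewrite inE.
Qed.

Lemma shuffle_wordE (s : shuffle DimLeNodes d n r) (g : 'I_d -> R) :
  \sum_i g (val s i) = r%:R * \sum_a g a.
Proof. by apply: word_count => a; apply/eqP; have /forallP := valP s. Qed.

Lemma shuffle_perm_uniform (s0 : 'I_d) (g : 'I_d -> R) :
  d%:R * \sum_(s : {perm 'I_d}) g (s s0) = #|{perm 'I_d}|%:R * \sum_a g a.
Proof.
have := @shuffle_uniform R {perm 'I_d} 'I_d 'I_d (fun s i => s i) 1
  (fun i j s => (tperm i j * s)%g) _ _ _ s0 g.
rewrite card_ord mul1r; apply.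
- by move=> i j s; rewrite mulgA tperm2 mul1g.
- by move=> i j s; rewrite permM tpermL.
- by move=> s h; rewrite mul1r [RHS](reindex_inj (@perm_inj _ s)).
Qed.

Lemma shuffle_word_uniform (i : 'I_n) (g : 'I_d -> R) :
  n%:R * \sum_(s : shuffle DimLeNodes d n r) g (val s i) =
  #|shuffle DimLeNodes d n r|%:R * (r%:R * \sum_a g a).
Proof.
have := @shuffle_uniform R (shuffle DimLeNodes d n r) 'I_n 'I_d (fun s i => val s i) r
  move_shuffle _ _ _ i g.
rewrite card_ord; apply.
- by move=> j k s; apply/val_inj/ffunP => l /=; rewrite !ffunE tpermK.
- by move=> j k s /=; rewrite ffunE tpermL.
- exact: shuffle_wordE.
Qed.

Lemma block_ltn (i : 'I_n) (j : 'I_d) : d = (r * n)%N -> (0 < r)%N ->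
  (r * i <= j < r * i.+1)%N = (j %/ r == i)%N.
Proof.
move=> drn r0; rewrite mulnC -leq_divRL// mulnC -ltn_divLR// ltnS -eqn_leq.
by rewrite eq_sym.
Qed.

Lemma card_block (i : 'I_n) : d = (r * n)%N -> (0 < r)%N ->
  #|[pred j : 'I_d | (r * i <= j < r * i.+1)%N]| = r.
Proof.
move=> drn r0; rewrite -sum1_card -[RHS]card_ord -sum1_card.
have lt (j : 'I_r) : (r * i + j < d)%N.
  apply: (@leq_trans (r * i.+1)); last by rewrite drn leq_mul2l ltn_ord orbT.
  by rewrite mulnS addnC ltn_add2r.
rewrite (reindex (fun j : 'I_r => Ordinal (lt j)))//=.
  apply: eq_bigl => j; rewrite inE /= leq_addr mulnS addnC ltn_add2r.
  by rewrite ltn_ord.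
have gt (j : 'I_d) : (j %% r < r)%N by rewrite ltn_mod.
exists (fun j => Ordinal (gt j)) => j hj; apply: val_inj => /=.
  by rewrite mulnC modnMDl modn_small.
have {}hj : (r * i <= j < r * i.+1)%N by exact: hj. move: hj; rewrite (block_ltn i j drn r0) => /eqP <-; rewrite mulnC.
by rewrite -divn_eq.
Qed.

Variable c : regime.
Hypothesis hc : regime_ok c d n r.
Hypothesis n_gt0 : (0 < n)%N.
Hypothesis S_gt0 : (0 < #|shuffle c d n r|)%N.

Let Sn0 : (#|shuffle c d n r|%:R : R) != 0.
Proof. by rewrite pnatr_eq0 -lt0n. Qed.

Let nR0 : (n%:R : R) != 0. Proof. by rewrite pnatr_eq0 -lt0n. Qed.

(** Every position of the shuffle is uniform on the coordinates. A given coordinate reaches node [i]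
    with probability r / d = 1 / n in the first regime and 1 / d in the second, which the prefactor
    of the compressor undoes. *)
Lemma compressor_mean (i : 'I_n) u :
  \sum_(s : shuffle c d n r) #|shuffle c d n r|%:R^-1 *: compressor s i u = u.
Proof.
rewrite -scaler_sumr; apply: (scalerI Sn0); rewrite scalerA mulfV// scale1r.
apply/rowP => a; rewrite !mxE summxE.
case: c hc S_gt0 => [[r0 drn]|[r0 n1 nrd]] _ /=.
- have dR : (d%:R : R) = r%:R * n%:R by rewrite drn natrM.
  have dR0 : (d%:R : R) != 0.
    by rewrite dR mulf_neq0// pnatr_eq0 -lt0n.
  have step (s : {perm 'I_d}) :
      (n%:R *: (\sum_(j < d | (r * i <= j < r * i.+1)%N) u 0 (s j) *: delta_mx 0 (s j))) 0 a
      = \sum_(j < d | (r * i <= j < r * i.+1)%N) n%:R * (u 0 a * (s j == a)%:R).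
    rewrite !mxE summxE mulr_sumr; apply: eq_bigr => j _; rewrite !mxE eqxx /=.
    by congr (_ * _); rewrite eq_sym; case: eqP => [->//|_]; rewrite !mulr0.
  under eq_bigr do rewrite step.
  rewrite exchange_big /=; apply: (mulfI dR0); rewrite mulr_sumr.
  transitivity (\sum_(j < d | (r * i <= j < r * i.+1)%N)
      n%:R * u 0 a * #|{perm 'I_d}|%:R).
    apply: eq_bigr => j _.
    transitivity (n%:R * u 0 a * (d%:R * \sum_(s : {perm 'I_d}) (s j == a)%:R)).
      by rewrite [RHS]mulrCA; congr (_ * _); rewrite mulr_sumr; apply: eq_bigr => s _; rewrite mulrA.
    rewrite (shuffle_perm_uniform j (fun b => (b == a)%:R)); congr (_ * _).
    rewrite (bigD1 a)//= eqxx big1 ?addr0 ?mulr1// => b /negPf ->.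
    by [].
  rewrite sumr_const card_block// dR -mulr_natl; ring.
- have nR : (n%:R : R) = r%:R * d%:R by rewrite nrd natrM.
  transitivity (\sum_(s : shuffle DimLeNodes d n r) d%:R * u 0 a * (val s i == a)%:R).
    apply: eq_bigr => s _; rewrite !mxE eqxx /= -mulrA; congr (_ * _).
    by rewrite eq_sym; case: eqP => [->//|_]; rewrite !mulr0.
  rewrite -mulr_sumr; apply: (mulfI nR0); rewrite mulrCA.
  rewrite (shuffle_word_uniform i (fun b => (b == a)%:R)).
  rewrite [\sum_b _](bigD1 a)//= eqxx big1 ?addr0 ?mulr1; last by move=> b /negPf ->.
  by rewrite nR; ring.
Qed.

(** In the first regime the blocks of the nodes are disjoint, so no cross terms arise and equality
    holds. In the second, the [r] nodes sharing a coordinate are combined by Cauchy-Schwarz. *)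
Lemma compressor_second_moment (v : 'I_n -> 'rV[R]_d) :
  \sum_(s : shuffle c d n r) #|shuffle c d n r|%:R^-1 *
    dot (n%:R^-1 *: \sum_(i < n) compressor s i (v i)) (n%:R^-1 *: \sum_(i < n) compressor s i (v i))
  <= n%:R^-1 * \sum_(i < n) dot (v i) (v i).
Proof.
rewrite -mulr_sumr mulrC ler_pdivrMr ?ltr0n//.
case: c hc S_gt0 => [[r0 drn]|[r0 n1 nrd]] _ /=.
- have dR : (d%:R : R) = r%:R * n%:R by rewrite drn natrM.
  have dn0 : (0 < d)%N.
  - by rewrite drn muln_gt0 r0.
  have dR0 : (d%:R : R) != 0 by rewrite pnatr_eq0 -lt0n.
  have bl (j : 'I_d) : (j %/ r < n)%N by rewrite ltn_divLR// mulnC -drn.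
  pose blk (j : 'I_d) := Ordinal (bl j).
  have step (s : {perm 'I_d}) :
      n%:R^-1 *: \sum_(i < n) (n%:R *: \sum_(j < d | (r * i <= j < r * i.+1)%N)
        v i 0 (s j) *: delta_mx 0 (s j)) =
      \sum_(j < d) v (blk j) 0 (s j) *: delta_mx 0 (s j) :> 'rV[R]_d.
    rewrite -scaler_sumr scalerA mulVf// scale1r.
    rewrite [RHS](partition_big blk predT)//=; apply: eq_bigr => i _.
    apply: eq_big => [j|j].
      by rewrite (block_ltn i j drn r0) -val_eqE.
    by rewrite (block_ltn i j drn r0) => /eqP h; congr (v _ 0 _ *: _); apply: val_inj.
  have norm (s : {perm 'I_d}) :
      dot (\sum_(j < d) v (blk j) 0 (s j) *: delta_mx 0 (s j))
          (\sum_(j < d) v (blk j) 0 (s j) *: delta_mx 0 (s j)) =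
      \sum_(j < d) v (blk j) 0 (s j) ^+ 2.
    rewrite dot_sumr; apply: eq_bigr => j _.
    rewrite dotZr dot_delta expr2; congr (_ * _).
    rewrite summxE (bigD1 j)//= !mxE !eqxx mulr1 big1 ?addr0// => k kj.
    by rewrite !mxE eqxx (inj_eq perm_inj) eq_sym (negPf kj) mulr0.
  under eq_bigr do rewrite step norm.
  rewrite exchange_big /= -(ler_pM2l (_ : 0 < d%:R)) ?ltr0n//.
  have -> : d%:R * (\sum_(j < d) \sum_(s : {perm 'I_d}) v (blk j) 0 (s j) ^+ 2) =
      #|{perm 'I_d}|%:R * \sum_(j < d) \sum_a v (blk j) 0 a ^+ 2.
    rewrite !mulr_sumr; apply: eq_bigr => j _.
    exact: (shuffle_perm_uniform j (fun b => v (blk j) 0 b ^+ 2)).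
  rewrite (partition_big blk predT)//=.
  have -> : \sum_(i < n) \sum_(j | blk j == i) \sum_a v (blk j) 0 a ^+ 2 =
      r%:R * \sum_(i < n) dot (v i) (v i).
    rewrite mulr_sumr; apply: eq_bigr => i _.
    rewrite -[in RHS](card_block i drn r0) mulr_natl -sumr_const.
    apply: eq_big => [j|j].
      by rewrite [RHS]inE (block_ltn i j drn r0) -val_eqE.
    by move=> /eqP ->; apply: eq_bigr => a _; rewrite expr2.
  rewrite dR le_eqVlt; apply/orP; left; apply/eqP; field.
  exact: nR0.
- have nR : (n%:R : R) = r%:R * d%:R by rewrite nrd natrM.
  have dR0 : (d%:R : R) != 0 by apply: contraNneq nR0 => h; rewrite nR h mulr0.
  have rR0 : (r%:R : R) != 0 by rewrite pnatr_eq0 -lt0n.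
  have step (s : shuffle DimLeNodes d n r) :
      dot (n%:R^-1 *: \sum_(i < n) d%:R *: (v i 0 (val s i) *: delta_mx 0 (val s i)))
          (n%:R^-1 *: \sum_(i < n) d%:R *: (v i 0 (val s i) *: delta_mx 0 (val s i)))
      <= r%:R^-1 * \sum_(i < n) v i 0 (val s i) ^+ 2.
    rewrite -scaler_sumr scalerA {1}/dot.
    have -> : n%:R^-1 * d%:R = r%:R^-1 :> R by rewrite nR; field; rewrite rR0.
    rewrite [\sum_(i < n) v i 0 _ ^+ 2](partition_big (fun i : 'I_n => val s i) predT)//=.
    rewrite mulr_sumr; apply: ler_sum => a _.
    have -> : (r%:R^-1 *: (\sum_(i < n) v i 0 (val s i) *: delta_mx 0 (val s i) : 'rV[R]_d)) 0 a
        = r%:R^-1 * \sum_(i | val s i == a) v i 0 a.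
      rewrite !mxE summxE; congr (_ * _); rewrite [RHS]big_mkcond; apply: eq_bigr => i _.
      by rewrite !mxE eqxx /= eq_sym; case: eqP => [->|_]; rewrite ?mulr1 ?mulr0.
    have card : r = #|[set i | val s i == a]%SET|.
      by apply/esym/eqP; have /forallP := valP s.
    have -> : \sum_(i | val s i == a) v i 0 (val s i) ^+ 2 =
        \sum_(i | val s i == a) v i 0 a ^+ 2 by apply: eq_bigr => i /eqP ->.
    have -> : r%:R^-1 * (\sum_(i | val s i == a) v i 0 a) *
        (r%:R^-1 * \sum_(i | val s i == a) v i 0 a) =
        r%:R^-1 * (r%:R^-1 * (\sum_(i | val s i == a) v i 0 a) ^+ 2) by ring.
    rewrite ler_pM2l ?invr_gt0 ?ltr0n// mulrC ler_pdivrMr ?ltr0n//.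
    set T := \sum_(i | val s i == a) v i 0 a.
    (* Exactly [r] nodes share the coordinate [a]; Cauchy-Schwarz for their average is the
       nonnegativity of this variance, written without division. *)
    have : 0 <= \sum_(i | val s i == a) (r%:R * v i 0 a - T) ^+ 2.
      by apply: sumr_ge0 => i _; exact: sqr_ge0.
    have -> : \sum_(i | val s i == a) (r%:R * v i 0 a - T) ^+ 2 =
        r%:R ^+ 2 * (\sum_(i | val s i == a) v i 0 a ^+ 2) - r%:R * T ^+ 2.
      transitivity (\sum_(i | val s i == a)
          (r%:R ^+ 2 * v i 0 a ^+ 2 + (- (2 * r%:R * T) * v i 0 a + T ^+ 2))).
        by apply: eq_bigr => i _; ring.
      rewrite big_split big_split /=.
      have -> : \sum_(i < n | val s i == a) T ^+ 2 = r%:R * T ^+ 2.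
        rewrite mulr_natl [in RHS]card -sumr_const; apply: eq_bigl => i.
        by rewrite inE.
      by rewrite -!mulr_sumr -/T; ring.
    have rp : (0 : R) < r%:R by rewrite ltr0n.
    rewrite subr_ge0 expr2 -mulrA ler_pM2l//; lra.
  apply: (@le_trans _ _ (\sum_(s : shuffle DimLeNodes d n r)
      r%:R^-1 * \sum_(i < n) v i 0 (val s i) ^+ 2)).
    by apply: ler_sum => s _; exact: step.
  rewrite -mulr_sumr exchange_big /=.
  have -> : \sum_(i < n) \sum_(s : shuffle DimLeNodes d n r) v i 0 (val s i) ^+ 2 =
      \sum_(i < n) n%:R^-1 * (#|shuffle DimLeNodes d n r|%:R * (r%:R * dot (v i) (v i))).
    apply: eq_bigr => i _; apply: (mulfI nR0).
    rewrite (shuffle_word_uniform i (fun a => v i 0 a ^+ 2)) mulVKf//.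
  rewrite -!mulr_sumr le_eqVlt; apply/orP; left; apply/eqP; field.
  by rewrite nR0 rR0.
Qed.

End Compressors.

(** * Lists of draws *)

Section AverageOfFewDraws.
Variables (R : realType) (I : eqType) (E : I -> finType) (law : forall a, E a -> R).
Hypothesis law_sum : forall a, \sum_(o : E a) law o = 1.

Lemma avg_single l a (h : E a -> R) v : uniq l -> a \in l ->
  avg law l (fun x => h (x a)) v = \sum_(o : E a) law o * h o.
Proof.
elim: l v => [|b l ih] v //= /andP[bl ul]; rewrite inE => /orP[/eqP ab|al].
  subst b; apply: eq_bigr => o _; congr (_ * _); apply: avg_const => // y hy.
  by rewrite (agree_off_dfwith bl hy).
under eq_bigr do rewrite ih//.
by rewrite -mulr_suml law_sum mul1r.
Qed.

Lemma avg_pair l a b (h : E a -> E b -> R) v : uniq l -> a \in l -> b \in l -> a != b ->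
  avg law l (fun x => h (x a) (x b)) v =
  \sum_(o : E a) law o * (\sum_(o' : E b) law o' * h o o').
Proof.
elim: l v => [|e l ih] v //= /andP[el ul]; rewrite !inE => al bl ab.
have [ea|ea] := eqVneq e a.
  subst e; rewrite eq_sym (negPf ab)/= in bl.
  apply: eq_bigr => o _; congr (_ * _).
  rewrite -(avg_single (h o) (dfwith v o) ul bl); apply: avg_eq => y hy.
  by rewrite (agree_off_dfwith el hy).
rewrite eq_sym (negPf ea)/= in al.
have [eb|eb] := eqVneq e b.
  subst e; rewrite [RHS](eq_bigr (fun o => \sum_(o' : E b) law o' * (law o * h o o'))).
    rewrite exchange_big; apply: eq_bigr => o _ /=; rewrite -mulr_sumr; congr (_ * _).
    rewrite -(avg_single (fun o' => h o' o) (dfwith v o) ul al); apply: avg_eq => y hy.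
    by rewrite (agree_off_dfwith el hy).
  by move=> o _; rewrite mulr_sumr; apply: eq_bigr => o' _; rewrite mulrCA.
rewrite eq_sym (negPf eb)/= in bl.
under eq_bigr do rewrite ih//.
by rewrite -mulr_suml law_sum mul1r.
Qed.

End AverageOfFewDraws.

Section DrawLists.
Variables (n H : nat).

Definition inner_draws (k : nat) (ts : seq 'I_H) : seq (draw n H) :=
  flatten [seq [:: InnerIndex k t; AnchorCoin k t] | t <- ts].

Definition node_draws (k : nat) : seq (draw n H) :=
  [seq NodeIndex k i | i <- enum 'I_n].

Definition outer_draws (k : nat) : seq (draw n H) :=
  node_draws k ++ [:: @Shuffle n H k; @RefCoin n H k].

Definition step_draws (k : nat) : seq (draw n H) :=
  inner_draws k (enum 'I_H) ++ outer_draws k.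

Definition all_draws (K : nat) : seq (draw n H) :=
  flatten [seq step_draws k | k <- iota 0 K].

Definition iteration (a : draw n H) : nat :=
  match a with
  | InnerIndex k _ | AnchorCoin k _ | NodeIndex k _ | Shuffle k | RefCoin k => k
  end.

Lemma mem_inner_draws a k ts : (a \in inner_draws k ts) ->
  exists2 t, t \in ts & a = InnerIndex k t \/ a = AnchorCoin k t.
Proof.
move=> /flattenP[s /mapP[t tts ->]]; rewrite !inE => /orP[/eqP ->|/eqP ->]; exists t => //.
  by left.
by right.
Qed.

Lemma uniq_inner_draws k ts : uniq ts -> uniq (inner_draws k ts).
Proof.
elim: ts => // t ts ih /= /andP[tts uts]; rewrite inE negb_or.
have nI : InnerIndex k t \notin inner_draws k ts.
  by apply/negP => /mem_inner_draws[t' t's [[e]|]]//; rewrite e t's in tts.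
have nA : AnchorCoin k t \notin inner_draws k ts.
  by apply/negP => /mem_inner_draws[t' t's [|[e]]]//; rewrite e t's in tts.
by rewrite nI nA ih// !andbT; apply/eqP.
Qed.

Lemma mem_node_draws a k : (a \in node_draws k) -> exists i, a = NodeIndex k i.
Proof. by move=> /mapP[i _ ->]; exists i. Qed.

Lemma uniq_node_draws k : uniq (node_draws k).
Proof. by rewrite map_inj_uniq ?enum_uniq// => i j [->]. Qed.

Lemma uniq_outer_draws k : uniq (outer_draws k).
Proof.
rewrite cat_uniq uniq_node_draws /= inE andbT; apply/andP; split; last exact/eqP.
by rewrite !negb_or andbT; apply/andP; split; apply/negP => /mem_node_draws[i].
Qed.

Lemma iteration_step_draws a k : a \in step_draws k -> iteration a = k.
Proof.
rewrite !mem_cat => /or3P[/mem_inner_draws[t _ [->|->]]|/mem_node_draws[i ->]|]//.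
by rewrite !inE => /orP[/eqP->|/eqP->].
Qed.

Lemma uniq_step_draws k : uniq (step_draws k).
Proof.
rewrite cat_uniq uniq_inner_draws ?enum_uniq// uniq_outer_draws andbT /=.
apply/hasPn => a; rewrite mem_cat => ha; apply/negP => /mem_inner_draws[t _ ht].
move: ha => /orP[/mem_node_draws[i ai]|]; first by case: ht; rewrite ai.
by rewrite !inE => /orP[] /eqP ae; case: ht; rewrite ae.
Qed.

Lemma all_drawsS K : all_draws K.+1 = all_draws K ++ step_draws K.
Proof. by rewrite /all_draws -addn1 iotaD map_cat flatten_cat /= cats0. Qed.

Lemma iteration_all_draws a K : a \in all_draws K -> (iteration a < K)%N.
Proof.
elim: K => [|K ih] //; rewrite all_drawsS mem_cat => /orP[/ih/leqW//|].
by move=> /iteration_step_draws ->.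
Qed.

Lemma uniq_all_draws K : uniq (all_draws K).
Proof.
elim: K => [|K ih] //; rewrite all_drawsS cat_uniq ih uniq_step_draws andbT /=.
apply/hasPn => a /iteration_step_draws aK; apply/negP => /iteration_all_draws.
by rewrite aK ltnn.
Qed.

Lemma mem_outer_draws k : [/\ forall i, NodeIndex k i \in outer_draws k,
  @Shuffle n H k \in outer_draws k & @RefCoin n H k \in outer_draws k].
Proof.
split=> [i||]; rewrite mem_cat ?inE ?eqxx ?orbT//.
by rewrite map_f ?mem_enum.
Qed.

End DrawLists.

(** * The inner loop as a Markov chain *)

Section InnerChain.
Variables (R : realType) (c : regime) (d n r M H : nat) (p q : R).
Let E : draw n H -> finType := fun a => outcome c d r M a.
Let lw : forall a : draw n H, outcome c d r M a -> R := draw_law p q.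
Variables (S : Type) (step : 'I_M -> bool -> S -> S).

(** Markov operator of one inner step. By [avg_inner_chain], averaging over all inner draws is its
    iterate, and the later rates are about this operator alone. *)
Definition chain_op (g : S -> R) (s : S) : R :=
  \sum_(j < M) M%:R^-1 * \sum_(b : bool) (if b then q else 1 - q) * g (step j b s).

Lemma avg_inner_chain k (ts : seq 'I_H) (g : S -> R) s v : uniq ts ->
  avg lw (inner_draws n k ts)
    (fun x => g (foldl (fun s t => step (x (InnerIndex k t)) (x (AnchorCoin k t)) s) s ts)) v
  = iter (size ts) chain_op g s.
Proof.
elim: ts s v => [|t ts ih] s v //= /andP[tts uts].
apply: eq_bigr => j _; congr (_ * _); apply: eq_bigr => b _; congr (_ * _).
rewrite -(ih _ (@eqtype.dfwith _ _ (@eqtype.dfwith _ _ v (InnerIndex k t) j) (AnchorCoin k t) b))//; apply: avg_eq => y hy.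
have nI : InnerIndex k t \notin inner_draws n k ts.
  by apply/negP => /mem_inner_draws[t' t's [[e]|]]//; rewrite e t's in tts.
have nA : AnchorCoin k t \notin inner_draws n k ts.
  by apply/negP => /mem_inner_draws[t' t's [|[e]]]//; rewrite e t's in tts.
rewrite -(hy _ nI) -(hy _ nA) dfwith_in dfwith_out ?dfwith_in//.
exact/eqP.
Qed.

Hypotheses (q_ge0 : 0 <= q) (q_le1 : q <= 1) (M_gt0 : (0 < M)%N).

Lemma chain_op_le (f g : S -> R) s : (forall j b, f (step j b s) <= g (step j b s)) ->
  chain_op f s <= chain_op g s.
Proof.
move=> fg; apply: ler_sum => j _; rewrite ler_wpM2l ?invr_ge0//; apply: ler_sum => b _.
by rewrite ler_wpM2l//; case: b => //; rewrite subr_ge0.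
Qed.

Lemma iter_chain_le (Inv : S -> Prop) (g : S -> R) (a : R) N s :
  0 <= a -> (forall s j b, Inv s -> Inv (step j b s)) ->
  (forall s, Inv s -> chain_op g s <= a * g s) -> Inv s ->
  iter N chain_op g s <= a ^+ N * g s.
Proof.
move=> a0 hI hg; elim: N s => [|N ih] s Is; first by rewrite expr0 mul1r.
rewrite iterSr exprSr -mulrA.
have mono N' (f h : S -> R) s' : Inv s' -> (forall s, Inv s -> f s <= h s) ->
    iter N' chain_op f s' <= iter N' chain_op h s'.
  elim: N' s' => [|N' ihN] s' Is' fh /=; first exact: fh.
  by apply: chain_op_le => j b; apply: ihN => //; exact: hI.
apply: (le_trans (mono N _ (fun s => a * g s) s Is hg)).
have -> : iter N chain_op (fun s => a * g s) s = a * iter N chain_op g s.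
  elim: (N) (s) => [|N' ihN] s' //=.
  rewrite /chain_op mulr_sumr; apply: eq_bigr => j _; rewrite mulrCA; congr (_ * _).
  by rewrite mulr_sumr; apply: eq_bigr => b _; rewrite ihN mulrCA.
by rewrite mulrCA ler_wpM2l// ih.
Qed.

Lemma chain_opD (f g : S -> R) s : chain_op (fun s => f s + g s) s = chain_op f s + chain_op g s.
Proof.
rewrite /chain_op -big_split; apply: eq_bigr => j _ /=; rewrite -mulrDr -big_split.
by congr (_ * _); apply: eq_bigr => b _; rewrite mulrDr.
Qed.

Lemma chain_opZ (a : R) (f : S -> R) s : chain_op (fun s => a * f s) s = a * chain_op f s.
Proof.
rewrite /chain_op mulr_sumr; apply: eq_bigr => j _; rewrite mulrCA; congr (_ * _).
by rewrite mulr_sumr; apply: eq_bigr => b _; rewrite mulrCA.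
Qed.

End InnerChain.

(** * Operators and the inner problem *)

Section Operators.
Variables (R : realType) (d n M : nat) (Z : set 'rV[R]_d).
Variables (F : 'I_n -> 'I_M -> 'rV[R]_d -> 'rV[R]_d) (i1 : 'I_n).
Hypotheses (n_gt0 : (0 < n)%N) (M_gt0 : (0 < M)%N).
Implicit Types u v m z y : 'rV[R]_d.

Let MR0 : (M%:R : R) != 0. Proof. by rewrite pnatr_eq0 -lt0n. Qed.
Let nR0 : (n%:R : R) != 0. Proof. by rewrite pnatr_eq0 -lt0n. Qed.

(** Mean of the compressed correction added after the inner loop, without its factor [gamma]. *)
Definition gap m u := full_op F m - node_op F i1 m - full_op F u + node_op F i1 u.

Lemma node_opB i u v :
  node_op F i u - node_op F i v = M%:R^-1 *: \sum_(j < M) (F i j u - F i j v).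
Proof. by rewrite /node_op -scalerBr -sumrB. Qed.

Lemma full_opB u v :
  full_op F u - full_op F v = n%:R^-1 *: \sum_(i < n) (node_op F i u - node_op F i v).
Proof. by rewrite /full_op -scalerBr -sumrB. Qed.

Section Lipschitz.
Variable L : R.
Hypothesis F_lip : mean_square_lipschitz Z F L.

Lemma F_lipE i u v : Z u -> Z v ->
  M%:R^-1 * \sum_(j < M) dot (F i j u - F i j v) (F i j u - F i j v)
  <= L ^+ 2 * dot (u - v) (u - v).
Proof.
move=> Zu Zv; have := F_lip i Zu Zv; rewrite enorm_sqr.
by under eq_bigr do rewrite enorm_sqr.
Qed.

Lemma node_op_lip i u v : Z u -> Z v ->
  dot (node_op F i u - node_op F i v) (node_op F i u - node_op F i v)
  <= L ^+ 2 * dot (u - v) (u - v).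
Proof.
move=> Zu Zv; rewrite node_opB; apply: le_trans (F_lipE i Zu Zv).
by apply: jensen_dot; rewrite card_ord.
Qed.

Lemma full_op_lip u v : Z u -> Z v ->
  dot (full_op F u - full_op F v) (full_op F u - full_op F v)
  <= L ^+ 2 * dot (u - v) (u - v).
Proof.
move=> Zu Zv; rewrite full_opB.
apply: le_trans (jensen_dot _ _) _; first by rewrite card_ord.
rewrite ler_pdivrMl ?ltr0n// mulr_natl -[n in _ *+ n]card_ord -sumr_const.
by apply: ler_sum => i _; exact: node_op_lip.
Qed.

(** Each of the two increments contributes 2 L^2. The constant 2 L replaces [delta] for small steps,
    where gamma L is tiny while gamma delta is only known to be at most sqrt p / 4. *)
Lemma F_similar_of_lip : mean_square_similar Z F (2 * L).
Proof.
move=> i u v Zu Zv; rewrite enorm_sqr.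
pose D := dot (u - v) (u - v).
pose a i j := dot (F i j u - F i j v) (F i j u - F i j v).
have le1 i2 j1 j2 : enorm (F i j1 u - F i2 j2 u - F i j1 v + F i2 j2 v) ^+ 2
    <= 2 * a i j1 + 2 * a i2 j2.
  rewrite enorm_sqr.
  have -> : F i j1 u - F i2 j2 u - F i j1 v + F i2 j2 v =
      (F i j1 u - F i j1 v) + - (F i2 j2 u - F i2 j2 v).
    by apply/rowP => k; rewrite !mxE; ring.
  by apply: le_trans (dot_addr_le2 _ _) _; rewrite dotNl dotNr opprK.
apply: (@le_trans _ _ ((n%:R * M%:R ^+ 2)^-1 * \sum_(i2 < n) \sum_(j1 < M) \sum_(j2 < M)
    (2 * a i j1 + 2 * a i2 j2))).
  rewrite ler_wpM2l ?invr_ge0 ?mulr_ge0 ?exprn_ge0//.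
  by apply: ler_sum => i2 _; apply: ler_sum => j1 _; apply: ler_sum => j2 _.
pose A k := \sum_(j < M) a k j.
have Ale k : A k <= M%:R * (L ^+ 2 * D).
  by rewrite -ler_pdivrMl ?ltr0n//; exact: F_lipE.
have -> : \sum_(i2 < n) \sum_(j1 < M) \sum_(j2 < M) (2 * a i j1 + 2 * a i2 j2) =
    \sum_(i2 < n) (2 * M%:R * A i + 2 * M%:R * A i2).
  apply: eq_bigr => i2 _.
  transitivity (\sum_(j1 < M) (2 * M%:R * a i j1 + 2 * A i2)).
    apply: eq_bigr => j1 _; rewrite big_split /= sumr_const card_ord -mulr_sumr.
    by rewrite -/(A i2) -mulr_natr; ring.
  rewrite big_split /= -mulr_sumr -/(A i) sumr_const card_ord -mulr_natr; ring.
apply: (@le_trans _ _ ((n%:R * M%:R ^+ 2)^-1 * \sum_(i2 < n) (4 * M%:R ^+ 2 * (L ^+ 2 * D)))).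
  rewrite ler_wpM2l ?invr_ge0 ?mulr_ge0 ?exprn_ge0//; apply: ler_sum => i2 _.
  have h1 := Ale i; have h2 := Ale i2.
  have M0 : (0 : R) <= M%:R by [].
  have := ler_wpM2l M0 h1; have := ler_wpM2l M0 h2; lra.
rewrite sumr_const card_ord -mulr_natr -/D le_eqVlt; apply/orP; left; apply/eqP.
by field; rewrite MR0.
Qed.

End Lipschitz.

Section Similar.
Variable S : R.
Hypothesis F_sim : mean_square_similar Z F S.

Lemma gapB m u v : gap m u - gap m v =
  - (full_op F u - full_op F v - (node_op F i1 u - node_op F i1 v)).
Proof. by apply/rowP => k; rewrite !mxE; ring. Qed.

(** The difference of two gaps is the average of the similarity increments over all triples of
    indices, so Jensen's inequality applies. *)
Lemma gap_lip m u v : Z u -> Z v ->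
  dot (gap m u - gap m v) (gap m u - gap m v) <= S ^+ 2 * dot (u - v) (u - v).
Proof.
move=> Zu Zv; have := F_sim i1 Zu Zv; rewrite enorm_sqr; apply: le_trans.
pose f (t : 'I_n * 'I_M * 'I_M) :=
  F i1 t.1.2 u - F t.1.1 t.2 u - F i1 t.1.2 v + F t.1.1 t.2 v.
have cardI : (n * M * M)%N = #|{: 'I_n * 'I_M * 'I_M}| by rewrite !card_prod !card_ord.
have -> : n%:R * M%:R ^+ 2 = (n * M * M)%:R :> R by rewrite !natrM; ring.
have -> : \sum_(i2 < n) \sum_(j1 < M) \sum_(j2 < M)
    enorm (F i1 j1 u - F i2 j2 u - F i1 j1 v + F i2 j2 v) ^+ 2 = \sum_t dot (f t) (f t).
  rewrite pair_bigA pair_bigA /=.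
  by apply: eq_bigr => -[[i2 j1] j2] _ /=; rewrite enorm_sqr.
have -> : gap m u - gap m v = (n * M * M)%:R^-1 *: \sum_t f t; last exact: jensen_dot.
rewrite gapB.
have -> : \sum_t f t = \sum_(i2 < n) \sum_(j1 < M) \sum_(j2 < M)
    ((F i1 j1 u - F i1 j1 v) - (F i2 j2 u - F i2 j2 v)).
  rewrite pair_bigA pair_bigA /=.
  apply: eq_bigr => -[[i2 j1] j2] _ /=; rewrite /f /=.
  by apply/rowP => k; rewrite !mxE; ring.
have -> : \sum_(i2 < n) \sum_(j1 < M) \sum_(j2 < M)
    ((F i1 j1 u - F i1 j1 v) - (F i2 j2 u - F i2 j2 v)) =
    (n * M * M)%:R *: ((node_op F i1 u - node_op F i1 v) - (full_op F u - full_op F v)).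
  have e1 i : \sum_(j < M) (F i j u - F i j v) = M%:R *: (node_op F i u - node_op F i v).
    by rewrite node_opB scalerA mulfV// scale1r.
  have e2 : \sum_(i < n) (node_op F i u - node_op F i v) =
      n%:R *: (full_op F u - full_op F v).
    by rewrite full_opB scalerA mulfV// scale1r.
  transitivity (\sum_(i2 < n) (M * M)%:R *: ((node_op F i1 u - node_op F i1 v) -
      (node_op F i2 u - node_op F i2 v))).
    apply: eq_bigr => i2 _.
    under eq_bigr do rewrite sumrB sumr_const card_ord e1.
    rewrite sumrB sumrMnl e1 sumr_const card_ord -mulrnBl -scalerBr.
    by rewrite -[LHS]scaler_nat scalerA -natrM.
  rewrite -scaler_sumr sumrB e2 sumr_const card_ord -[X in _ *: (X - _)]scaler_nat -scalerBr scalerA.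
  by rewrite -natrM mulnC mulnA.
rewrite scalerA mulVf ?scale1r ?opprB//.
by rewrite pnatr_eq0 -lt0n !muln_gt0 n_gt0 M_gt0.
Qed.

Lemma gap_refl m : gap m m = 0.
Proof. by apply/rowP => k; rewrite !mxE; ring. Qed.

Lemma gap_le m u : Z u -> Z m -> dot (gap m u) (gap m u) <= S ^+ 2 * dot (u - m) (u - m).
Proof. by move=> Zu Zm; have := gap_lip m Zu Zm; rewrite gap_refl subr0. Qed.

End Similar.

Section Hat.
Variable L : R.
Hypothesis F_lip : mean_square_lipschitz Z F L.
Hypotheses (Z_nonempty : Z !=set0) (Z_closed : closed Z) (Z_convex : convex_set Z).
Hypothesis F_mono : forall i, monotone_on Z (node_op F i).
Variables (gamma p : R).
Hypothesis gamma_gt0 : 0 < gamma.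

Definition drift m u := node_op F i1 u - node_op F i1 m + full_op F m.

(* The exact solution approximated by the inner loop, and the resulting
   element of the normal cone. *)
Definition normal_of z m u := z + p *: (m - z) - u - gamma *: drift m u.

Definition is_hat z m u := Z u /\ forall y, Z y -> dot (normal_of z m u) (y - u) <= 0.

(** Divided by [gamma], the inclusion is a variational inequality whose operator is strongly
    monotone with constant 1 / gamma: the proximal term provides it, node 1 being merely
    monotone. *)
Lemma hat_exists z m : exists u, is_hat z m u.
Proof.
pose G u := drift m u + gamma^-1 *: (u - (z + p *: (m - z))).
have GB u v : G u - G v = (node_op F i1 u - node_op F i1 v) + gamma^-1 *: (u - v).
  by apply/rowP => k; rewrite !mxE; ring.
have gi : 0 < gamma^-1 by rewrite invr_gt0.
have K0 : 0 <= 2 * L ^+ 2 + 2 * gamma^-1 ^+ 2 by rewrite addr_ge0// mulr_ge0// sqr_ge0.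
have G_strong u v : Z u -> Z v ->
    gamma^-1 * dot (u - v) (u - v) <= dot (G u - G v) (u - v).
  by move=> Zu Zv; rewrite GB [leRHS]dotDl dotZl lerDr; exact: (F_mono i1 Zu Zv).
have G_lip u v : Z u -> Z v -> dot (G u - G v) (G u - G v) <=
    (2 * L ^+ 2 + 2 * gamma^-1 ^+ 2) * dot (u - v) (u - v).
  move=> Zu Zv; rewrite GB; apply: (le_trans (dot_addr_le2 _ _)); rewrite dotZl dotZr.
  have := node_op_lip F_lip i1 Zu Zv; lra.
have [u [Zu uP]] := vi_exists Z_nonempty Z_closed Z_convex gi K0 G_strong G_lip.
exists u; split => // y /uP.
have -> : normal_of z m u = - (gamma *: G u).
  apply/rowP => k; rewrite /normal_of /G !mxE; field.
  by rewrite lt0r_neq0//= nR0 MR0.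
by rewrite dotNl dotZl oppr_le0 pmulr_rge0.
Qed.

End Hat.

End Operators.

Lemma dot_add_scale (R : realType) (d : nat) (u v : 'rV[R]_d) (t : R) :
  dot (u + t *: v) (u + t *: v) = dot u u + 2 * t * dot u v + t ^+ 2 * dot v v.
Proof. by rewrite !dotE (dotC v u); ring. Qed.

(** * Averaging over the draws of the outer step *)

Section OuterAverage.
Variables (R : realType) (c : regime) (d n r M H : nat) (p q : R).
Let lw : forall a : draw n H, outcome c d r M a -> R := draw_law p q.
Hypothesis lw_sum : forall a : draw n H, \sum_(o : outcome c d r M a) lw o = 1.
Hypothesis lw_ge0 : forall (a : draw n H) (o : outcome c d r M a), 0 <= lw o.
Hypothesis hc : regime_ok c d n r.
Hypotheses (n_gt0 : (0 < n)%N) (M_gt0 : (0 < M)%N).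
Variables (Z : set 'rV[R]_d) (F : 'I_n -> 'I_M -> 'rV[R]_d -> 'rV[R]_d) (i1 : 'I_n).
Variable S : R.
Hypothesis F_sim : mean_square_similar Z F S.

Lemma shuffle_gt0 : (0 < #|shuffle c d n r|)%N.
Proof.
rewrite lt0n; apply/negP => /eqP h0; have := lw_sum (@Shuffle n H 0).
rewrite /lw /= sumr_const h0 => /eqP; rewrite mulr0n eq_sym oner_eq0.
by [].
Qed.

Definition centered_increment (m u : 'rV[R]_d) (j : 'I_n -> 'I_M) (i : 'I_n) : 'rV[R]_d :=
  F i (j i) m - F i1 (j i1) m - F i (j i) u + F i1 (j i1) u.

Definition correction m u (x : forall a : draw n H, outcome c d r M a) k : 'rV[R]_d :=
  n%:R^-1 *: \sum_(i < n) compressor (x (@Shuffle n H k)) i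
    (centered_increment m u (fun i => x (@NodeIndex n H k i)) i).

Lemma avg_node (k : nat) (i : 'I_n) (h : 'I_M -> R) v :
  avg lw (node_draws n H k) (fun x => h (x (@NodeIndex n H k i))) v = M%:R^-1 * \sum_(j < M) h j.
Proof.
rewrite (avg_single lw_sum (a := @NodeIndex n H k i) h) ?uniq_node_draws//.
  by rewrite mulr_sumr.
by rewrite map_f ?mem_enum.
Qed.

Lemma dot_node_op (y u : 'rV[R]_d) i :
  M%:R^-1 * \sum_(j < M) dot y (F i j u) = dot y (node_op F i u).
Proof. by rewrite /node_op dotZr dot_sumr. Qed.

Lemma avg_increment_dot k y m u i v :
  avg lw (node_draws n H k) (fun x => dot y
    (centered_increment m u (fun i => x (@NodeIndex n H k i)) i)) v =
  dot y (node_op F i m - node_op F i u) - dot y (node_op F i1 m - node_op F i1 u).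
Proof.
transitivity (avg lw (node_draws n H k) (fun x =>
    dot y (F i (x (@NodeIndex n H k i)) m - F i (x (@NodeIndex n H k i)) u)
    + (-1) * dot y (F i1 (x (@NodeIndex n H k i1)) m - F i1 (x (@NodeIndex n H k i1)) u)) v).
  by apply: avg_eq => x _; rewrite /centered_increment !dotDr !dotNr; ring.
rewrite avgD avgZ (avg_node k i (fun j => dot y (F i j m - F i j u))).
rewrite (avg_node k i1 (fun j => dot y (F i1 j m - F i1 j u))) mulN1r.
have e i' : M%:R^-1 * \sum_(j < M) dot y (F i' j m - F i' j u) =
    dot y (node_op F i' m - node_op F i' u).
  rewrite dotDr dotNr -!dot_node_op -mulrBr -sumrB; congr (_ * _).
  by apply: eq_bigr => j _; rewrite dotDr dotNr.
by rewrite !e.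
Qed.

Lemma avg_increment_sq k m u v : Z m -> Z u ->
  n%:R^-1 * \sum_(i < n) avg lw (node_draws n H k) (fun x => dot
    (centered_increment m u (fun i => x (@NodeIndex n H k i)) i)
    (centered_increment m u (fun i => x (@NodeIndex n H k i)) i)) v
  <= S ^+ 2 * dot (u - m) (u - m).
Proof.
move=> Zm Zu; have := F_sim i1 Zu Zm; rewrite enorm_sqr; apply: le_trans.
rewrite invfM -mulrA ler_wpM2l ?invr_ge0// mulr_sumr; apply: ler_sum => i _.
pose h (o o' : 'I_M) :=
  dot (F i o' m - F i1 o m - F i o' u + F i1 o u) (F i o' m - F i1 o m - F i o' u + F i1 o u).
have hE o o' : enorm (F i1 o u - F i o' u - F i1 o m + F i o' m) ^+ 2 = h o o'.
  rewrite enorm_sqr /h; congr (dot _ _); apply/rowP => j; rewrite !mxE; ring.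
(* For node 1 the two operators share one draw and the increment vanishes; for any other node the
   two indices are independent, which reproduces the double sum over indices in the similarity
   condition. *)
have [ii1|ii1] := eqVneq i i1.
  subst i; rewrite (avg_const lw_sum (c := 0)).
    rewrite mulr_ge0 ?invr_ge0 ?exprn_ge0// sumr_ge0// => j1 _; rewrite sumr_ge0// => j2 _.
    exact: exprn_ge0 (enorm_ge0 _).
  move=> x _; rewrite /centered_increment (_ : _ - _ - _ + _ = 0) ?dot0l//.
  by apply/rowP => j; rewrite !mxE; ring.
rewrite -/(h _ _) (avg_pair lw_sum (a := @NodeIndex n H k i1) (b := @NodeIndex n H k i) h) ?uniq_node_draws//.
- rewrite le_eqVlt; apply/orP; left; apply/eqP.
  rewrite expr2 invfM -mulrA !mulr_sumr; apply: eq_bigr => o _; congr (_ * _).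
  by rewrite mulr_sumr; apply: eq_bigr => o' _; rewrite hE.
- by rewrite map_f ?mem_enum.
- by rewrite map_f ?mem_enum.
- by apply/eqP => -[/esym/eqP]; rewrite (negPf ii1).
Qed.

(** The shuffle is averaged first, with the node indices frozen: unbiasedness serves the linear
    term, the second moment bound the quadratic one. Averaging the indices then yields [gap] and the
    similarity constant. *)
Lemma avg_outer_draws k (m u y : 'rV[R]_d) (gamma : R) v : Z m -> Z u ->
  avg lw (outer_draws n H k)
    (fun x => dot (y + gamma *: correction m u x k) (y + gamma *: correction m u x k)) v
  <= dot y y + 2 * gamma * dot y (gap F i1 m u) + gamma ^+ 2 * (S ^+ 2 * dot (u - m) (u - m)).
Proof.
move=> Zm Zu; rewrite avg_cat.
pose w (x : forall a : draw n H, outcome c d r M a) := centered_increment m u (fun i : 'I_n => x (@NodeIndex n H k i)).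
have hS := shuffle_gt0.
have step x : avg lw [:: @Shuffle n H k; @RefCoin n H k]
    (fun x => dot (y + gamma *: correction m u x k) (y + gamma *: correction m u x k)) x
    <= dot y y + 2 * gamma * dot y (n%:R^-1 *: \sum_(i < n) w x i)
      + gamma ^+ 2 * (n%:R^-1 * \sum_(i < n) dot (w x i) (w x i)).
  pose K (s : shuffle c d n r) := n%:R^-1 *: \sum_(i < n) compressor s i (w x i).
  have -> : avg lw [:: @Shuffle n H k; @RefCoin n H k]
      (fun x => dot (y + gamma *: correction m u x k) (y + gamma *: correction m u x k)) x =
      \sum_(s : shuffle c d n r) #|shuffle c d n r|%:R^-1 *
        (dot y y + (2 * gamma * dot y (K s) + gamma ^+ 2 * dot (K s) (K s))).
    apply: eq_bigr => s _; congr (_ * _).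
    transitivity (\sum_(o : bool) lw (a := @RefCoin n H k) o *
        (dot y y + (2 * gamma * dot y (K s) + gamma ^+ 2 * dot (K s) (K s)))).
      apply: eq_bigr => o _; congr (_ * _).
      rewrite (_ : correction _ _ _ _ = K s).
        by rewrite dot_add_scale addrA.
      rewrite /correction /K; congr (_ *: _); apply: eq_bigr => i _.
      rewrite dfwith_out ?dfwith_in; last by apply/eqP.
      congr (compressor _ _ _); rewrite /w /centered_increment.
      by rewrite !dfwith_out//; apply/eqP.
    by rewrite -mulr_suml [X in X * _](lw_sum (@RefCoin n H k)) mul1r.
  have e0 : \sum_(s : shuffle c d n r) #|shuffle c d n r|%:R^-1 = 1 :> R.
    by rewrite sumr_const -[LHS]mulr_natr mulVf// pnatr_eq0 -lt0n.
  have e1 : \sum_(s : shuffle c d n r) #|shuffle c d n r|%:R^-1 *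
        (dot y y + (2 * gamma * dot y (K s) + gamma ^+ 2 * dot (K s) (K s))) =
      dot y y + 2 * gamma * (\sum_(s : shuffle c d n r) #|shuffle c d n r|%:R^-1 * dot y (K s))
      + gamma ^+ 2 * (\sum_(s : shuffle c d n r) #|shuffle c d n r|%:R^-1 * dot (K s) (K s)).
    transitivity (\sum_(s : shuffle c d n r) #|shuffle c d n r|%:R^-1 * dot y y +
      (\sum_(s : shuffle c d n r) 2 * gamma * (#|shuffle c d n r|%:R^-1 * dot y (K s)) +
       \sum_(s : shuffle c d n r) gamma ^+ 2 * (#|shuffle c d n r|%:R^-1 * dot (K s) (K s)))).
      by rewrite -!big_split /=; apply: eq_bigr => s _; ring.
    by rewrite -mulr_suml e0 mul1r -!mulr_sumr addrA.
  rewrite e1; apply: lerD; last first.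
    by rewrite ler_wpM2l ?sqr_ge0//; exact: compressor_second_moment.
  rewrite lerD2l le_eqVlt; apply/orP; left; apply/eqP; congr (_ * _).
  rewrite dotZr dot_sumr.
  transitivity (\sum_(s : shuffle c d n r) n%:R^-1 * (\sum_(i < n)
      dot y (#|shuffle c d n r|%:R^-1 *: compressor s i (w x i)))).
    apply: eq_bigr => s _; rewrite dotZr dot_sumr mulrCA mulr_sumr; congr (_ * _).
    by apply: eq_bigr => i _; rewrite dotZr.
  rewrite -mulr_sumr exchange_big /=; congr (_ * _); apply: eq_bigr => i _.
  by rewrite -dot_sumr compressor_mean.
apply: (le_trans (avg_le lw_ge0 (fun x _ => step x))).
have -> : avg lw (node_draws n H k) (fun x =>
    dot y y + 2 * gamma * dot y (n%:R^-1 *: \sum_(i < n) w x i)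
      + gamma ^+ 2 * (n%:R^-1 * \sum_(i < n) dot (w x i) (w x i))) v =
    dot y y + 2 * gamma * dot y (gap F i1 m u) + gamma ^+ 2 * (n%:R^-1 *
     \sum_(i < n) avg lw (node_draws n H k) (fun x => dot (w x i) (w x i)) v).
  rewrite avgD avgD (avg_cst lw_sum) !avgZ; congr (_ + _ * _ + _ * (_ * _)); last first.
    exact: avg_sum.
  transitivity (avg lw (node_draws n H k) (fun x => n%:R^-1 * \sum_(i < n) dot y (w x i)) v).
    by apply: avg_eq => x _; rewrite dotZr dot_sumr.
  rewrite avgZ avg_sum; under eq_bigr do rewrite avg_increment_dot.
  have nR0 : (n%:R : R) != 0 by rewrite pnatr_eq0 -lt0n.
  rewrite sumrB sumr_const card_ord -[X in _ * (_ - X)]mulr_natl -dot_sumr sumrB.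
  have -> : \sum_(i < n) node_op F i m = n%:R *: full_op F m.
    by rewrite /full_op scalerA mulfV// scale1r.
  have -> : \sum_(i < n) node_op F i u = n%:R *: full_op F u.
    by rewrite /full_op scalerA mulfV// scale1r.
  rewrite -scalerBr dotZr -mulrBr mulKf// -dotNr -dotDr; congr (dot _ _).
  by apply/rowP => j; rewrite /gap !mxE; ring.
by rewrite lerD2l ler_wpM2l ?sqr_ge0//; exact: avg_increment_sq.
Qed.

End OuterAverage.

(** * Iterating one-step estimates along the outer loop *)

Section Process.
Variables (R : realType) (c : regime) (d n r M H : nat) (p q : R).
Let lw : forall a : draw n H, outcome c d r M a -> R := draw_law p q.
Hypothesis lw_sum : forall a : draw n H, \sum_(o : outcome c d r M a) lw o = 1.
Hypothesis lw_ge0 : forall (a : draw n H) (o : outcome c d r M a), 0 <= lw o.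
Variables (T : Type) (step : (forall a : draw n H, outcome c d r M a) -> nat -> T -> T).
Hypothesis step_local : forall x y k s, (forall a, a \in step_draws n H k -> x a = y a) ->
  step x k s = step y k s.

Fixpoint run (s : T) (x : forall a : draw n H, outcome c d r M a) (k : nat) : T :=
  if k is k'.+1 then step x k' (run s x k') else s.

Lemma run_local s x y k : (forall a, a \in all_draws n H k -> x a = y a) ->
  run s x k = run s y k.
Proof.
elim: k => [|k ih] //= xy; rewrite ih => [|a ak].
  by apply: step_local => a ak; apply: xy; rewrite all_drawsS mem_cat ak orbT.
by apply: xy; rewrite all_drawsS mem_cat ak.
Qed.

Variable Inv : T -> Prop.
Hypothesis Inv_step : forall x k s, Inv s -> Inv (step x k s).

Lemma run_Inv s x k : Inv s -> Inv (run s x k).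
Proof. by move=> Is; elim: k => //= k; exact: Inv_step. Qed.

Lemma avg_run_succ k (f g : T -> R) s v : Inv s ->
  (forall s v, Inv s -> avg lw (step_draws n H k) (fun x => f (step x k s)) v <= g s) ->
  avg lw (all_draws n H k.+1) (fun x => f (run s x k.+1)) v
  <= avg lw (all_draws n H k) (fun x => g (run s x k)) v.
Proof.
move=> Is fg; rewrite all_drawsS avg_cat; apply: avg_le => // y _.
rewrite (avg_eq _ (g := fun x => f (step x k (run s y k)))) => [|x yx].
  by apply: fg; exact: run_Inv.
congr (f (step _ _ _)); apply: run_local => a ak; rewrite yx//.
by apply/negP => /iteration_step_draws; move/iteration_all_draws: ak => /[swap] ->; rewrite ltnn.
Qed.

Lemma avg_run_le (W : nat -> T -> R) (b : R) s v K : Inv s -> 0 <= b ->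
  (forall k s v, Inv s ->
     avg lw (step_draws n H k) (fun x => W k.+1 (step x k s)) v <= b * W k s) ->
  avg lw (all_draws n H K) (fun x => W K (run s x K)) v <= b ^+ K * W 0%N s.
Proof.
move=> Is b0 hW; elim: K => [|K ih]; first by rewrite expr0 mul1r.
apply: (le_trans (avg_run_succ v Is (hW K))).
by rewrite avgZ exprS -mulrA ler_wpM2l.
Qed.

End Process.

Section OneStep.
Variables (R : realType) (c : regime) (d n r M H : nat) (p q : R).
Let lw : forall a : draw n H, outcome c d r M a -> R := draw_law p q.
Hypothesis lw_sum : forall a : draw n H, \sum_(o : outcome c d r M a) lw o = 1.
Hypothesis lw_ge0 : forall (a : draw n H) (o : outcome c d r M a), 0 <= lw o.
Hypothesis hc : regime_ok c d n r.
Hypotheses (n_gt0 : (0 < n)%N) (M_gt0 : (0 < M)%N).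
Variables (S : Type) (stp : 'I_M -> bool -> S -> S).

Definition inner_fold (k : nat) (s : S) (x : forall a : draw n H, outcome c d r M a) : S :=
  foldl (fun s t => stp (x (@InnerIndex n H k t)) (x (@AnchorCoin n H k t)) s) s (enum 'I_H).

Lemma inner_fold_local k s x y : (forall a, a \in inner_draws n k (enum 'I_H) -> x a = y a) ->
  inner_fold k s x = inner_fold k s y.
Proof.
rewrite /inner_fold; elim: (enum _) s => //= t ts ih s xy.
rewrite !xy ?inE ?eqxx ?orbT// ih// => a ats.
by apply: xy; rewrite !inE ats !orbT.
Qed.

Lemma inner_fold_Inv (Inv : S -> Prop) k s x :
  (forall j b s, Inv s -> Inv (stp j b s)) -> Inv s -> Inv (inner_fold k s x).
Proof. by move=> hI; rewrite /inner_fold; elim: (enum _) s => //= t ts ih s /hI/ih. Qed.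

(** The outer draws are averaged for a frozen result of the inner loop; the remaining average is an
    iterate of the Markov operator. *)
Lemma avg_step_le k (Inv : S -> Prop) (s : S)
    (f : S -> (forall a : draw n H, outcome c d r M a) -> R) (g : S -> R) v :
  (forall j b s, Inv s -> Inv (stp j b s)) -> Inv s ->
  (forall s v, Inv s -> avg lw (outer_draws n H k) (f s) v <= g s) ->
  avg lw (step_draws n H k) (fun x => f (inner_fold k s x) x) v
  <= iter H (chain_op q stp) g s.
Proof.
move=> hI Is fg; rewrite avg_cat.
have -> : iter H (chain_op q stp) g s =
    avg lw (inner_draws n k (enum 'I_H)) (fun x => g (inner_fold k s x)) v.
  by rewrite (@avg_inner_chain R c d n r M H p q S stp k (enum 'I_H) g) ?enum_uniq ?size_enum_ord.
apply: avg_le => // y _; rewrite (avg_eq _ (g := f (inner_fold k s y))) => [|x yx].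
  by apply: fg; exact: inner_fold_Inv.
congr (f _ _); apply: inner_fold_local => a ai; rewrite yx//.
move: (uniq_step_draws n H k); rewrite cat_uniq => /and3P[_ /hasPn h _].
by apply/negP => /h; rewrite /= ai.
Qed.

Lemma avg_ref_coin k (G : bool -> R) v :
  avg lw (outer_draws n H k) (fun x => G (x (@RefCoin n H k))) v = p * G true + (1 - p) * G false.
Proof.
rewrite (avg_single lw_sum (a := @RefCoin n H k) G) ?uniq_outer_draws//.
  by rewrite big_bool.
by case: (mem_outer_draws n H k).
Qed.

End OneStep.

(** * The inner loop as a contraction *)

Section StepInequalities.
Variables (R : realType) (d : nat) (q b : R).
Implicit Types u w a v N f h La : 'rV[R]_d.

(** Here [u], [w], [a], [v] are the current, anchor, half and next points relative to a moving
    reference, [N] is the normal vector, [f] and [h] are the operator and its stochastic increment.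
    The inequality |v - a + b (a - w + h)|^2 >= 0 is added to the two projection inequalities; b s
    La is the motion of the reference between the half and the next point. *)
Lemma extragradient_step u w a v N f h La (s : R) :
  0 <= dot ((1 - q) *: u + q *: w - b *: a - v + b *: (N - f - h)) v ->
  dot ((1 - q) *: u + (q - b) *: w - a + b *: (N - f)) (v - a + (b * s) *: La) <= 0 ->
  dot v v <= (1 - q) * dot u u + q * dot w w - (1 - q) * dot (a - u) (a - u)
    - q * dot (a - w) (a - w) - 2 * b * dot a a + b ^+ 2 * dot (a - w + h) (a - w + h)
    + 2 * b * dot (N - f - h) a
    - 2 * b * s * dot ((1 - q) *: u + (q - b) *: w - a + b *: (N - f)) La.
Proof.
have := dot_ge0 (v - a + b *: (a - w + h)).
rewrite !dotE ?(dotC w u) ?(dotC a u) ?(dotC v u) ?(dotC N u) ?(dotC f u) ?(dotC h u) ?(dotC La u) ?(dotC a w) ?(dotC v w) ?(dotC N w) ?(dotC f w) ?(dotC h w) ?(dotC La w) ?(dotC v a) ?(dotC N a) ?(dotC f a) ?(dotC h a) ?(dotC La a) ?(dotC N v) ?(dotC f v) ?(dotC h v) ?(dotC La v) ?(dotC f N) ?(dotC h N) ?(dotC La N) ?(dotC h f) ?(dotC La f) ?(dotC La h); lra.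
Qed.

(** The same projection of the next point, combined with the square of v - ((1 - q) u + q w - b a) +
    b (f + h) and with the half point tested at the reference instead of at the next point. This one
    keeps a negative multiple of |u - w|^2. *)
Lemma projected_step u w a v N f h :
  0 <= dot ((1 - q) *: u + q *: w - b *: a - v + b *: (N - f - h)) v ->
  0 <= b ->
  0 <= dot ((1 - q) *: u + (q - b) *: w - a + b *: (N - f)) a ->
  dot v v <= (1 - q) * dot u u + q * dot w w - q * (1 - q) * dot (u - w) (u - w)
    - (2 * b - b ^+ 2) * dot a a - 2 * b ^+ 2 * dot w a + 2 * b ^+ 2 * dot (N - f) a
    - 2 * b * dot ((1 - q) *: u + q *: w - b *: a) (f + h) + b ^+ 2 * dot (f + h) (f + h)
    + 2 * b * dot N v.
Proof.
move=> hv b0 ha; have hb := mulr_ge0 b0 ha; move: hv hb {ha}.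
have := dot_ge0 (v - ((1 - q) *: u + q *: w - b *: a) + b *: (f + h)).
rewrite !dotE ?(dotC w u) ?(dotC a u) ?(dotC v u) ?(dotC N u) ?(dotC f u) ?(dotC h u) ?(dotC a w) ?(dotC v w) ?(dotC N w) ?(dotC f w) ?(dotC h w) ?(dotC v a) ?(dotC N a) ?(dotC f a) ?(dotC h a) ?(dotC N v) ?(dotC f v) ?(dotC h v) ?(dotC f N) ?(dotC h N) ?(dotC h f); lra.
Qed.

End StepInequalities.

Section IndexAverage.
Variables (R : realType) (M : nat).
Hypothesis M_gt0 : (0 < M)%N.

Definition Ej (f : 'I_M -> R) : R := M%:R^-1 * \sum_(j < M) f j.

Lemma Ej_le f g : (forall j, f j <= g j) -> Ej f <= Ej g.
Proof. by move=> fg; rewrite ler_wpM2l ?invr_ge0//; apply: ler_sum. Qed.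

Lemma EjD f g : Ej (fun j => f j + g j) = Ej f + Ej g.
Proof. by rewrite /Ej big_split mulrDr. Qed.

Lemma EjZ a f : Ej (fun j => a * f j) = a * Ej f.
Proof. by rewrite /Ej -mulr_sumr mulrCA. Qed.

Lemma Ej_cst a : Ej (fun=> a) = a.
Proof. by rewrite /Ej sumr_const card_ord -[X in _ * X]mulr_natl mulKf// pnatr_eq0 -lt0n. Qed.

Lemma chain_opE (S : Type) q (step : 'I_M -> bool -> S -> S) g s : chain_op q step g s =
  Ej (fun j => q * g (step j true s) + (1 - q) * g (step j false s)).
Proof. by rewrite /chain_op /Ej mulr_sumr; apply: eq_bigr => j _; rewrite big_bool. Qed.

End IndexAverage.

Section InnerLoop.
Variables (R : realType) (d n M : nat) (Z : set 'rV[R]_d).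
Variables (F : 'I_n -> 'I_M -> 'rV[R]_d -> 'rV[R]_d) (i1 : 'I_n).
Variables (gamma p q b : R) (z m : 'rV[R]_d).
Implicit Types u w y v La uh : 'rV[R]_d.

(** The inner operator times [gamma]. As eta = gamma b, the steps become the dimensionless [b], and
    the proximal term gets coefficient one. *)
Definition force w := gamma *: drift F i1 m w + (w - (z + p *: (m - z))).

Definition half_step u w := proj Z ((1 - q) *: u + q *: w - b *: force w).

Definition next_step j u w := proj Z ((1 - q) *: u + q *: w -
  b *: (force w + gamma *: (F i1 j (half_step u w) - F i1 j w) + (half_step u w - w))).

Lemma inner_stepE eta tau alpha j coin u w : gamma != 0 ->
  eta = gamma * b -> tau = p -> alpha = 1 - q ->
  inner_step Z F i1 gamma eta tau alpha z m j coin (u, w) =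
  (next_step j u w, if coin then next_step j u w else w).
Proof.
move=> g0 -> -> ->; rewrite /inner_step.
have -> : proj Z ((1 - q) *: u + (1 - (1 - q)) *: w - (gamma * b) *:
    (node_op F i1 w - node_op F i1 m + full_op F m + gamma^-1 *: (w - z - p *: (m - z)))) =
    half_step u w.
  rewrite /half_step; congr (proj Z _); apply/rowP => k; rewrite /force /drift.
  move: (node_op F i1 w) (node_op F i1 m) (full_op F m) => f1 f2 f3.
  by rewrite !mxE; field.
have -> : proj Z ((1 - q) *: u + (1 - (1 - q)) *: w - (gamma * b) *:
    (F i1 j (half_step u w) - F i1 j w + node_op F i1 w - node_op F i1 m + full_op F m
      + gamma^-1 *: (half_step u w - z - p *: (m - z)))) = next_step j u w.
  rewrite /next_step; congr (proj Z _); apply/rowP => k; rewrite /force /drift.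
  move: (half_step u w) (node_op F i1 w) (node_op F i1 m) (full_op F m) => a f1 f2 f3.
  by rewrite !mxE; field.
by [].
Qed.

Hypotheses (Z_nonempty : Z !=set0) (Z_closed : closed Z) (Z_convex : convex_set Z).

Lemma half_in u w : Z (half_step u w). Proof. exact: proj_in. Qed.
Lemma next_in j u w : Z (next_step j u w). Proof. exact: proj_in. Qed.

Hypothesis M_gt0 : (0 < M)%N.
Variable L : R.
Hypotheses (L_ge0 : 0 <= L) (gamma_gt0 : 0 < gamma) (b_ge0 : 0 <= b).
Hypotheses (F_lip : mean_square_lipschitz Z F L).
Hypothesis F_mono : forall i, monotone_on Z (node_op F i).
Variable uh : 'rV[R]_d.
Hypothesis uh_hat : is_hat Z F i1 gamma p z m uh.

Let N := normal_of F i1 gamma p z m uh.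
Definition rel_op w := gamma *: (node_op F i1 w - node_op F i1 uh).
Let h j u w := gamma *: (F i1 j (half_step u w) - F i1 j w).

Lemma rel_op_lip w1 w2 : Z w1 -> Z w2 ->
  dot (rel_op w1 - rel_op w2) (rel_op w1 - rel_op w2) <= (gamma * L) ^+ 2 * dot (w1 - w2) (w1 - w2).
Proof.
move=> Z1 Z2; have -> : rel_op w1 - rel_op w2 = gamma *: (node_op F i1 w1 - node_op F i1 w2).
  by apply/rowP => k; rewrite !mxE; ring.
rewrite dotZl dotZr exprMn [leLHS]mulrA -[leRHS]mulrA -(expr2 gamma) ler_wpM2l ?sqr_ge0//.
exact: (node_op_lip F_lip).
Qed.

Lemma rel_op_le w : Z w -> dot (rel_op w) (rel_op w) <= (gamma * L) ^+ 2 * dot (w - uh) (w - uh).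
Proof.
move=> Zw; have [Zuh _] := uh_hat; have := rel_op_lip Zw Zuh.
by rewrite (_ : rel_op uh = 0) ?subr0// /rel_op subrr scaler0.
Qed.

Lemma rel_op_mono w : Z w -> 0 <= dot (rel_op w) (w - uh).
Proof.
move=> Zw; have [Zuh _] := uh_hat; rewrite dotZl mulr_ge0 //; first exact: ltW.
exact: (F_mono i1 Zw Zuh).
Qed.

Lemma Ej_h_dot y u w : Z w ->
  Ej (fun j => dot (h j u w) y) = dot (rel_op (half_step u w) - rel_op w) y.
Proof.
move=> Zw; have -> : rel_op (half_step u w) - rel_op w =
    gamma *: (node_op F i1 (half_step u w) - node_op F i1 w).
  rewrite /rel_op; move: (half_step u w) => a.
  by apply/rowP => k; rewrite !mxE; ring.
rewrite node_opB !dotZl dot_suml -/(Ej _) -EjZ; congr (_ * _); apply: eq_bigr => j _.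
by rewrite /h dotZl.
Qed.

Lemma Ej_h_sq u w : Z w ->
  Ej (fun j => dot (h j u w) (h j u w)) <= (gamma * L) ^+ 2 * dot (half_step u w - w) (half_step u w - w).
Proof.
move=> Zw; rewrite exprMn -mulrA.
have -> : Ej (fun j => dot (h j u w) (h j u w)) = gamma ^+ 2 *
    Ej (fun j => dot (F i1 j (half_step u w) - F i1 j w) (F i1 j (half_step u w) - F i1 j w)).
  by rewrite -EjZ; congr (_ * _); apply: eq_bigr => j _; rewrite dotZl dotZr mulrA -expr2.
rewrite ler_wpM2l ?sqr_ge0//; exact: (F_lipE F_lip i1 (half_in u w) Zw).
Qed.

Section Relative.
Variables (La : 'rV[R]_d) (thu thw : R) (u w : 'rV[R]_d).
Hypothesis Zw : Z w.
Let tha := (1 - q) * thu + (q - b) * thw.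
Let thn := (1 - q) * thu + q * thw - b * tha.
Let u' := u - uh - thu *: La.
Let w' := w - uh - thw *: La.
Let a' := half_step u w - uh - tha *: La.
Let v' j := next_step j u w - uh - thn *: La.
Let nu := (1 - q) *: u' + (q - b) *: w' - a' + b *: (N - rel_op w).

Lemma nuE : nu = ((1 - q) *: u + q *: w - b *: force w) - half_step u w.
Proof.
rewrite /nu /a' /u' /w' /tha /N /normal_of /rel_op /force /drift.
by move: (half_step u w) => a; apply/rowP => k; rewrite !mxE; ring.
Qed.

Lemma half_vi y : Z y -> dot nu (y - half_step u w) <= 0.
Proof. by move=> Zy; rewrite nuE; apply: proj_vi. Qed.

(** [tha] and [thn] obey the recursion of the half and the next point with the identity as operator,
    so all multiples of [La] cancel in the relative coordinates. *)
Lemma next_vi j : Z (uh + thn *: La) ->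
  0 <= dot ((1 - q) *: u' + q *: w' - b *: a' - v' j + b *: (N - rel_op w - h j u w)) (v' j).
Proof.
move=> Zy; set P := ((1 - q) *: u + q *: w -
  b *: (force w + gamma *: (F i1 j (half_step u w) - F i1 j w) + (half_step u w - w))).
have := proj_vi Z_nonempty Z_closed Z_convex P Zy; rewrite -/(next_step j u w).
have -> : uh + thn *: La - next_step j u w = - v' j.
  by rewrite /v'; move: (next_step j u w) => v; apply/rowP => k; rewrite !mxE; ring.
rewrite dotNr oppr_le0; congr (_ <= dot _ _).
rewrite /P /v' /a' /u' /w' /thn /N /normal_of /rel_op /force /drift /h.
by move: (next_step j u w) (half_step u w) => v a; apply/rowP => k; rewrite !mxE; ring.
Qed.

(** The half step is tested at the next point; since thn = tha + b (thw - tha), the change of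
    reference leaves the explicit multiple of [La]. *)
Lemma half_next_vi j : dot nu (v' j - a' + (b * (thw - tha)) *: La) <= 0.
Proof.
have := half_vi (next_in j u w); congr (dot _ _ <= _).
rewrite /v' /a' /thn /tha; move: (next_step j u w) (half_step u w) => v a.
by apply/rowP => k; rewrite !mxE; ring.
Qed.

Lemma Ej_extragradient : Z (uh + thn *: La) ->
  Ej (fun j => dot (v' j) (v' j)) <= (1 - q) * dot u' u' + q * dot w' w'
    - (1 - q) * dot (a' - u') (a' - u') - q * dot (a' - w') (a' - w') - 2 * b * dot a' a'
    + b ^+ 2 * (dot (a' - w') (a' - w') + 2 * dot (rel_op (half_step u w) - rel_op w) (a' - w')
        + (gamma * L) ^+ 2 * dot (half_step u w - w) (half_step u w - w))
    + 2 * b * dot (N - rel_op (half_step u w)) a' - 2 * b * (thw - tha) * dot nu La.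
Proof.
move=> Zy; pose C := (1 - q) * dot u' u' + q * dot w' w'
    - (1 - q) * dot (a' - u') (a' - u') - q * dot (a' - w') (a' - w') - 2 * b * dot a' a'
    + b ^+ 2 * dot (a' - w') (a' - w') + 2 * b * dot (N - rel_op w) a'
    - 2 * b * (thw - tha) * dot nu La.
apply: (@le_trans _ _ (Ej (fun j => C + (2 * b ^+ 2 * dot (h j u w) (a' - w')
    + (b ^+ 2 * dot (h j u w) (h j u w) + (- (2 * b)) * dot (h j u w) a'))))).
  apply: Ej_le => j; apply: (le_trans (extragradient_step (next_vi j Zy) (half_next_vi j))).
  rewrite -/nu; have -> : dot (a' - w' + h j u w) (a' - w' + h j u w) =
      dot (a' - w') (a' - w') + 2 * dot (h j u w) (a' - w') + dot (h j u w) (h j u w).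
    by rewrite [LHS]dotDl !(dotDr _ (a' - w') (h j u w)) (dotC (a' - w') (h j u w)); ring.
  have -> : dot (N - rel_op w - h j u w) a' = dot (N - rel_op w) a' - dot (h j u w) a'.
    by rewrite [LHS]dotDl dotNl.
  rewrite /C; lra.
rewrite EjD (Ej_cst M_gt0) EjD EjZ EjD !EjZ !Ej_h_dot//.
have := ler_wpM2l (sqr_ge0 b) (Ej_h_sq u Zw).
have -> : dot (N - rel_op (half_step u w)) a' =
    dot (N - rel_op w) a' - dot (rel_op (half_step u w) - rel_op w) a'.
  by rewrite -dotNl -dotDl; congr (dot _ _); apply/rowP => k; rewrite !mxE; ring.
rewrite /C; lra.
Qed.

Lemma Ej_projected : Z (uh + thn *: La) -> Z (uh + tha *: La) ->
  Ej (fun j => dot (v' j) (v' j)) <= (1 - q) * dot u' u' + q * dot w' w'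
    - q * (1 - q) * dot (u' - w') (u' - w') - (2 * b - b ^+ 2) * dot a' a'
    - 2 * b ^+ 2 * dot w' a' + 2 * b ^+ 2 * dot (N - rel_op w) a'
    - 2 * b * dot ((1 - q) *: u' + q *: w' - b *: a') (rel_op (half_step u w))
    + b ^+ 2 * (2 * dot (rel_op w) (rel_op w)
        + 2 * ((gamma * L) ^+ 2 * dot (half_step u w - w) (half_step u w - w)))
    + 2 * b * Ej (fun j => dot N (v' j)).
Proof.
move=> Zn Za; pose xi := (1 - q) *: u' + q *: w' - b *: a'.
have ha : 0 <= dot nu a'.
  have := half_vi Za; have -> : uh + tha *: La - half_step u w = - a'.
    by rewrite /a'; move: (half_step u w) => a; apply/rowP => k; rewrite !mxE; ring.
  by rewrite dotNr oppr_le0.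
pose C := (1 - q) * dot u' u' + q * dot w' w'
    - q * (1 - q) * dot (u' - w') (u' - w') - (2 * b - b ^+ 2) * dot a' a'
    - 2 * b ^+ 2 * dot w' a' + 2 * b ^+ 2 * dot (N - rel_op w) a'
    - 2 * b * dot xi (rel_op w) + 2 * b ^+ 2 * dot (rel_op w) (rel_op w).
apply: (@le_trans _ _ (Ej (fun j => C + ((- (2 * b)) * dot (h j u w) xi
    + (2 * b ^+ 2 * dot (h j u w) (h j u w) + 2 * b * dot N (v' j)))))).
  apply: Ej_le => j; apply: (le_trans (projected_step (next_vi j Zn) b_ge0 ha)).
  rewrite -/xi (dotDr xi (rel_op w) (h j u w)) (dotC xi (h j u w)).
  have := ler_wpM2l (sqr_ge0 b) (dot_addr_le2 (rel_op w) (h j u w)).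
  rewrite /C; lra.
rewrite EjD (Ej_cst M_gt0) EjD EjZ EjD !EjZ !Ej_h_dot//.
have := ler_wpM2l (sqr_ge0 b) (Ej_h_sq u Zw).
have -> : dot (rel_op (half_step u w) - rel_op w) xi = dot xi (rel_op (half_step u w)) - dot xi (rel_op w).
  by rewrite dotC [LHS]dotDr dotNr.
rewrite /C -/xi; lra.
Qed.

End Relative.

End InnerLoop.

(** * Scalar inequalities behind one inner step *)

Section Coefficients.
Variables (R : realFieldType) (b q : R).
Hypotheses (b_ge0 : 0 <= b) (b_le : b <= 1 / 2) (q_ge : 4 * b ^+ 2 <= q).
Hypotheses (q_le : q <= 81 / 20 * b ^+ 2) (q_le1 : q <= 1).

Ltac hyps := move: b_ge0 b_le q_ge q_le q_le1 => ? ? ? ? ?.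

(** Nonnegative products of the hypotheses; from them [lra] derives the polynomial inequalities in
    [b] and [q] as linear combinations. *)
Let b2 : 0 <= b ^+ 2. Proof. exact: sqr_ge0. Qed.
Let b3 : 0 <= b ^+ 3. Proof. exact: exprn_ge0. Qed.
Let b4 : 0 <= b ^+ 4. Proof. exact: exprn_ge0. Qed.
Let q0 : 0 <= q. Proof. by hyps; move: b2; lra. Qed.
Let s0 : 0 <= 1 - 2 * b. Proof. by hyps; lra. Qed.
Let e0 : 0 <= q - 4 * b ^+ 2. Proof. by hyps; lra. Qed.
Let e1 : 0 <= 81 / 20 * b ^+ 2 - q. Proof. by hyps; lra. Qed.
Let m1 : 0 <= b * (q - 4 * b ^+ 2). Proof. exact: mulr_ge0. Qed.
Let m2 : 0 <= b * (81 / 20 * b ^+ 2 - q). Proof. exact: mulr_ge0. Qed.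
Let m3 : 0 <= q * (81 / 20 * b ^+ 2 - q). Proof. exact: mulr_ge0. Qed.
Let m4 : 0 <= q * (q - 4 * b ^+ 2). Proof. exact: mulr_ge0. Qed.
Let m5 : 0 <= b ^+ 2 * (q - 4 * b ^+ 2). Proof. exact: mulr_ge0. Qed.
Let m6 : 0 <= (1 - 2 * b) * (q * (81 / 20 * b ^+ 2 - q)). Proof. exact: mulr_ge0. Qed.
Let m8 : 0 <= (1 - 2 * b) * (81 / 20 * b ^+ 2 - q). Proof. exact: mulr_ge0. Qed.
Let m9 : 0 <= b * (1 - 2 * b). Proof. exact: mulr_ge0. Qed.
Let m10 : 0 <= b ^+ 2 * (1 - 2 * b). Proof. exact: mulr_ge0. Qed.
Let m11 : 0 <= q * b ^+ 3. Proof. exact: mulr_ge0. Qed.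
Let m12 : 0 <= (q - 4 * b ^+ 2) * (b * (1 - 2 * b)). Proof. exact: mulr_ge0. Qed.
Let m13 : 0 <= (q - 4 * b ^+ 2) * b ^+ 3. Proof. exact: mulr_ge0. Qed.
Let m14 : 0 <= (q - 4 * b ^+ 2) * (1 - 2 * b). Proof. exact: mulr_ge0. Qed.
Let sqb (t : R) : 0 <= b * (b - t) ^+ 2. Proof. by rewrite mulr_ge0 ?sqr_ge0. Qed.
Let sqb2 (t : R) : 0 <= b ^+ 2 * (b - t) ^+ 2. Proof. by rewrite mulr_ge0 ?sqr_ge0. Qed.
Let sqb3 (t : R) : 0 <= b ^+ 3 * (b - t) ^+ 2. Proof. by rewrite mulr_ge0 ?sqr_ge0. Qed.

Let m15 : 0 <= (q - 4 * b ^+ 2) * (b * (b - 1 / 3) ^+ 2). Proof. exact: mulr_ge0. Qed.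

Lemma coef_p (k : R) : 0 <= k -> k <= 1 ->
  0 <= 2 * b - (1 - 2 * b) * q * (11 / 9) - 4 / 5 * k * b - (3 / 16 * q + b / 64) * (3 / 2).
Proof.
hyps => k0 k1.
have h2 : 0 <= b * (1 - k) by apply: mulr_ge0; lra.
by move: m8 (sqb (3 / 10)) m9; lra.
Qed.

(** Coefficient of [xr] that survives the Young inequalities of [inner_form_psd], when the mixed
    term [ar] has coefficient [C] up to sign; [aa] is the analogue for [xa]. *)
Let rr (C : R) := 2 * b * (q - b ^+ 2) + (1 - 2 * b) * (1 - q) * q * (55 / 100)
   - (3 / 16 + 1 / 64) * q * (5 / 3) - 3 / 16 * C.

Lemma coef_r0 : 0 <= rr (2 * b ^+ 2 * (1 - 2 * b)).
Proof.
by rewrite /rr; move: m14 m15 m6 m11 m12 m13 m1 b2 b3 m10 e0 (sqb2 (1 / 4)) (sqb3 (1 / 4)); lra.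
Qed.

Lemma coef_r1 : 0 <= rr (2 * b * (q - b) - 2 * b ^+ 2 * (1 - 2 * b)).
Proof.
by rewrite /rr; move: m14 m15 m6 m11 m12 m13 m1 b2 b3 m10 e0 (sqb2 (1 / 3)) (sqb3 (1 / 3)); lra.
Qed.

Lemma coef_r1' : 0 <= rr (- (2 * b * (q - b) - 2 * b ^+ 2 * (1 - 2 * b))).
Proof.
by rewrite /rr; move: m14 m15 m6 m11 m12 m13 m1 b2 b3 m10 e0 (sqb2 (1 / 4)) (sqb3 (1 / 4)); lra.
Qed.

Let aa (k C : R) := 2 * b * (2 * b + k * b) + (1 - 2 * b) * (2 * b + b ^+ 2) - 5 / 4 * k * (1 - q) * b
  - 4 / 3 * C - (1 - q) * (3 / 16 * q + b / 64) * 3 - (3 / 16 + 1 / 64) * q * (5 / 2) - b / 64.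

Lemma coef_a0 : 0 <= aa 0 (2 * b ^+ 2 * (1 - 2 * b)).
Proof.
have := mulr_ge0 b_ge0 q0; rewrite /aa; move: m4 m5 e1 b2 b3 b4 m9 m10 b_ge0 (sqb (1 / 3)) (sqb2 (1 / 2)); lra.
Qed.

Lemma coef_a1 : 0 <= aa 1 (2 * b * (q - b) - 2 * b ^+ 2 * (1 - 2 * b)).
Proof.
have := mulr_ge0 b_ge0 q0; rewrite /aa; move: m2 m4 m5 e1 b2 b3 b4 m9 m10 b_ge0 (sqb (1 / 3)) (sqb2 (1 / 2)); lra.
Qed.

Lemma coef_a1' : 0 <= aa 1 (- (2 * b * (q - b) - 2 * b ^+ 2 * (1 - 2 * b))).
Proof.
have := mulr_ge0 b_ge0 q0; rewrite /aa; move: m1 m4 m5 e1 b2 b3 b4 m9 m10 b_ge0 (sqb (7 / 40)); lra.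
Qed.

(** The variables stand for the squared norms of a - u, a - w, a and their inner products. Each
    cross term is removed by Young's inequality with the fixed constants in the hypotheses; the
    remaining coefficients of [xr] and [xa] are interpolated between k = 0 and k = 1. The sign of
    [C1] is undetermined, hence two cases. The rate is 3/16 q, and 1/64 is slack for the Lipschitz
    errors. *)
Lemma inner_form_psd (k xp xr xa pr ap ar : R) : 0 <= k -> k <= 1 ->
  0 <= xp -> 0 <= xr -> 0 <= xa ->
  2 * pr <= 45 / 100 * xr + 20 / 9 * xp ->
  - (2 * ap) <= 4 / 5 * xp + 5 / 4 * xa ->
  - (2 * ap) <= 1 / 2 * xp + 2 * xa ->
  - (2 * ar) <= 2 / 3 * xr + 3 / 2 * xa ->
  2 * ar <= 3 / 8 * xr + 8 / 3 * xa -> - (2 * ar) <= 3 / 8 * xr + 8 / 3 * xa ->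
  3 / 16 * q * ((1 - q) * (xa - 2 * ap + xp) + (xa - 2 * ar + xr)) +
    1 / 64 * (b * (1 - q) * (xa - 2 * ap + xp) + b * xa + q * (xa - 2 * ar + xr)) <=
  2 * b * ((1 - q) * xp + (q - b ^+ 2) * xr + (2 * b + k * b) * xa
    + k * (1 - q) * ap + k * (q - b) * ar) +
  (1 - 2 * b) * ((1 - q) * q * (xr - 2 * pr + xp) + (2 * b + b ^+ 2) * xa - 2 * b ^+ 2 * ar).
Proof.
move=> k0 k1 p0 r0 a0 h1 h2 h3 h4 h5 h6.
have nq : 0 <= 1 - q by hyps; lra.
have nk : 0 <= 1 - k by lra.
pose C0 := 2 * b ^+ 2 * (1 - 2 * b); pose C1 := 2 * b * (q - b) - C0.
have C00 : 0 <= C0 by rewrite /C0; move: m10; lra.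
have y1 : 0 <= (1 - 2 * b) * (1 - q) * q * (45 / 100 * xr + 20 / 9 * xp - 2 * pr).
  by rewrite !mulr_ge0 // subr_ge0.
have y2 : 0 <= k * (1 - q) * b * (4 / 5 * xp + 5 / 4 * xa + 2 * ap).
  by rewrite !mulr_ge0//; lra.
have y3 : 0 <= (1 - q) * (3 / 16 * q + b / 64) * (1 / 2 * xp + 2 * xa + 2 * ap).
  by rewrite !mulr_ge0//; [rewrite addr_ge0 ?mulr_ge0//; lra | lra].
have y4 : 0 <= (3 / 16 + 1 / 64) * q * (2 / 3 * xr + 3 / 2 * xa + 2 * ar).
  by rewrite !mulr_ge0//; lra.
have y5 : 0 <= (1 - k) * C0 * (3 / 8 * xr + 8 / 3 * xa - 2 * ar).
  by rewrite !mulr_ge0// subr_ge0.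
have cp := mulr_ge0 (mulr_ge0 nq p0) (coef_p k0 k1).
have cr0 := mulr_ge0 (mulr_ge0 nk r0) coef_r0.
have ca0 := mulr_ge0 (mulr_ge0 nk a0) coef_a0.
have [C10|C10] := leP 0 C1.
  have y6 : 0 <= k * C1 * (3 / 8 * xr + 8 / 3 * xa + 2 * ar) by rewrite !mulr_ge0//; lra.
  have cr1 := mulr_ge0 (mulr_ge0 k0 r0) coef_r1.
  have ca1 := mulr_ge0 (mulr_ge0 k0 a0) coef_a1.
  move: y1 y2 y3 y4 y5 y6 cp cr0 ca0 cr1 ca1; rewrite /rr /aa /C1 /C0; lra.
have y6 : 0 <= k * - C1 * (3 / 8 * xr + 8 / 3 * xa - 2 * ar).
  by rewrite !mulr_ge0// ?oppr_ge0 ?subr_ge0// ltW.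
have cr1 := mulr_ge0 (mulr_ge0 k0 r0) coef_r1'.
have ca1 := mulr_ge0 (mulr_ge0 k0 a0) coef_a1'.
move: y1 y2 y3 y4 y5 y6 cp cr0 ca0 cr1 ca1; rewrite /rr /aa /C1 /C0; lra.
Qed.

Let A := 10 * b - 41 / 4 * q + 8 * q * b + 4 * b ^+ 3.
Let B := 17 / 4 * q - 12 * b ^+ 2 + 10 * b * q - 8 * q ^+ 2 + 8 * q ^+ 2 * b
  - 8 * q * b ^+ 2 + 4 * b ^+ 3 * q - 4 * b ^+ 4.

Let bX j : 0 <= b ^+ j. Proof. exact: exprn_ge0. Qed.
Let h1 j : 0 <= b ^+ j * (1 - 2 * b). Proof. exact: mulr_ge0. Qed.
Let h2 j : 0 <= b ^+ j * (q - 4 * b ^+ 2). Proof. exact: mulr_ge0. Qed.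
Let h3 j : 0 <= b ^+ j * (81 / 20 * b ^+ 2 - q). Proof. exact: mulr_ge0. Qed.
Let h4 j : 0 <= b ^+ j * ((q - 4 * b ^+ 2) * (q - 4 * b ^+ 2)). Proof. by rewrite !mulr_ge0. Qed.
Let h5 j : 0 <= b ^+ j * ((q - 4 * b ^+ 2) * (81 / 20 * b ^+ 2 - q)). Proof. by rewrite !mulr_ge0. Qed.

Let drift_high : 0 <= A * (1 - q) + B.
Proof.
rewrite /A /B.
move: (sqb (1 / 2)) (h1 1) (h1 2) (h1 3) (h1 4) (h2 0) (h2 1) (h2 2) (h2 3) (h3 0) (h3 1) (h3 2) (h3 3)
  (h4 0) (h4 1) (h5 0) (h5 1) (bX 1) (bX 2) (bX 3) (bX 4); lra.
Qed.

Let drift_low : 0 <= A * (3 * b + 2 * b ^+ 2 - q * (1 + 2 * b)) + B * (1 + 2 * b).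
Proof.
rewrite /A /B.
move: (sqb2 (1 / 2)) (sqb3 (1 / 2)) (h1 2) (h1 3) (h1 4) (h1 5) (h2 0) (h2 1) (h2 2) (h2 3) (h2 4) (h3 0) (h3 1) (h3 2) (h3 3) (h3 4)
  (h4 0) (h4 1) (h4 2) (h5 0) (h5 1) (h5 2) (bX 2) (bX 3) (bX 4) (bX 5) (bX 6); lra.
Qed.

(** Decrease of 3/5 (1 - q) tu + tw that pays for the force of the normal vector. The difference of
    the two sides is linear in (1 - q) tu and tw, so it is checked on an extreme ray of the
    admissible cone: the lower bound on [tu] if A >= 0, and tu = tw otherwise. *)
Lemma weight_drift (tu tw : R) : 0 <= tu -> tu <= tw ->
  (3 * b + 2 * b ^+ 2 - q * (1 + 2 * b)) * tw <= (1 + 2 * b) * ((1 - q) * tu) ->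
  forall ta tn, ta = (1 - q) * tu + (q - b) * tw -> tn = (1 - q) * tu + q * tw - b * ta ->
  2 * b * (2 * b * ta + 2 * b ^+ 2 * (tw - ta)) + (1 - 2 * b) * (2 * b ^+ 2 * ta + 2 * b * tn) <=
  20 * ((1 - 3 / 16 * q) * (3 / 5 * (1 - q) * tu + tw)
        - (3 / 5 * (1 - q) * tn + (q * tn + (1 - q) * tw))).
Proof.
move=> tu0 tuw low ta tn taE tnE; rewrite -subr_ge0.
have -> : 20 * ((1 - 3 / 16 * q) * (3 / 5 * (1 - q) * tu + tw)
        - (3 / 5 * (1 - q) * tn + (q * tn + (1 - q) * tw))) -
  (2 * b * (2 * b * ta + 2 * b ^+ 2 * (tw - ta)) + (1 - 2 * b) * (2 * b ^+ 2 * ta + 2 * b * tn))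
  = A * ((1 - q) * tu) + B * tw by rewrite /A /B tnE taE; field.
have tw0 : 0 <= tw by apply: le_trans tuw.
have nq : 0 <= 1 - q by hyps; lra.
have b1 : 0 < 1 + 2 * b by hyps; lra.
have [A0|A0] := leP 0 A.
  rewrite -(pmulr_rge0 _ b1) mulrDr.
  have := ler_wpM2l A0 low; have := mulr_ge0 tw0 drift_low; lra.
have A0' : 0 <= - A by rewrite oppr_ge0 ltW.
have := mulr_ge0 (mulr_ge0 A0' nq) (_ : 0 <= tw - tu); rewrite subr_ge0 => /(_ tuw).
have := mulr_ge0 tw0 drift_high; lra.
Qed.
End Coefficients.

Section VectorForm.
Variables (R : realType) (d : nat) (b q k : R).
Local Notation nsq v := (dot v v).

Lemma inner_form_psd_dot (u w a : 'rV[R]_d) : 0 <= b -> b <= 1 / 2 ->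
  4 * b ^+ 2 <= q -> q <= 81 / 20 * b ^+ 2 -> q <= 1 -> 0 <= k -> k <= 1 ->
  3 / 16 * q * ((1 - q) * nsq u + nsq w) + 1 / 64 * (b * (1 - q) * nsq u + b * nsq a + q * nsq w) <=
  2 * b * ((1 - q) * nsq (a - u) + (q - b ^+ 2) * nsq (a - w) + (2 * b + k * b) * nsq a
    + k * (1 - q) * dot (a - u) a + k * (q - b) * dot (a - w) a) +
  (1 - 2 * b) * ((1 - q) * q * nsq (u - w) + (2 * b + b ^+ 2) * nsq a - 2 * b ^+ 2 * dot (a - w) a).
Proof.
move=> b0 b1 q_ge q_le q1 k0 k1.
have eu : nsq u = nsq a - 2 * dot (a - u) a + nsq (a - u).
  by rewrite !dotE (dotC u a); ring.
have ew : nsq w = nsq a - 2 * dot (a - w) a + nsq (a - w).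
  by rewrite !dotE (dotC w a); ring.
have euw : nsq (u - w) = nsq (a - w) - 2 * dot (a - w) (a - u) + nsq (a - u).
  by rewrite !dotE (dotC w a) (dotC u a) (dotC w u); ring.
have Y (x y : 'rV[R]_d) (t : R) : 0 < t -> 2 * dot x y <= t * nsq x + t^-1 * nsq y.
  exact: dot_young.
have Y' (x y : 'rV[R]_d) (t : R) : 0 < t -> - (2 * dot x y) <= t * nsq x + t^-1 * nsq y.
  by move=> /(Y (- x) y); rewrite !(dotNl, dotNr) opprK mulrN.
have t1 : (0 : R) < 45 / 100 by lra.
have t2 : (0 : R) < 4 / 5 by lra.
have t3 : (0 : R) < 1 / 2 by lra.
have t4 : (0 : R) < 2 / 3 by lra.
have t5 : (0 : R) < 3 / 8 by lra.
rewrite euw {1 2}eu {1 2}ew; apply: (@inner_form_psd R b q b0 b1 q_ge q_le q1 k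
  (nsq (a - u)) (nsq (a - w)) (nsq a) (dot (a - w) (a - u)) (dot (a - u) a) (dot (a - w) a)) => //.
all: rewrite ?dot_ge0//.
- by have := Y (a - w) (a - u) _ t1; rewrite (_ : (45 / 100)^-1 = 20 / 9) //; field.
- by have := Y' (a - u) a _ t2; rewrite (_ : (4 / 5)^-1 = 5 / 4) //; field.
- by have := Y' (a - u) a _ t3; rewrite (_ : (1 / 2)^-1 = 2) //; field.
- by have := Y' (a - w) a _ t4; rewrite (_ : (2 / 3)^-1 = 3 / 2) //; field.
- by have := Y (a - w) a _ t5; rewrite (_ : (3 / 8)^-1 = 8 / 3) //; field.
- by have := Y' (a - w) a _ t5; rewrite (_ : (3 / 8)^-1 = 8 / 3) //; field.
Qed.

End VectorForm.

(** * Mean decrease in a single inner step *)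

Section InnerRates.
Variables (R : realType) (d n M : nat) (Z : set 'rV[R]_d).
Variables (F : 'I_n -> 'I_M -> 'rV[R]_d -> 'rV[R]_d) (i1 : 'I_n).
Variables (gamma p q b : R) (z m : 'rV[R]_d).
Implicit Types u w y v La uh zh : 'rV[R]_d.
Hypotheses (Z_nonempty : Z !=set0) (Z_closed : closed Z) (Z_convex : convex_set Z).
Hypothesis M_gt0 : (0 < M)%N.
Variable L : R.
Hypotheses (L_gt0 : 0 < L) (gamma_gt0 : 0 < gamma) (b_gt0 : 0 < b) (b_le : b <= 1 / 2).
Hypotheses (F_lip : mean_square_lipschitz Z F L).
Hypothesis F_mono : forall i, monotone_on Z (node_op F i).
Variable uh : 'rV[R]_d.
Hypothesis uh_hat : is_hat Z F i1 gamma p z m uh.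
Hypotheses (q_def : q = 4 * b ^+ 2 * (1 + gamma * L) ^+ 2) (q_le1 : q <= 1).
Local Notation N := (normal_of F i1 gamma p z m uh).
Local Notation half := (half_step Z F i1 gamma p q b z m).
Local Notation next := (next_step Z F i1 gamma p q b z m).
Local Notation rel_op := (rel_op F i1 gamma uh).
Local Notation l := (gamma * L).
Local Notation nsq v := (dot v v).

Lemma l_gt0 : 0 < l. Proof. exact: mulr_gt0. Qed.

Lemma q_ge0 : 0 <= q.
Proof. by rewrite q_def mulr_ge0 ?sqr_ge0// mulr_ge0 ?sqr_ge0. Qed.

Lemma young_l (x y : 'rV[R]_d) (A : R) : nsq x <= l ^+ 2 * A -> 2 * dot x y <= l * A + l * nsq y.
Proof.
move=> h; have li : 0 < l^-1 by rewrite invr_gt0 l_gt0.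
apply: le_trans (dot_young x y li) _; rewrite invrK lerD2r.
have := ler_wpM2l (ltW li) h; rewrite expr2 -mulrA mulKf ?lt0r_neq0 ?l_gt0//.
Qed.

Lemma normal_le y : Z y -> dot N (y - uh) <= 0.
Proof. by case: uh_hat => _; apply. Qed.

Definition gain u w := (1 - q) * nsq (half u w - u) + 3 / 4 * q * nsq (half u w - w)
  + 2 * b * nsq (half u w - uh).


Lemma E1 La thu thw tha thn u w u' w' a' nu : Z w ->
  tha = (1 - q) * thu + (q - b) * thw -> thn = (1 - q) * thu + q * thw - b * tha ->
  u' = u - uh - thu *: La -> w' = w - uh - thw *: La -> a' = half u w - uh - tha *: La ->
  nu = (1 - q) *: u' + (q - b) *: w' - a' + b *: (N - rel_op w) ->
  Z (uh + thn *: La) ->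
  Ej (fun j => nsq (next j u w - uh - thn *: La)) <= (1 - q) * nsq u' + q * nsq w'
    - (1 - q) * nsq (a' - u') - q * nsq (a' - w') - 2 * b * nsq a'
    + b ^+ 2 * (nsq (a' - w') + 2 * dot (rel_op (half u w) - rel_op w) (a' - w')
        + l ^+ 2 * nsq (half u w - w))
    + 2 * b * dot (N - rel_op (half u w)) a' - 2 * b * (thw - tha) * dot nu La.
Proof.
move=> Zw -> -> -> -> -> -> Zn.
exact: (Ej_extragradient i1 gamma p z m Z_nonempty Z_closed Z_convex M_gt0 F_lip u Zw Zn).
Qed.

Lemma E2 La thu thw tha thn u w u' w' a' : Z w ->
  tha = (1 - q) * thu + (q - b) * thw -> thn = (1 - q) * thu + q * thw - b * tha ->
  u' = u - uh - thu *: La -> w' = w - uh - thw *: La -> a' = half u w - uh - tha *: La ->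
  Z (uh + thn *: La) -> Z (uh + tha *: La) ->
  Ej (fun j => nsq (next j u w - uh - thn *: La)) <= (1 - q) * nsq u' + q * nsq w'
    - q * (1 - q) * nsq (u' - w') - (2 * b - b ^+ 2) * nsq a'
    - 2 * b ^+ 2 * dot w' a' + 2 * b ^+ 2 * dot (N - rel_op w) a'
    - 2 * b * dot ((1 - q) *: u' + q *: w' - b *: a') (rel_op (half u w))
    + b ^+ 2 * (2 * nsq (rel_op w) + 2 * (l ^+ 2 * nsq (half u w - w)))
    + 2 * b * Ej (fun j => dot N (next j u w - uh - thn *: La)).
Proof.
move=> Zw -> -> -> -> -> Zn Za.
exact: (Ej_projected i1 gamma p z m Z_nonempty Z_closed Z_convex M_gt0 (ltW b_gt0) F_lip u Zw Zn Za).
Qed.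

(** The case of direction zero. The extrapolation and stochastic terms add up to b^2 (1 + l)^2 |a -
    w|^2 = q/4 |a - w|^2, which leaves 3/4 q in [gain]. *)
Lemma Ej_contract u w : Z w ->
  Ej (fun j => nsq (next j u w - uh)) <=
  (1 - q) * nsq (u - uh) + q * nsq (w - uh) - gain u w.
Proof.
move=> Zw; have [Zuh _] := uh_hat.
pose a := half u w; have Za : Z a by exact: half_in.
have E (v : 'rV[R]_d) t : v - uh = v - uh - t *: 0 by rewrite scaler0 subr0.
have t0 : 0 = (1 - q) * 0 + (q - b) * 0 by ring.
have n0 : 0 = (1 - q) * 0 + q * 0 - b * 0 by ring.
have Z0 : Z (uh + 0 *: 0) by rewrite scaler0 addr0.
have := E1 Zw t0 n0 (E u 0) (E w 0) (E a 0) erefl Z0.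
under eq_fun do rewrite -E; move=> h; apply: le_trans h _.
have -> : a - uh - (u - uh) = a - u by rewrite opprB addrA subrK.
have -> : a - uh - (w - uh) = a - w by rewrite opprB addrA subrK.
have h1 := young_l (a - w) (rel_op_lip i1 gamma F_lip uh Za Zw).
have h2 : dot (N - rel_op a) (a - uh) <= 0.
  rewrite dotDl dotNl; have := normal_le Za.
  have := rel_op_mono gamma_gt0 F_mono uh_hat Za; lra.
have h3 := ler_wpM2l (sqr_ge0 b) h1; have h4 := ler_wpM2l (ltW b_gt0) h2.
have h5 : b ^+ 2 * (1 + l) ^+ 2 = q / 4 by rewrite q_def; field.
have h6 : b ^+ 2 * (1 + 2 * l + l ^+ 2) * nsq (a - w) = q / 4 * nsq (a - w).
  by rewrite -h5; ring.
rewrite /gain -/a dot0r.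
move: h3 h4 h6; lra.
Qed.

Lemma gain_ge (u w : 'rV[R]_d) (r : R) : 0 <= r -> 2 * r <= 3 / 4 * q -> 2 * r <= b ->
  r * ((1 - q) * nsq (u - uh) + nsq (w - uh)) <= gain u w.
Proof.
move=> r0 r1 r2; pose a := half u w; rewrite /gain -/a.
have E (v : 'rV[R]_d) : nsq (v - uh) <= 2 * nsq (a - uh) + 2 * nsq (a - v).
  have := dot_addr_le2 (a - uh) (v - a); rewrite (dot_subC v a).
  by rewrite (_ : a - uh + (v - a) = v - uh)// addrC addrA subrK.
have nq : 0 <= 1 - q by rewrite subr_ge0.
have h1 := ler_wpM2l r0 (E w); have h2 := ler_wpM2l (mulr_ge0 r0 nq) (E u).
have h3 : 0 <= (3 / 4 * q - 2 * r) * nsq (a - w) by rewrite mulr_ge0 ?dot_ge0// subr_ge0.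
have h4 : 0 <= (b - 2 * r) * nsq (a - uh) by rewrite mulr_ge0 ?dot_ge0// subr_ge0.
have h5 : 0 <= (1 - q) * ((1 - 2 * r) * nsq (a - u)).
  rewrite mulr_ge0// mulr_ge0 ?dot_ge0//; move: b_le; lra.
have h6 : 0 <= q * (r * nsq (a - uh)) by rewrite !mulr_ge0 ?dot_ge0// q_ge0.
have h7 := dot_ge0 (a - uh); move: h1 h2 h3 h4 h5 h6 h7; lra.
Qed.

Section Deviation.
Variable zh : 'rV[R]_d.
Hypothesis Zzh : Z zh.
Local Notation La := (zh - uh).
Local Notation dd := (- dot N La).

Lemma dd_ge0 : 0 <= dd. Proof. by rewrite oppr_ge0 normal_le. Qed.

Lemma segment_in t : 0 <= t -> t <= 1 -> Z (uh + t *: La).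
Proof.
move=> t0 t1; have [Zuh _] := uh_hat.
by have := convex_mem Z_convex t0 t1 Zzh Zuh; rewrite scalerBr scalerBl scale1r addrCA.
Qed.

Variables (thu thw tha thn : R) (u w u' w' a' : 'rV[R]_d).
Hypotheses (Zw : Z w) (thu0 : 0 <= thu) (thuw : thu <= thw) (thw0 : 0 < thw) (thw1 : thw <= 1).
Hypothesis th_low : (3 * b + 2 * b ^+ 2 - q * (1 + 2 * b)) * thw <= (1 + 2 * b) * ((1 - q) * thu).
Hypotheses (thaE : tha = (1 - q) * thu + (q - b) * thw).
Hypotheses (thnE : thn = (1 - q) * thu + q * thw - b * tha).
Hypotheses (u'E : u' = u - uh - thu *: La) (w'E : w' = w - uh - thw *: La).
Hypothesis (a'E : a' = half u w - uh - tha *: La).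

(** [th_low] is this bound written in terms of [thu]; it says that the ratio [k] of [dev_energy] is
    at most 1. *)
Lemma tha_low : 2 * b * thw <= (1 + 2 * b) * tha.
Proof. by rewrite thaE; move: th_low; lra. Qed.

Lemma tha_gt0 : 0 < tha.
Proof.
have h : 0 < 1 + 2 * b by move: b_gt0; lra.
rewrite -(pmulr_rgt0 _ h); apply: lt_le_trans tha_low.
by rewrite !mulr_gt0.
Qed.

Lemma tha_le : tha <= thw.
Proof.
have h : 0 <= (1 - q) * (thw - thu) by rewrite mulr_ge0 ?subr_ge0.
have h' := mulr_gt0 b_gt0 thw0; rewrite thaE; lra.
Qed.

Lemma thnE' : thn = tha + b * (thw - tha).
Proof. by rewrite thnE thaE; ring. Qed.

Lemma thn_bounds : 0 <= thn <= thw.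
Proof.
have h1 := tha_le; have h2 := tha_gt0; have := b_gt0; have := b_le => b2 b0.
have h3 : 0 <= b * (thw - tha) by rewrite mulr_ge0 ?subr_ge0// ltW.
have h4 : 0 <= (1 - b) * (thw - tha) by rewrite mulr_ge0 ?subr_ge0//; lra.
by rewrite thnE'; apply/andP; split; lra.
Qed.

Lemma dotNa' : dot N a' <= tha * dd.
Proof.
have h := normal_le (half_in F i1 gamma p q b z m Z_nonempty Z_closed u w).
have -> : dot N a' = dot N (half u w - uh) + - (tha * dot N La) by rewrite a'E [LHS]dotDr dotNr dotZr.
lra.
Qed.

Lemma dev_energy (k : R) : 0 <= k -> k * tha = 2 * b * (thw - tha) -> l <= 1 ->
  Ej (fun j => nsq (next j u w - uh - thn *: La)) <= (1 - q) * nsq u' + q * nsq w'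
  - ((1 - q) * nsq (a' - u') + (q - b ^+ 2) * nsq (a' - w') + (2 * b + k * b) * nsq a'
     + k * (1 - q) * dot (a' - u') a' + k * (q - b) * dot (a' - w') a')
  + (2 * b * tha + 2 * b ^+ 2 * (thw - tha)) * dd
  + l * (b ^+ 2 * nsq (a' - w') + 2 * b ^+ 2 * nsq (half u w - w) + 3 * b * nsq (half u w - uh)
         + 2 * b * nsq a' + k * b / 2 * (nsq (w - uh) + nsq a')).
Proof.
move=> k0 kE l1; have [Zuh _] := uh_hat; pose a := half u w.
have Za : Z a by exact: half_in.
have /andP[thn0 thnw] := thn_bounds.
pose nu := (1 - q) *: u' + (q - b) *: w' - a' + b *: (N - rel_op w).
have Zn : Z (uh + thn *: La) by apply: segment_in => //; exact: le_trans thnw thw1.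
have := E1 Zw thaE thnE u'E w'E a'E (erefl nu) Zn; move=> h; apply: le_trans h _.
rewrite -/a.
have fa := young_l (a' - w') (rel_op_lip i1 gamma F_lip uh Za Zw).
have fb : 2 * dot (N - rel_op a) a' <= 2 * (tha * dd) + l * (3 * nsq (a - uh) + 2 * nsq a').
  rewrite dotDl dotNl; have h1 := dotNa'.
  have h2 := rel_op_mono gamma_gt0 F_mono uh_hat Za.
  have h3 := young_l (a - uh - a') (rel_op_le F_lip uh_hat Za).
  have h4 : nsq (a - uh - a') <= 2 * nsq (a - uh) + 2 * nsq a'.
    by apply: le_trans (dot_addr_le2 _ _) _; rewrite dotNl dotNr opprK.
  have h5 := ler_wpM2l (ltW l_gt0) h4; rewrite [X in 2 * X <= _]dotDr dotNr in h3.
  move: h1 h2 h3 h5; lra.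
(* Testing the half step at [uh] bounds the pairing with [La], a vector of uncontrolled size, by a
   pairing with the deviation [a']. *)
have fc : - (2 * b * (thw - tha) * dot nu La) <= k * dot nu a'.
  rewrite -kE; have h1 : dot nu (uh - a) <= 0.
    rewrite /nu u'E w'E a'E thaE.
    exact: (half_vi F i1 gamma p q b z m Z_nonempty Z_closed Z_convex uh La thu thw u w Zuh).
  have h2 : dot nu a' = - dot nu (uh - a) - tha * dot nu La.
    by rewrite a'E -/a (dotDr nu _ (- (tha *: _))) dotNr (dotZr tha nu La) -(opprB uh a) dotNr.
  rewrite h2; have := mulr_ge0 k0 (_ : 0 <= - dot nu (uh - a)); rewrite oppr_ge0 => /(_ h1).
  lra.
have fd : dot nu a' = - (1 - q) * dot (a' - u') a' - (q - b) * dot (a' - w') a'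
    - b * nsq a' + b * dot N a' - b * dot (rel_op w) a'.
  rewrite /nu; clear; rewrite !(dotDl, dotNl, dotZl); ring.
have fe := young_l (- a') (rel_op_le F_lip uh_hat Zw).
rewrite (dotNr (rel_op w)) dotNl dotNr opprK in fe.
have b0 := ltW b_gt0; have kb := mulr_ge0 k0 b0.
have ff := ler_wpM2l kb fe; have fg := ler_wpM2l b0 fb; have fh := ler_wpM2l (sqr_ge0 b) fa.
have fi := ler_wpM2l kb dotNa'.
have fj : k * b * (tha * dd) = 2 * b ^+ 2 * (thw - tha) * dd.
  by rewrite mulrA -(mulrA k) (mulrC b) mulrA kE; ring.
have fk : 0 <= b ^+ 2 * (l * (1 - l) * nsq (a - w)).
  by rewrite !mulr_ge0 ?sqr_ge0 ?dot_ge0 ?subr_ge0// ltW// l_gt0.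
rewrite fd in fc; move: fc ff fg fh fi fj fk; lra.
Qed.

(** The half point is compared with the point of the segment carrying the weight [tha], which must
    lie in [0, 1]; in exchange, no pairing of [nu] with [La] remains. *)
Lemma dev_ball : l <= 1 ->
  Ej (fun j => nsq (next j u w - uh - thn *: La)) <= (1 - q) * nsq u' + q * nsq w'
  - ((1 - q) * q * nsq (u' - w') + (2 * b + b ^+ 2) * nsq a' - 2 * b ^+ 2 * dot (a' - w') a')
  + (2 * b ^+ 2 * tha + 2 * b * thn) * dd
  + l * (3 * b ^+ 2 * nsq (w - uh) + b ^+ 2 * nsq a'
         + b * (2 * (1 - q) * nsq u' + 2 * q * nsq w' + 2 * b ^+ 2 * nsq a')
         + b * nsq (half u w - uh) + 2 * b ^+ 2 * nsq (half u w - w)).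
Proof.
move=> l1; have [Zuh _] := uh_hat; pose a := half u w.
have Za : Z a by exact: half_in.
have /andP[thn0 thnw] := thn_bounds.
have Zn : Z (uh + thn *: La) by apply: segment_in => //; exact: le_trans thnw thw1.
have Zt : Z (uh + tha *: La).
  by apply: segment_in; [exact/ltW/tha_gt0 | exact: le_trans tha_le thw1].
have := E2 Zw thaE thnE u'E w'E a'E Zn Zt; move=> h; apply: le_trans h _.
rewrite -/a.
have hN : Ej (fun j => dot N (next j u w - uh - thn *: La)) <= thn * dd.
  rewrite -(Ej_cst M_gt0 (thn * dd)); apply: Ej_le => j.
  have := normal_le (next_in F i1 gamma p q b z m Z_nonempty Z_closed j u w).
  rewrite [X in _ -> X <= _]dotDr dotNr dotZr; lra.
have fw := young_l (- a') (rel_op_le F_lip uh_hat Zw).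
rewrite (dotNr (rel_op w)) dotNl dotNr opprK in fw.
have fN : 2 * dot (N - rel_op w) a' <= 2 * (tha * dd) + l * nsq (w - uh) + l * nsq a'.
  by rewrite dotDl dotNl; have := dotNa'; lra.
pose xi := (1 - q) *: u' + q *: w' - b *: a'.
have hxi : nsq xi <= 2 * ((1 - q) * nsq u' + q * nsq w') + 2 * (b ^+ 2 * nsq a').
  apply: le_trans (dot_addr_le2 _ _) _.
  have -> : nsq (- (b *: a')) = b ^+ 2 * nsq a'.
    by rewrite dotNl dotNr opprK dotZl dotZr mulrA.
  rewrite lerD2r ler_pM2l//.
  have := dot_ge0 (u' - w'); have := mulr_ge0 q_ge0 (_ : 0 <= 1 - q).
  rewrite subr_ge0 => /(_ q_le1) h1 h2; have := mulr_ge0 h1 h2.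
  rewrite !(dotDl, dotDr, dotNl, dotNr, dotZl, dotZr) (dotC w' u'); lra.
have fx := young_l (- xi) (rel_op_le F_lip uh_hat Za).
rewrite dotNr [nsq (- xi)]dotNl dotNr opprK -/a in fx.
rewrite -/xi (dotC xi).
have hr := rel_op_le F_lip uh_hat Zw.
have ha : - dot w' a' = dot (a' - w') a' - nsq a' by rewrite dotDl dotNl; ring.
have b0 := ltW b_gt0.
have g1 := ler_wpM2l b0 hN; have g2 := ler_wpM2l (sqr_ge0 b) fN; have g3 := ler_wpM2l b0 fx.
have g4 := ler_wpM2l (mulr_ge0 b0 (ltW l_gt0)) hxi; have g5 := ler_wpM2l (sqr_ge0 b) hr.
have ll : 0 <= l * (1 - l) by rewrite mulr_ge0 ?subr_ge0// ltW// l_gt0.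
have g6 : 0 <= b ^+ 2 * (l * (1 - l) * (nsq (w - uh) + nsq (a - w))).
  by rewrite mulr_ge0 ?sqr_ge0// mulr_ge0// addr_ge0 ?dot_ge0.
have g7 := congr1 (fun x => b ^+ 2 * x) ha; rewrite /= in g7.
move: g1 g2 g3 g4 g5 g6 g7; lra.
Qed.

(** Convex combination of [dev_energy] and [dev_ball] with weights 2 b and 1 - 2 b, the form treated
    by [inner_form_psd_dot]. The errors of size [l] are split: one part fits the slack 1/64, the
    rest, at the half point, is left to be paid by [gain]. *)
Lemma dev_step : l <= 1 / 320 ->
  Ej (fun j => nsq (next j u w - uh - thn *: La)) <= (1 - q) * nsq u' + q * nsq w'
  - 3 / 16 * q * ((1 - q) * nsq u' + nsq w')
  + (2 * b * (2 * b * tha + 2 * b ^+ 2 * (thw - tha))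
     + (1 - 2 * b) * (2 * b ^+ 2 * tha + 2 * b * thn)) * dd
  + l * (9 * b * nsq (half u w - uh) + 3 * q * nsq (half u w - w)).
Proof.
move=> hl; have l1 : l <= 1 by lra.
have l0 := l_gt0; have b0 := b_gt0; have b1 := b_le; have q0 := q_ge0; have q1 := q_le1.
have q_ge : 4 * b ^+ 2 <= q.
  have h : 1 <= (1 + l) ^+ 2.
    by have := sqr_ge0 l; move: l0; move: (gamma * L) => x; lra.
  by rewrite q_def; have := ler_wpM2l (sqr_ge0 b) h; lra.
have q_le : q <= 81 / 20 * b ^+ 2.
  have h : (1 + l) ^+ 2 <= 81 / 80.
    have : 0 <= l * (1 / 320 - l) by apply: mulr_ge0; [exact: ltW | rewrite subr_ge0].
    by move: hl l0; move: (gamma * L) => x; lra.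
  by rewrite q_def; have := ler_wpM2l (sqr_ge0 b) h; lra.
pose k := 2 * b * (thw - tha) / tha.
have ta := tha_gt0; have tw := tha_le.
have kE : k * tha = 2 * b * (thw - tha) by rewrite /k divfK// gt_eqF.
have k0 : 0 <= k.
  by apply: divr_ge0; [rewrite !mulr_ge0 ?subr_ge0 //; exact: ltW | exact: ltW].
have k1 : k <= 1 by rewrite ler_pdivrMr// mul1r; have := tha_low; lra.
have hpsd := inner_form_psd_dot u' w' a' (ltW b0) b1 q_ge q_le q1 k0 k1.
pose pv := a' - u'; pose rv := a' - w'; rewrite -/pv -/rv in hpsd.
have := dev_energy k0 kE l1; have := dev_ball l1.
clearbody k; set X := Ej _ => hB hE.
have b2 : 0 <= 1 - 2 * b by lra.
have b2' : 0 <= 2 * b by lra.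
have hB' := ler_wpM2l b2 hB; have hE' := ler_wpM2l b2' hE.
have hr : nsq rv <= 2 * nsq a' + 2 * nsq w'.
  by apply: le_trans (dot_addr_le2 _ _) _; rewrite dotNl dotNr opprK.
have hw : nsq (w - uh) <= 2 * nsq (half u w - w) + 2 * nsq (half u w - uh).
  have := dot_addr_le2 (w - half u w) (half u w - uh); rewrite (dot_subC w).
  by rewrite addrA subrK.
have D0 := @dot_ge0 R d.
rewrite -/pv -/rv in hE' hB'.
set U := nsq u' in hE' hB' hpsd *; set W := nsq w' in hE' hB' hpsd hr *.
set A2 := nsq a' in hE' hB' hpsd hr *; set ao := nsq (half u w - uh) in hE' hB' hw *.
set aw := nsq (half u w - w) in hE' hB' hw *; set wo := nsq (w - uh) in hE' hB' hw.
(* The errors proportional to [l] from both estimates. The factor 5 is matched to l <= 1/320, as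
   5/320 = 1/64. *)
have J : 2 * b * (b ^+ 2 * nsq rv + 2 * b ^+ 2 * aw + 3 * b * ao + 2 * b * A2 + k * b / 2 * (wo + A2))
  + (1 - 2 * b) * (3 * b ^+ 2 * wo + b ^+ 2 * A2 + b * (2 * (1 - q) * U + 2 * q * W + 2 * b ^+ 2 * A2)
     + b * ao + 2 * b ^+ 2 * aw)
  <= 5 * (b * (1 - q) * U + b * A2 + q * W) + (9 * b * ao + 3 * q * aw).
  have [U0 W0 A0 o0 w0] : [/\ 0 <= U, 0 <= W, 0 <= A2, 0 <= ao & 0 <= aw] by split; exact: D0.
  have b' := ltW b0; have bb : b ^+ 2 <= b / 2.
    by rewrite expr2 ler_wpM2l//; lra.
  have c1 := ler_wpM2l (exprn_ge0 3 b') hr.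
  have c2 : 0 <= b * (q * (W * (1 - b))) by rewrite !mulr_ge0//; lra.
  have c3 : 0 <= b ^+ 2 * ((1 - k + 6 * b) * wo).
    by rewrite !mulr_ge0 ?sqr_ge0 ?D0//; lra.
  have c4 := ler_wpM2l (sqr_ge0 b) hw.
  have c5 : 0 <= b ^+ 2 * (1 - k) * A2 by rewrite !mulr_ge0 ?sqr_ge0//; lra.
  have c6 : 0 <= (b / 2 - b ^+ 2) * A2 by rewrite mulr_ge0// subr_ge0.
  have c7 : 0 <= (b / 2 - b ^+ 2) * ao by rewrite mulr_ge0// subr_ge0.
  have c8 : 0 <= (q - 4 * b ^+ 2) * aw by rewrite mulr_ge0// subr_ge0.
  have c9 : 0 <= (q - 4 * b ^+ 2) * W by rewrite mulr_ge0// subr_ge0.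
  have c10 : 0 <= b ^+ 2 * (1 - 2 * b) * A2 by rewrite !mulr_ge0 ?sqr_ge0.
  have c11 : 0 <= b ^+ 2 * (1 - 2 * b) * W by rewrite !mulr_ge0 ?sqr_ge0.
  have c12 : 0 <= b ^+ 4 * A2 by rewrite mulr_ge0 ?exprn_ge0.
  have c13 : 0 <= b * (1 - q) * U * (3 + 4 * b).
    by rewrite !mulr_ge0 ?subr_ge0//; lra.
  have c14 : 0 <= b * q * W * b by rewrite !mulr_ge0.
  have c15 : 0 <= q * W * (1 - 2 * b) by rewrite !mulr_ge0.
  have c16 : 0 <= q * W by rewrite !mulr_ge0.
  have c17 : 0 <= b * A2 by rewrite !mulr_ge0.
  have c18 : 0 <= b * ao by rewrite !mulr_ge0.
  have c19 : 0 <= q * aw by rewrite !mulr_ge0.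
  have c20 : 0 <= b ^+ 2 * wo by rewrite mulr_ge0 ?sqr_ge0 ?D0.
  move: c1 c2 c3 c4 c5 c6 c7 c8 c9 c10 c11 c12 c13 c14 c15 c16 c17 c18 c19 c20; lra.
have hl' := ler_wpM2l (ltW l0) J.
have S0 : 0 <= b * (1 - q) * U + b * A2 + q * W.
  by rewrite !addr_ge0 ?mulr_ge0 ?D0 ?subr_ge0 ?(ltW b0).
have hs : l * (5 * (b * (1 - q) * U + b * A2 + q * W)) <=
    1 / 64 * (b * (1 - q) * U + b * A2 + q * W).
  have := mulr_ge0 (_ : 0 <= 1 / 320 - l) S0; rewrite subr_ge0 => /(_ hl).
  lra.
move: hB' hE' hpsd hl' hs; lra.
Qed.

End Deviation.

End InnerRates.

Section ChainLinearity.
Variables (R : realType) (M : nat) (q : R) (S : Type) (step : 'I_M -> bool -> S -> S).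
Hypotheses (M_gt0 : (0 < M)%N) (q_ge0 : 0 <= q) (q_le1 : q <= 1).
Local Notation op := (chain_op q step).

Lemma iter_chain_mono (Inv : S -> Prop) N (f g : S -> R) s :
  (forall s j b, Inv s -> Inv (step j b s)) -> Inv s ->
  (forall s, Inv s -> f s <= g s) -> iter N op f s <= iter N op g s.
Proof.
move=> hI + fg; elim: N s => [|N ih] s Is /=; first exact: fg.
by apply: chain_op_le => // j b; apply: ih; exact: hI.
Qed.

Lemma iter_chainD N (f g : S -> R) s :
  iter N op (fun s => f s + g s) s = iter N op f s + iter N op g s.
Proof.
elim: N s => //= N ih s; rewrite -chain_opD; congr (chain_op q step _ s).
by apply: funext => x; exact: ih.
Qed.

Lemma iter_chainZ N (a : R) (f : S -> R) s : iter N op (fun s => a * f s) s = a * iter N op f s.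
Proof.
elim: N s => //= N ih s; rewrite -chain_opZ; congr (chain_op q step _ s).
by apply: funext => x; exact: ih.
Qed.

Lemma iter_chain_cst N (a : R) s : iter N op (fun=> a) s = a.
Proof.
elim: N s => //= N ih s; rewrite -[RHS](Ej_cst M_gt0 a) chain_opE; congr Ej.
by apply: funext => j; rewrite !ih; ring.
Qed.

(** The weights form an autonomous chain driven by the coins, so their mean does not depend on the
    iterates. *)
Lemma iter_chain_factor (T : Type) (th : S -> T) (stepT : bool -> T -> T) N (h : T -> R) s :
  (forall j b s, th (step j b s) = stepT b (th s)) ->
  iter N op (fun s => h (th s)) s = iter N (chain_op q (fun _ : 'I_M => stepT)) h (th s).
Proof.
move=> hth; elim: N s => //= N ih s.
apply: eq_bigr => j _; congr (_ * _); apply: eq_bigr => b _; congr (_ * _).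
by rewrite ih hth.
Qed.

(** [f] need not be below [g]: the potentials weigh [u] by 1 - q, which vanishes for M = 1. After
    one step the comparison holds, at the price of N > 0. *)
Lemma iter_chain_decay (Inv : S -> Prop) (f g : S -> R) (a : R) N s : (0 < N)%N ->
  0 <= a -> (forall s j b, Inv s -> Inv (step j b s)) -> Inv s ->
  (forall s, Inv s -> op g s <= a * g s) -> (forall s, Inv s -> op f s <= op g s) ->
  iter N op f s <= a ^+ N * g s.
Proof.
case: N => // N _ a0 hI Is hg hf; rewrite iterSr.
apply: (@le_trans _ _ (iter N op (op g) s)); first exact: (iter_chain_mono N hI Is).
by rewrite -iterSr; exact: (iter_chain_le q_ge0 q_le1 N.+1 a0 hI hg Is).
Qed.

End ChainLinearity.

(** * Rates of the whole inner loop *)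

Section InnerChainRates.
Variables (R : realType) (d n M H : nat) (Z : set 'rV[R]_d).
Variables (F : 'I_n -> 'I_M -> 'rV[R]_d -> 'rV[R]_d) (i1 : 'I_n).
Variables (gamma p q b : R) (z m : 'rV[R]_d).
Hypotheses (Z_nonempty : Z !=set0) (Z_closed : closed Z) (Z_convex : convex_set Z).
Hypothesis M_gt0 : (0 < M)%N.
Variable L : R.
Hypotheses (L_gt0 : 0 < L) (gamma_gt0 : 0 < gamma) (b_gt0 : 0 < b) (b_le : b <= 1 / 2).
Hypotheses (F_lip : mean_square_lipschitz Z F L).
Hypothesis F_mono : forall i, monotone_on Z (node_op F i).
Variable uh : 'rV[R]_d.
Hypothesis uh_hat : is_hat Z F i1 gamma p z m uh.
Hypotheses (q_def : q = 4 * b ^+ 2 * (1 + gamma * L) ^+ 2) (q_le1 : q <= 1).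
Hypotheses (H_gt0 : (0 < H)%N) (Zz : Z z).
Local Notation N := (normal_of F i1 gamma p z m uh).
Local Notation half := (half_step Z F i1 gamma p q b z m).
Local Notation next := (next_step Z F i1 gamma p q b z m).
Local Notation l := (gamma * L).
Local Notation nsq v := (dot v v).

(* The weights (theta_u, theta_w) follow, in the direction of a fixed reference
   vector, the exact linear recursion obeyed by (u, w) when the operator and
   the constraint are ignored. *)
Definition next_weight (th : R * R) : R :=
  let ta := (1 - q) * th.1 + (q - b) * th.2 in (1 - q) * th.1 + q * th.2 - b * ta.

Definition weight_step (coin : bool) (th : R * R) : R * R :=
  (next_weight th, if coin then next_weight th else th.2).

Definition ext_step (j : 'I_M) (coin : bool) (s : ('rV[R]_d * 'rV[R]_d) * (R * R)) :
    ('rV[R]_d * 'rV[R]_d) * (R * R) :=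
  let v := next j s.1.1 s.1.2 in
  ((v, if coin then v else s.1.2), weight_step coin s.2).

Definition ext_start : ('rV[R]_d * 'rV[R]_d) * (R * R) := ((z, z), (1, 1)).

Local Notation op := (chain_op q ext_step).
Local Notation E f := (iter H op f ext_start).

Let Inv0 (s : ('rV[R]_d * 'rV[R]_d) * (R * R)) := Z s.1.1 /\ Z s.1.2.

Let Inv0_step s j c : Inv0 s -> Inv0 (ext_step j c s).
Proof.
case=> Zu Zw; have h := next_in F i1 gamma p q b z m Z_nonempty Z_closed j s.1.1 s.1.2.
by split => //=; case: c.
Qed.

Let q0 : 0 <= q. Proof. exact: (q_ge0 q_def). Qed.

Lemma inner_contraction (rho : R) : 0 <= rho -> 2 * rho <= 3 / 4 * q -> 2 * rho <= b ->
  E (fun s => nsq (s.1.1 - uh)) <= (1 - rho) ^+ H * (2 * nsq (z - uh)).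
Proof.
(* Averaging over the coin gives |next - uh|^2 the total coefficient (1 - q) + q = 1, which is the
   quantity bounded by [Ej_contract]. *)
move=> r0 r1 r2; pose Phi (s : ('rV[R]_d * 'rV[R]_d) * (R * R)) :=
  (1 - q) * nsq (s.1.1 - uh) + nsq (s.1.2 - uh).
have opE s : op Phi s =
    Ej (fun j => nsq (next j s.1.1 s.1.2 - uh)) + (1 - q) * nsq (s.1.2 - uh).
  rewrite chain_opE -(Ej_cst M_gt0 ((1 - q) * nsq (s.1.2 - uh))) -EjD; congr Ej.
  by apply: funext => j; rewrite /Phi /=; ring.
have nq : 0 <= 1 - q by rewrite subr_ge0.
have rho1 : 0 <= 1 - rho by move: b_le; lra.
apply: (@le_trans _ _ ((1 - rho) ^+ H * Phi ext_start)).
  apply: (iter_chain_decay q0 q_le1 H_gt0 rho1 Inv0_step).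
  - by split.
  - move=> s [Zu Zw]; rewrite opE.
    have h1 := Ej_contract Z_nonempty Z_closed Z_convex M_gt0 L_gt0 gamma_gt0 b_gt0 F_lip F_mono uh_hat q_def s.1.1 Zw.
    have h2 := gain_ge Z F i1 p z m b_le uh q_def q_le1 s.1.1 s.1.2 r0 r1 r2.
    rewrite /Phi; move: h1 h2; lra.
  - move=> s [Zu Zw]; rewrite opE chain_opE.
    have -> : (fun j => q * nsq ((ext_step j true s).1.1 - uh)
       + (1 - q) * nsq ((ext_step j false s).1.1 - uh)) =
       (fun j => nsq (next j s.1.1 s.1.2 - uh)) by apply: funext => j /=; ring.
    by rewrite lerDl mulr_ge0 ?dot_ge0.
rewrite ler_wpM2l ?exprn_ge0// /Phi /=.
by have := mulr_ge0 q0 (dot_ge0 (z - uh)); lra.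
Qed.

Hypothesis l_le : l <= 1 / 320.

Let q_ge : 4 * b ^+ 2 <= q.
Proof.
have h : 1 <= (1 + l) ^+ 2.
  by have := sqr_ge0 l; have := l_gt0 L_gt0 gamma_gt0; move: (gamma * L) => x; lra.
by rewrite q_def; have := ler_wpM2l (sqr_ge0 b) h; lra.
Qed.

Let q_le : q <= 81 / 20 * b ^+ 2.
Proof.
have h : (1 + l) ^+ 2 <= 81 / 80.
  have l0 := l_gt0 L_gt0 gamma_gt0.
  have : 0 <= l * (1 / 320 - l) by apply: mulr_ge0; [exact: ltW | rewrite subr_ge0].
  by move: l_le l0; move: (gamma * L) => x; lra.
by rewrite q_def; have := ler_wpM2l (sqr_ge0 b) h; lra.
Qed.

(** The last clause is [tha_low], 2 b th.2 <= (1 + 2 b) tha for the weight [tha] of the half point,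
    expressed in the weights of the state. *)
Definition weight_inv (th : R * R) := [/\ 0 <= th.1, th.1 <= th.2, 0 < th.2, th.2 <= 1 &
  (3 * b + 2 * b ^+ 2 - q * (1 + 2 * b)) * th.2 <= (1 + 2 * b) * ((1 - q) * th.1)].

Let low_diag t : 0 <= t ->
  (3 * b + 2 * b ^+ 2 - q * (1 + 2 * b)) * t <= (1 + 2 * b) * ((1 - q) * t).
Proof.
move=> t0; rewrite !mulrA ler_wpM2r//.
have : 0 <= (1 - 2 * b) * (1 + b) by rewrite mulr_ge0//; move: b_gt0 b_le; lra.
lra.
Qed.

Lemma weight_inv_start : weight_inv (1, 1).
Proof. by split => //=; exact: low_diag. Qed.

Lemma weight_inv_step c th : weight_inv th -> weight_inv (weight_step c th).
Proof.
case: th => tu tw [/= tu0 tuw tw0 tw1 low].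
pose ta := (1 - q) * tu + (q - b) * tw.
have taE : ta = (1 - q) * tu + (q - b) * tw by [].
have tnE : next_weight (tu, tw) = (1 - q) * tu + q * tw - b * ta by [].
have t1 := tha_low low taE; have t2 := tha_le b_gt0 q_le1 tuw tw0 taE.
have /andP[t3 t4] := thn_bounds b_gt0 b_le q_le1 tuw tw0 low taE tnE.
have t5 := thnE' taE tnE; clearbody ta.
rewrite /weight_step /weight_inv /=; move: (next_weight _) => tn in tnE t3 t4 t5 *.
have b0 := b_gt0; have b1 := b_le.
have b2 : 0 < 1 + 2 * b by lra.
have h1 : 3 * b * tw <= (1 + 2 * b) * tn.
  by have := ler_wpM2l (_ : 0 <= 1 - b) t1; rewrite subr_ge0 => /(_ ltac:(lra)); rewrite t5; lra.
have tn0 : 0 < tn.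
  by rewrite -(pmulr_rgt0 _ b2); apply: lt_le_trans h1; rewrite !mulr_gt0.
case: c; split => //=; [exact: le_trans t4 tw1 | exact: low_diag |].
have h2 := ler_wpM2l (_ : 0 <= 1 - q) h1; rewrite subr_ge0 in h2.
have h3 : 0 <= (q * (1 - b) - 2 * b ^+ 2) * tw.
  apply: mulr_ge0; last exact: ltW.
  have := ler_wpM2l (_ : 0 <= 1 - b) q_ge; rewrite subr_ge0 => /(_ ltac:(lra)).
  have : 0 <= b ^+ 2 * (1 - 2 * b) by rewrite mulr_ge0 ?sqr_ge0//; lra.
  lra.
by have := h2 q_le1; lra.
Qed.

(** 9/20 and 3/20 are one twentieth of the coefficients 9 and 3 left by [dev_step], because the
    distance to [uh] enters the potential [Y] with the factor 20 l. *)
Let gain_ge_strong u w : 3 / 16 * q * ((1 - q) * nsq (u - uh) + nsq (w - uh))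
    + 9 / 20 * b * nsq (half u w - uh) + 3 / 20 * q * nsq (half u w - w)
  <= gain Z F i1 gamma p q b z m uh u w.
Proof.
pose a := half u w; rewrite /gain -/a.
have E1 (v : 'rV[R]_d) : nsq (v - uh) <= 2 * nsq (a - uh) + 2 * nsq (a - v).
  have := dot_addr_le2 (a - uh) (v - a); rewrite (dot_subC v a).
  by rewrite (_ : a - uh + (v - a) = v - uh)// addrC addrA subrK.
have nq : 0 <= 1 - q by rewrite subr_ge0.
have r0 : 0 <= 3 / 16 * q by rewrite mulr_ge0//; lra.
have h1 := ler_wpM2l r0 (E1 w); have h2 := ler_wpM2l (mulr_ge0 r0 nq) (E1 u).
have h3 : 0 <= q * nsq (a - w) by rewrite mulr_ge0 ?dot_ge0.
have h4 : 0 <= (81 / 40 * b - q) * nsq (a - uh).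
  rewrite mulr_ge0 ?dot_ge0//; have : 0 <= b * (1 / 2 - b).
    by apply: mulr_ge0; [exact: ltW | rewrite subr_ge0].
  by move: q_le; lra.
have h5 : 0 <= (1 - q) * ((1 - 3 / 8 * q) * nsq (a - u)).
  rewrite mulr_ge0// mulr_ge0 ?dot_ge0//; move: q_le1; lra.
have h6 : 0 <= q * (q * nsq (a - uh)) by rewrite !mulr_ge0 ?dot_ge0.
have h7 : 0 <= b * nsq (a - uh) by rewrite mulr_ge0 ?dot_ge0 ?ltW.
move: h1 h2 h3 h4 h5 h6 h7; lra.
Qed.

Variable zh : 'rV[R]_d.
Hypothesis Zzh : Z zh.
Local Notation La := (zh - uh).
Local Notation dd := (- dot N La).

(** Potential of the weights: twenty times its drop below (1 - 3/16 q) T pays for the force of the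
    normal vector. *)
Let T (th : R * R) := 3 / 5 * (1 - q) * th.1 + th.2.

Let T_drift th : weight_inv th ->
  let ta := (1 - q) * th.1 + (q - b) * th.2 in
  2 * b * (2 * b * ta + 2 * b ^+ 2 * (th.2 - ta))
    + (1 - 2 * b) * (2 * b ^+ 2 * ta + 2 * b * next_weight th) <=
  20 * ((1 - 3 / 16 * q) * T th - (q * T (weight_step true th) + (1 - q) * T (weight_step false th))).
Proof.
case: th => tu tw [/= tu0 tuw tw0 tw1 low].
have := weight_drift (ltW b_gt0) b_le q_ge q_le q_le1 tu0 tuw low
  (erefl ((1 - q) * tu + (q - b) * tw)) (erefl (next_weight (tu, tw))).
rewrite /T /weight_step /=; move: (next_weight _) => tn; lra.
Qed.

Let Inv1 (s : ('rV[R]_d * 'rV[R]_d) * (R * R)) := Inv0 s /\ weight_inv s.2.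

Definition fin_in (s : ('rV[R]_d * 'rV[R]_d) * (R * R)) :=
  [/\ Z s.1.1, Z s.1.2 & weight_inv s.2].

Lemma fin_in_step j c s : fin_in s -> fin_in (ext_step j c s).
Proof.
case=> Zu Zw I; have [h1 h2] := @Inv0_step s j c (conj Zu Zw).
by split => //; exact: weight_inv_step.
Qed.

Lemma fin_in_start : fin_in ext_start.
Proof. by split=> //; exact: weight_inv_start. Qed.

Let Inv1_step s j c : Inv1 s -> Inv1 (ext_step j c s).
Proof.
by case=> I0 I1; split; [exact: Inv0_step | exact: weight_inv_step].
Qed.

Let start_Inv1 : Inv1 ext_start.
Proof. by split; [split | exact: weight_inv_start]. Qed.

Let Tge th : weight_inv th -> th.1 <= T th.
Proof.
case: th => tu tw [/= tu0 tuw _ _ _]; rewrite /T /=.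
by have := mulr_ge0 (_ : 0 <= 1 - q) tu0; rewrite subr_ge0 => /(_ q_le1); lra.
Qed.

Let T_ge0 th : weight_inv th -> 0 <= T th.
Proof. by move=> I; apply: le_trans (Tge I); case: I. Qed.

Lemma mean_weight_le : E (fun s => s.2.1) <= (1 - 3 / 16 * q) ^+ H * 2.
Proof.
have nq : 0 <= 1 - q by rewrite subr_ge0.
have r0 : 0 <= 1 - 3 / 16 * q by move: q_le1; lra.
pose TT (s : ('rV[R]_d * 'rV[R]_d) * (R * R)) := T s.2.
apply: (@le_trans _ _ (E TT)).
  apply: (iter_chain_mono q0 q_le1 H Inv1_step start_Inv1) => s [_ Is].
  exact: Tge.
apply: (@le_trans _ _ ((1 - 3 / 16 * q) ^+ H * TT ext_start)); last first.
  by rewrite ler_wpM2l ?exprn_ge0// /TT /T /=; move: q0; lra.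
apply: (iter_chain_le q0 q_le1 H r0 Inv1_step _ start_Inv1) => s [_ Is].
have -> : op TT s = q * T (weight_step true s.2) + (1 - q) * T (weight_step false s.2).
  by rewrite chain_opE /TT /= (Ej_cst M_gt0).
have := T_drift Is; rewrite /TT /=.
case: s.2 Is => tu tw [/= tu0 tuw tw0 tw1 low].
pose ta := (1 - q) * tu + (q - b) * tw.
have t0 := tha_gt0 b_gt0 tw0 low (erefl ta); have t2 := tha_le b_gt0 q_le1 tuw tw0 (erefl ta).
have /andP[t3 t4] := thn_bounds b_gt0 b_le q_le1 tuw tw0 low (erefl ta) (erefl (next_weight (tu, tw))).
rewrite -/ta; have b0 := ltW b_gt0.
have b2 : 0 <= 1 - 2 * b by move: b_le; lra.
have : 0 <= 2 * b * (2 * b * ta + 2 * b ^+ 2 * (tw - ta))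
    + (1 - 2 * b) * (2 * b ^+ 2 * ta + 2 * b * next_weight (tu, tw)).
  have t0' := ltW t0; have t2' : 0 <= tw - ta by rewrite subr_ge0.
  by repeat first [assumption | apply: addr_ge0 | apply: mulr_ge0 | exact: sqr_ge0 | exact: ler0n].
lra.
Qed.

Lemma inner_deviation :
  E (fun s => nsq (s.1.1 - uh - s.2.1 *: La)) <=
  (1 - 3 / 16 * q) ^+ H * (2 * nsq (z - zh) + 40 * l * nsq (z - uh) + 32 * dd).
Proof.
have nq : 0 <= 1 - q by rewrite subr_ge0.
have r0 : 0 <= 1 - 3 / 16 * q by move: q_le1; lra.
have l0 := ltW (l_gt0 L_gt0 gamma_gt0).
have d0 := dd_ge0 uh_hat Zzh.
(* Three layers: the deviation, the distance to [uh] paying for the Lipschitz errors, and the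
   weights paying for the force. At the start the last layer is at most 20 (3/5 + 1) = 32 times
   [dd]. *)
pose Y (s : ('rV[R]_d * 'rV[R]_d) * (R * R)) :=
  (1 - q) * nsq (s.1.1 - uh - s.2.1 *: La) + nsq (s.1.2 - uh - s.2.2 *: La)
  + 20 * l * ((1 - q) * nsq (s.1.1 - uh) + nsq (s.1.2 - uh)) + 20 * dd * T s.2.
have opY s : op Y s = Ej (fun j => nsq (next j s.1.1 s.1.2 - uh - next_weight s.2 *: La))
    + (20 * l * Ej (fun j => nsq (next j s.1.1 s.1.2 - uh))
    + ((1 - q) * (nsq (s.1.2 - uh - s.2.2 *: La) + 20 * l * nsq (s.1.2 - uh))
       + 20 * dd * (q * T (weight_step true s.2) + (1 - q) * T (weight_step false s.2)))).
  rewrite chain_opE -[X in _ + (_ + X)](Ej_cst M_gt0) -EjZ -!EjD; congr Ej.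
  by apply: funext => j; rewrite /Y /=; ring.
apply: (@le_trans _ _ ((1 - 3 / 16 * q) ^+ H * Y ext_start)).
  apply: (iter_chain_decay q0 q_le1 H_gt0 r0 Inv1_step start_Inv1) => s [I0 I1].
    rewrite opY; case: s I0 I1 => [[u w] [tu tw]] /= [Zu Zw] I1.
    have := T_drift I1; case: I1 => /= tu0 tuw tw0 tw1 low /(ler_wpM2l d0) h1.
    have h2 := dev_step Z_nonempty Z_closed Z_convex M_gt0 L_gt0 gamma_gt0 b_gt0 b_le F_lip F_mono
      uh_hat q_def q_le1 Zzh Zw tuw tw0 tw1 low erefl (erefl (next_weight (tu, tw))) (erefl (u - uh - tu *: La))
      (erefl (w - uh - tw *: La)) erefl l_le.
    have h3 := Ej_contract Z_nonempty Z_closed Z_convex M_gt0 L_gt0 gamma_gt0 b_gt0 F_lip F_mono uh_hat q_def u Zw.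
    have h4 := gain_ge_strong u w.
    have h5 := ler_wpM2l l0 h3; have h6 := ler_wpM2l l0 h4.
    have d1 : 0 <= nsq (half u w - uh) by exact: dot_ge0.
    rewrite /Y /=; move: h1 h2 h3 h5 h6; rewrite /=.
    set A := nsq (u - uh - _); set B := nsq (w - uh - _).
    set C := nsq (u - uh); set D := nsq (w - uh); set G := gain _ _ _ _ _ _ _ _ _ _ _ _.
    set E1 := Ej _; set E2 := Ej _; set T0 := T (tu, tw).
    set T1 := T (weight_step true (tu, tw)); set T2 := T (weight_step false (tu, tw)).
    set ta := (1 - q) * tu + (q - b) * tw; set tn := next_weight (tu, tw).
    move: (nsq (half u w - uh)) (nsq (half u w - w)) => ao aw.
    move: (- dot N La) => dz.
    move: A B C D G E1 E2 T0 T1 T2 ta tn => A B C D G E1 E2 T0 T1 T2 ta tn.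
    move: (gamma * L) => x; lra.
  rewrite opY chain_opE.
  have -> : (fun j => q * nsq ((ext_step j true s).1.1 - uh - (ext_step j true s).2.1 *: La)
       + (1 - q) * nsq ((ext_step j false s).1.1 - uh - (ext_step j false s).2.1 *: La)) =
       (fun j => nsq (next j s.1.1 s.1.2 - uh - next_weight s.2 *: La)).
    by apply: funext => j /=; ring.
  have T1 := T_ge0 (weight_inv_step true I1); have T2 := T_ge0 (weight_inv_step false I1).
  have e0 : 0 <= Ej (fun j => nsq (next j s.1.1 s.1.2 - uh)).
    by rewrite -(Ej_cst M_gt0 0); apply: Ej_le => j; exact: dot_ge0.
  by rewrite lerDl; repeat first [assumption | exact: q0 | exact: ler0n | exact: dot_ge0
    | apply: addr_ge0 | apply: mulr_ge0].
rewrite ler_wpM2l ?exprn_ge0// /Y /T /= scale1r.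
have -> : z - uh - La = z - zh by rewrite opprB addrA subrK.
have h1 := mulr_ge0 q0 (dot_ge0 (z - zh)); have h2 := mulr_ge0 (mulr_ge0 l0 q0) (dot_ge0 (z - uh)).
have h3 := mulr_ge0 q0 d0; lra.
Qed.

End InnerChainRates.

(** * The extended run *)

Section ExtendedRun.
Variables (R : realType) (c : regime) (d n r M H : nat).
Variables (Z : set 'rV[R]_d) (F : 'I_n -> 'I_M -> 'rV[R]_d -> 'rV[R]_d) (i1 : 'I_n).
Variables (gamma p q b : R) (hat : 'rV[R]_d -> 'rV[R]_d -> 'rV[R]_d) (x : 'rV[R]_d).
Local Notation nsq v := (dot v v).
Local Notation draws := (forall a : draw n H, outcome c d r M a).
Let lw : forall a : draw n H, outcome c d r M a -> R := draw_law p q.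

(* Besides (z, m), the state carries shadow iterates (zh, mh) moving without
   error along the segments towards the exact solutions of the inner problem,
   and a vector st_n such that st_n - gamma F(x) is normal to Z at zh up to the
   error st_t. *)
Record state := State {
  st_z : 'rV[R]_d; st_m : 'rV[R]_d; st_zh : 'rV[R]_d; st_mh : 'rV[R]_d;
  st_n : 'rV[R]_d; st_t : R }.

Local Notation fin := (('rV[R]_d * 'rV[R]_d) * (R * R))%type.

Definition st_hat s := hat (st_z s) (st_m s).
Definition st_N s := normal_of F i1 gamma p (st_z s) (st_m s) (st_hat s).
Definition st_d s := - dot (st_N s) (st_zh s - st_hat s).
Definition st_next_zh s (f : fin) := st_hat s + f.2.1 *: (st_zh s - st_hat s).

(** The vector st_n - gamma F(x) becomes [st_N], normal at the exact solution; moving the base point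
    back by the fraction theta towards [st_zh] costs theta times [st_d]. *)
Definition next_state s (zn : 'rV[R]_d) (coin : bool) (f : fin) : state :=
  State zn (if coin then st_z s else st_m s) (st_next_zh s f)
    (if coin then st_zh s else st_mh s) (gamma *: full_op F x + st_N s) (f.2.1 * st_d s).

Definition inner_run k s (y : draws) : fin :=
  inner_fold (ext_step Z F i1 gamma p q b (st_z s) (st_m s)) k (ext_start (st_z s)) y.

Definition state_step (y : draws) k s : state :=
  let f := inner_run k s y in
  next_state s (proj Z (f.1.1 + gamma *: correction F i1 (st_m s) f.1.1 y k))
    (y (@RefCoin n H k)) f.

Definition state_start z0 := State z0 z0 x x 0 0.

Lemma state_step_local y y' k s : (forall a, a \in step_draws n H k -> y a = y' a) ->
  state_step y k s = state_step y' k s.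
Proof.
move=> yy; rewrite /state_step.
have -> : inner_run k s y = inner_run k s y'.
  by apply: inner_fold_local => a ak; apply: yy; rewrite mem_cat ak.
have [h1 h2 h3] := mem_outer_draws n H k.
have yo a : a \in outer_draws n H k -> y a = y' a by move=> ak; apply: yy; rewrite mem_cat ak orbT.
rewrite (yo _ h3); congr (next_state _ (proj Z (_ + _ *: _)) _ _).
rewrite /correction (yo _ h2); congr (_ *: _); apply: eq_bigr => i _; congr compressor.
by rewrite /centered_increment !yo.
Qed.

Lemma inner_loop_ext z m (ts : seq 'I_H) (j : 'I_H -> 'I_M) (coin : 'I_H -> bool)
    eta tau alpha uw th : gamma != 0 -> eta = gamma * b -> tau = p -> alpha = 1 - q ->
  foldl (fun uw t => inner_step Z F i1 gamma eta tau alpha z m (j t) (coin t) uw) uw ts =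
  (foldl (fun s t => ext_step Z F i1 gamma p q b z m (j t) (coin t) s) (uw, th) ts).1.
Proof.
move=> g0 e1 e2 e3; elim: ts uw th => //= t ts ih [u w] th.
by rewrite (inner_stepE Z F i1 z m (j t) (coin t) u w g0 e1 e2 e3) (ih _ (weight_step q b (coin t) th)).
Qed.

Lemma iterates_run eta tau alpha z0 y k : gamma != 0 -> eta = gamma * b -> tau = p -> alpha = 1 - q ->
  iterates Z F i1 gamma eta tau alpha z0 y k =
  (st_z (run state_step (state_start z0) y k), st_m (run state_step (state_start z0) y k)).
Proof.
move=> g0 e1 e2 e3; elim: k => //= k ->; set s := run _ _ _ _.
rewrite /outer_step /inner_loop.
rewrite (inner_loop_ext _ _ _ _ _ _ (1, 1) g0 e1 e2 e3) -/(ext_start _).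
by [].
Qed.

Hypotheses (Z_nonempty : Z !=set0) (Z_closed : closed Z) (Z_convex : convex_set Z).
Hypothesis lw_sum : forall a : draw n H, \sum_(o : outcome c d r M a) lw o = 1.
Hypothesis lw_ge0 : forall (a : draw n H) (o : outcome c d r M a), 0 <= lw o.
Hypothesis hc : regime_ok c d n r.
Hypotheses (n_gt0 : (0 < n)%N) (M_gt0 : (0 < M)%N).
Variable S : R.
Hypothesis F_sim : mean_square_similar Z F S.

(** Upper bound for the mean of |z_new - y|^2 once the inner loop has ended at [u]: drift and
    variance of the compressed correction, the projection only shortening distances to points of
    [Z]. *)
Definition noisy_sq m u y : R :=
  nsq (u - y) + 2 * gamma * dot (u - y) (gap F i1 m u) + gamma ^+ 2 * (S ^+ 2 * nsq (u - m)).

Lemma avg_outer_proj k m u y v : Z m -> Z u -> Z y ->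
  avg lw (outer_draws n H k) (fun w => nsq (proj Z (u + gamma *: correction F i1 m u w k) - y)) v
  <= noisy_sq m u y.
Proof.
move=> Zm Zu Zy.
apply: le_trans (avg_outer_draws lw_sum lw_ge0 hc n_gt0 i1 F_sim k (u - y) gamma v Zm Zu).
apply: avg_le => // w _.
have := proj_dot_le Z_nonempty Z_closed Z_convex (u + gamma *: correction F i1 m u w k) Zy.
by rewrite addrAC.
Qed.

Hypothesis hatP : forall z m, is_hat Z F i1 gamma p z m (hat z m).
Variable L : R.
Hypotheses (L_gt0 : 0 < L) (gamma_gt0 : 0 < gamma) (b_gt0 : 0 < b) (b_le : b <= 1 / 2).
Hypotheses (q_def : q = 4 * b ^+ 2 * (1 + gamma * L) ^+ 2) (q_le1 : q <= 1).

(** Turns an outer step into the inner Markov operator for functions quadratic in the new [z],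
    centred at the solution and at the new shadow iterate. *)
Lemma avg_state_step k s (f : state -> R) (c1 c2 : R) (G : bool -> fin -> R) v :
  0 <= c1 -> 0 <= c2 -> Z (st_z s) -> Z (st_m s) -> Z (st_zh s) ->
  (forall zn coin fi, f (next_state s zn coin fi) =
     c1 * nsq (zn - x) + c2 * nsq (zn - st_next_zh s fi) + G coin fi) ->
  Z x ->
  avg lw (step_draws n H k) (fun y => f (state_step y k s)) v
  <= iter H (chain_op q (ext_step Z F i1 gamma p q b (st_z s) (st_m s)))
       (fun fi => c1 * noisy_sq (st_m s) fi.1.1 x
         + c2 * noisy_sq (st_m s) fi.1.1 (st_next_zh s fi) + (p * G true fi + (1 - p) * G false fi))
       (ext_start (st_z s)).
Proof.
move=> c10 c20 Zz Zm Zzh fE Zx.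
pose fo (fi : fin) (y : draws) := f (next_state s
  (proj Z (fi.1.1 + gamma *: correction F i1 (st_m s) fi.1.1 y k)) (y (@RefCoin n H k)) fi).
apply: (avg_step_le lw_ge0 (f := fo) (Inv := @fin_in R d Z q b)).
- move=> j co fi; exact: (fin_in_step F i1 p (st_z s) (st_m s) Z_nonempty Z_closed L_gt0 gamma_gt0 b_gt0 b_le q_def q_le1).
- exact: (fin_in_start q b_gt0 b_le).
move=> fi w [Zu _ [th0 th1 _ th2 _]].
have Zn : Z (st_next_zh s fi).
  by apply: (segment_in Z_convex (hatP _ _) Zzh th0); exact: le_trans th2.
have -> : fo fi = (fun y => c1 * nsq (proj Z (fi.1.1 + gamma *: correction F i1 (st_m s) fi.1.1 y k) - x)
   + c2 * nsq (proj Z (fi.1.1 + gamma *: correction F i1 (st_m s) fi.1.1 y k) - st_next_zh s fi)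
   + G (y (@RefCoin n H k)) fi) by apply: funext => y; rewrite /fo fE.
rewrite !avgD !avgZ (avg_ref_coin lw_sum k (fun co => G co fi)) lerD2r.
by apply: lerD; rewrite ler_wpM2l//; exact: avg_outer_proj.
Qed.

End ExtendedRun.

(** * Distance to the solution after an outer step *)

Section BaseInequality.
Variables (R : realType) (d n M : nat).
Variables (Z : set 'rV[R]_d) (F : 'I_n -> 'I_M -> 'rV[R]_d -> 'rV[R]_d) (i1 : 'I_n).
Variables (gamma p S mu : R).
Hypotheses (n_gt0 : (0 < n)%N) (M_gt0 : (0 < M)%N).
Hypotheses (F_sim : mean_square_similar Z F S) (gamma_gt0 : 0 < gamma) (mu_gt0 : 0 < mu).
Local Notation nsq v := (dot v v).
Local Notation kap := (gamma ^+ 2 * S ^+ 2).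
Variables (z m uh u x : 'rV[R]_d).
Hypotheses (Zm : Z m) (Zuh : Z uh) (Zu : Z u).
Local Notation N := (normal_of F i1 gamma p z m uh).

Let normal_split : uh - (z + p *: (m - z)) = - N - gamma *: full_op F uh - gamma *: gap F i1 m uh.
Proof.
rewrite /normal_of /drift /gap.
move: (full_op F uh) (full_op F m) (node_op F i1 uh) (node_op F i1 m) => a1 a2 a3 a4.
by apply/rowP => k; rewrite !mxE; ring.
Qed.

Let center_sq : nsq (uh - x) + 2 * gamma * dot (uh - x) (gap F i1 m uh) =
  (1 - p) * (nsq (z - x) - nsq (uh - z)) + p * (nsq (m - x) - nsq (uh - m))
  - 2 * dot N (uh - x) - 2 * gamma * dot (full_op F uh) (uh - x).
Proof.
have e : dot (uh - (z + p *: (m - z))) (uh - x) =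
    - dot N (uh - x) - gamma * dot (full_op F uh) (uh - x) - gamma * dot (gap F i1 m uh) (uh - x).
  rewrite normal_split; move: N (full_op F uh) (gap F i1 m uh) => v1 v2 v3.
  by rewrite [LHS]dotDl [X in X + _]dotDl !dotNl !dotZl.
have -> : nsq (uh - x) + 2 * gamma * dot (uh - x) (gap F i1 m uh) =
    nsq (uh - x) - 2 * dot (uh - (z + p *: (m - z))) (uh - x)
    - 2 * dot N (uh - x) - 2 * gamma * dot (full_op F uh) (uh - x).
  by rewrite e (dotC (uh - x)); ring.
congr (_ - _ - _).
rewrite !(dotDl, dotDr, dotNl, dotNr, dotZl, dotZr).
rewrite (dotC x z) (dotC x m) (dotC x uh) (dotC z uh) (dotC m uh); ring.
Qed.

(** The exact solution contributes a three-point identity between [z], [m] and [x]; the similarity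
    constant enters only through [kap]. The cross term with u - uh is kept, since the two regimes
    treat it differently. *)
Lemma noisy_sq_le : noisy_sq F i1 gamma S m u x <=
  (1 - p) * (nsq (z - x) - nsq (uh - z)) + p * nsq (m - x) - (p - 4 * kap) * nsq (uh - m)
  - 2 * dot N (uh - x) - 2 * gamma * dot (full_op F uh) (uh - x)
  + gamma * mu / 4 * nsq (uh - x) + 2 * dot (uh - x) (u - uh)
  + (2 + 4 * kap + 4 * kap / (gamma * mu)) * nsq (u - uh).
Proof.
pose e := u - uh; pose dc := gap F i1 m u - gap F i1 m uh.
have gm : 0 < gamma * mu by rewrite mulr_gt0.
have e1 : nsq (u - x) = nsq (uh - x) + 2 * dot (uh - x) e + nsq e.
  have -> : u - x = (uh - x) + e by rewrite /e [RHS]addrC addrA subrK.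
  by rewrite [LHS]dotDl !(dotDr _ (uh - x)) (dotC e); ring.
have e2 : dot (u - x) (gap F i1 m u) =
    dot (uh - x) (gap F i1 m uh) + dot (uh - x) dc + dot e (gap F i1 m u).
  have -> : u - x = (uh - x) + e by rewrite /e [RHS]addrC addrA subrK.
  rewrite [LHS]dotDl -(dotDr (uh - x)); congr (dot _ _ + _).
  by rewrite /dc addrC subrK.
have h1 : 2 * gamma * dot (uh - x) dc <= gamma * mu / 4 * nsq (uh - x) + 4 * kap / (gamma * mu) * nsq e.
  have t0 : 0 < mu / 4 by rewrite divr_gt0.
  have := ler_wpM2l (ltW gamma_gt0) (dot_young (uh - x) dc t0).
  have := gap_lip i1 n_gt0 M_gt0 F_sim m Zu Zuh; rewrite -/e -/dc => hd.
  have t1 : 0 <= gamma * (mu / 4)^-1 by rewrite mulr_ge0 ?invr_ge0 ?ltW.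
  have := ler_wpM2l t1 hd.
  have -> : gamma * (mu / 4)^-1 * (S ^+ 2 * nsq e) = 4 * kap / (gamma * mu) * nsq e.
    by field; rewrite !gt_eqF.
  lra.
have h2 : 2 * gamma * dot e (gap F i1 m u) <= nsq e + kap * nsq (u - m).
  have := dot_young e (gamma *: gap F i1 m u) ltr01; rewrite !dotZr dotZl invr1 !mul1r.
  have := ler_wpM2l (sqr_ge0 gamma) (gap_le i1 n_gt0 M_gt0 F_sim Zu Zm); lra.
have h3 : nsq (u - m) <= 2 * nsq (uh - m) + 2 * nsq e.
  have -> : u - m = (uh - m) + e by rewrite /e [RHS]addrC addrA subrK.
  exact: dot_addr_le2.
have k0 : 0 <= kap by rewrite mulr_ge0 ?sqr_ge0.
have h4 := ler_wpM2l k0 h3.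
rewrite /noisy_sq e1 e2 -/e; have := center_sq; rewrite -/e.
move: h1 h2 h4; move: (4 * kap / (gamma * mu)) => A; lra.
Qed.

End BaseInequality.

(** * Numerical consequences of the parameters *)

(** Strong monotonicity and Cauchy-Schwarz at one pair of distinct points. It yields X >= 160, the
    source of the numerical smallness below. *)
Lemma strong_le_lip (R : realType) (d n M : nat) (Z : set 'rV[R]_d)
    (F : 'I_n -> 'I_M -> 'rV[R]_d -> 'rV[R]_d) (L mu : R) u v :
  (0 < n)%N -> (0 < M)%N -> 0 <= L -> 0 <= mu ->
  strongly_monotone_on Z (full_op F) mu -> mean_square_lipschitz Z F L ->
  Z u -> Z v -> u != v -> mu <= L.
Proof.
move=> n0 M0 L0 mu0 hs hl Zu Zv uv.
have D0 : 0 < dot (u - v) (u - v) by rewrite lt_def dot_eq0 subr_eq0 uv dot_ge0.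
have h1 := hs _ _ Zu Zv; rewrite enorm_sqr in h1.
have h2 := full_op_lip n0 hl Zu Zv.
have h3 := dot_CS (full_op F u - full_op F v) (u - v).
rewrite -(ler_pM2r D0) -ler_sqr ?nnegrE ?mulr_ge0 ?(ltW D0)//.
apply: (@le_trans _ _ (dot (full_op F u - full_op F v) (u - v) ^+ 2)).
  rewrite ler_sqr ?nnegrE// ?mulr_ge0 ?(ltW D0)//.
  by apply: le_trans h1; rewrite mulr_ge0 ?(ltW D0).
by apply: le_trans h3 _; have := ler_wpM2r (ltW D0) h2; rewrite exprMn -mulrA -expr2.
Qed.

Lemma decay_le (R : realType) (X r : R) (H k : nat) : 0 < X -> 0 <= r -> r <= 1 ->
  k%:R * ln X <= r * H%:R -> (1 - r) ^+ H <= X ^- k.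
Proof.
move=> X0 r0 r1 h.
have e1 : 1 - r <= expR (- r) by exact: expR_ge1Dx.
apply: (@le_trans _ _ (expR (- r) ^+ H)).
  by rewrite lerXn2r ?nnegrE ?subr_ge0 ?expR_ge0.
have -> : X ^- k = expR (- (k%:R * ln X)).
  by rewrite expRN expRM_natl lnK.
by rewrite -expRM_natl ler_expR mulrN lerN2 [leRHS]mulrC.
Qed.

Section StepSizes.
Variables (R : realType) (M H : nat) (L mu delta gamma eta p q : R).
Hypotheses (hM : (0 < M)%N) (L_gt0 : 0 < L) (mu_gt0 : 0 < mu) (delta_gt0 : 0 < delta).
Hypotheses (gamma_gt0 : 0 < gamma) (p_gt0 : 0 < p) (p_le : p <= 4%:R^-1).
Hypothesis gamma_def : gamma =
     Num.min (p / (3%:R * mu))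
       (Num.min (Num.sqrt p / (4%:R * delta))
          (L^-1 * (H%:R / (12%:R * Num.sqrt M%:R * ln (40%:R * L / (mu * p))) - 1))).
Hypothesis eta_def : eta = (2%:R * Num.sqrt M%:R * (L + gamma^-1))^-1.
Hypothesis q_def : q = M%:R^-1.
Hypothesis H_ge : 16%:R * M%:R * ln (40%:R * L / (mu * p)) <= H%:R.
Hypothesis mu_le : mu <= L.
Local Notation X := (40 * L / (mu * p)).
Local Notation b := (eta / gamma).

Lemma ratio_ge : 160 <= X.
Proof.
have mp : 0 < mu * p by rewrite mulr_gt0.
rewrite ler_pdivlMr//; have := ler_wpM2l (ltW mu_gt0) p_le.
have -> : (4%:R : R)^-1 = 1 / 4 by rewrite mul1r.
move: mu_le; lra.
Qed.

Let X0 : 0 < X. Proof. by apply: lt_le_trans ratio_ge; rewrite ltr0n. Qed.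
Let lnX0 : 0 < ln X.
Proof. by rewrite ln_gt0//; apply: lt_le_trans ratio_ge; rewrite ltr1n. Qed.
Let sM0 : 0 < Num.sqrt (M%:R : R). Proof. by rewrite sqrtr_gt0 ltr0n. Qed.
Let sM1 : 1 <= Num.sqrt (M%:R : R). Proof. by rewrite -{1}sqrtr1 ler_sqrt ?ler1n// ler0n. Qed.
Let sMM : Num.sqrt (M%:R : R) ^+ 2 = M%:R. Proof. by rewrite sqr_sqrtr ?ler0n. Qed.

Lemma step_ratioE : b = (2 * Num.sqrt M%:R * (1 + gamma * L))^-1.
Proof.
rewrite eta_def; have g0 := lt0r_neq0 gamma_gt0; have s0 := lt0r_neq0 sM0.
have l0 : 1 + gamma * L != 0 by rewrite gt_eqF// addr_gt0// mulr_gt0.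
have l1 : L + gamma^-1 != 0 by rewrite gt_eqF// addr_gt0// invr_gt0.
by field; rewrite l0 s0 g0.
Qed.

Lemma step_ratio_gt0 : 0 < b.
Proof. by rewrite step_ratioE invr_gt0 !mulr_gt0// addr_gt0// mulr_gt0. Qed.

Lemma step_ratio_le : b <= 1 / 2.
Proof.
have gl := mulr_gt0 gamma_gt0 L_gt0.
rewrite step_ratioE -[1 / 2]invrK lef_pV2 ?posrE ?invr_gt0 ?mulr_gt0 ?divr_gt0 ?addr_gt0//.
rewrite (_ : (1 / 2)^-1 = 2); last by field.
have := mulr_ge0 (ltW sM0) (ltW gl); move: sM1; lra.
Qed.

Lemma qE : q = 4 * b ^+ 2 * (1 + gamma * L) ^+ 2.
Proof.
rewrite step_ratioE q_def -{1}sMM; have s0 := lt0r_neq0 sM0.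
have l0 : 1 + gamma * L != 0 by rewrite gt_eqF// addr_gt0// mulr_gt0.
by field; rewrite l0 s0.
Qed.

Lemma q_le_one : q <= 1.
Proof. by rewrite q_def invf_le1 ?ltr0n// ler1n. Qed.

Lemma q_pos : 0 < q. Proof. by rewrite q_def invr_gt0 ltr0n. Qed.

Lemma qH : 16 * ln X <= q * H%:R.
Proof.
have Mp : (0 : R) < M%:R by rewrite ltr0n.
rewrite q_def [leRHS]mulrC ler_pdivlMr//; move: H_ge; lra.
Qed.

(** The condition on [H] gives 16 ln X <= q H, and 3/16 of it produces the exponent 3. *)
Lemma slow_decay : (1 - 3 / 16 * q) ^+ H <= X ^- 3.
Proof.
have := q_pos; have := q_le_one; have := qH => h1 h2 h3.
by apply: decay_le => //; lra.
Qed.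

(** That [gamma] is at most the last entry of its minimum means exactly 12 sqrt M (1 + gamma L) ln X
    <= H. *)
Lemma bH : 3 * ln X <= b / 2 * H%:R.
Proof.
have gl := mulr_gt0 gamma_gt0 L_gt0.
have l0 : 0 < 1 + gamma * L by rewrite addr_gt0.
have h : gamma <= L^-1 * (H%:R / (12%:R * Num.sqrt M%:R * ln X) - 1).
  by rewrite {1}gamma_def !ge_min lexx !orbT.
have h1 : (1 + gamma * L) * (12%:R * Num.sqrt M%:R * ln X) <= H%:R.
  rewrite -ler_pdivlMr ?mulr_gt0 ?ltr0n//.
  by have := ler_wpM2r (ltW L_gt0) h; rewrite mulrAC mulVf ?gt_eqF// mul1r; lra.
have c0 : 0 < 2 * Num.sqrt M%:R * (1 + gamma * L) by rewrite !mulr_gt0.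
have -> : b / 2 * H%:R = H%:R / (2 * (2 * Num.sqrt M%:R * (1 + gamma * L))).
  by rewrite step_ratioE [in RHS]invfM; ring.
rewrite ler_pdivlMr ?mulr_gt0 //; move: h1; lra.
Qed.

Definition fast_rate := Num.min (3 / 8 * q) (b / 2).

Lemma fast_rate_ge0 : 0 <= fast_rate.
Proof. by rewrite le_min; apply/andP; split; [have := q_pos; lra | have := step_ratio_gt0; lra]. Qed.

Lemma fast_rate_le : 2 * fast_rate <= 3 / 4 * q /\ 2 * fast_rate <= b.
Proof.
have h1 : fast_rate <= 3 / 8 * q by rewrite ge_min lexx.
have h2 : fast_rate <= b / 2 by rewrite ge_min lexx orbT.
by split; lra.
Qed.

Lemma fast_decay : (1 - fast_rate) ^+ H <= X ^- 3.
Proof.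
have [h1 h2] := fast_rate_le; have := step_ratio_le => h3.
apply: decay_le => //; [exact: fast_rate_ge0 | lra |].
rewrite minr_pMl ?ler0n// le_min bH andbT; have := qH; have := lnX0; lra.
Qed.

Lemma gamma_mu : gamma * mu <= p / 3.
Proof.
have h : gamma <= p / (3%:R * mu) by rewrite {1}gamma_def ge_min lexx.
by have := ler_wpM2r (ltW mu_gt0) h; rewrite invfM mulrA mulfVK ?gt_eqF.
Qed.

Lemma gamma_delta : gamma ^+ 2 * delta ^+ 2 <= p / 16.
Proof.
have h : gamma <= Num.sqrt p / (4%:R * delta) by rewrite {1}gamma_def !ge_min lexx orbT.
have h2 : gamma * (4 * delta) <= Num.sqrt p by rewrite -ler_pdivlMr// mulr_gt0.
have h3 : (gamma * (4 * delta)) ^+ 2 <= p.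
  have h0 : 0 <= gamma * (4 * delta) by rewrite !mulr_ge0 ?ltW.
  by rewrite -[leRHS](sqr_sqrtr (ltW p_gt0)) lerXn2r ?nnegrE ?sqrtr_ge0.
move: h3; rewrite !exprMn; lra.
Qed.

End StepSizes.

(** * The regime of small steps *)

Section ShadowAlgebra.
Variables (R : realType) (d : nat).
Local Notation nsq v := (dot v v).
Implicit Types (zh mh u x f k w D g : 'rV[R]_d).

(** Three-point identity for the anchored proximal step from [zh] on the linear function <f, .>,
    with perturbation [k]; it is exact because the energy is quadratic. *)
Lemma shadow_potential (gam p : R) zh mh u x f k N :
  u - zh = p *: (mh - zh) + k - (gam *: f + N) ->
  gam * dot f (u - x) + p / 2 * nsq (u - mh) =
  gam * dot f (zh - x) + p / 2 * nsq (zh - mh) - (1 - p / 2) * nsq (u - zh)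
    + dot k (u - zh) - dot N (u - zh).
Proof.
move=> e; have -> : N = p *: (mh - zh) + k - (u - zh) - gam *: f.
  by rewrite e; apply/rowP => i; rewrite !mxE; ring.
clear e; rewrite !(dotDl, dotDr, dotNl, dotNr, dotZl, dotZr).
by rewrite ?(dotC zh mh) ?(dotC u mh) ?(dotC u zh); field.
Qed.

(** Expands |k - (n1 - n0)|^2 >= 0 for the new vector n1 = k + p w - D; the hypothesis is the
    normality of n0 - g at the old point, up to [t]. *)
Lemma shadow_residual (p t : R) k w D (n0 : 'rV[R]_d) g :
  dot (n0 - g) D <= t ->
  nsq (k + p *: w - D) - 2 * p * dot (k + p *: w - D - g) w <=
  nsq n0 - 2 * p * dot (n0 - g) w + nsq k - 2 * dot (k + p *: w - D - g) D + 2 * t.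
Proof.
have := dot_ge0 (k - (k + p *: w - D - n0)).
rewrite !(dotDl, dotDr, dotNl, dotNr, dotZl, dotZr).
rewrite ?(dotC w k) ?(dotC D k) ?(dotC n0 k) ?(dotC g k) ?(dotC D w) ?(dotC n0 w) ?(dotC g w)
  ?(dotC n0 D) ?(dotC g D) ?(dotC g n0); lra.
Qed.

(** The left side is the energy at the new shadow iterate averaged over the coin that replaces [mh]
    by [zh]; the bound is convexity along the segment from [u] to [zh]. *)
Lemma shadow_potential_next (gam p th : R) zh mh u x f : 0 <= p -> p <= 1 -> 0 <= th -> th <= 1 ->
  p * (gam * dot f (u + th *: (zh - u) - x) + p / 2 * nsq (u + th *: (zh - u) - zh))
  + (1 - p) * (gam * dot f (u + th *: (zh - u) - x) + p / 2 * nsq (u + th *: (zh - u) - mh)) <=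
  (1 - th) * (gam * dot f (u - x) + p / 2 * nsq (u - mh))
  + th * (gam * dot f (zh - x) + p / 2 * nsq (zh - mh))
  - p ^+ 2 / 2 * (1 - th) * nsq (u - mh) + p ^+ 2 / 2 * nsq (u - zh).
Proof.
move=> p0 p1 t0 t1; have q1 : 0 <= 1 - p by rewrite subr_ge0.
have s1 : 0 <= 1 - th by rewrite subr_ge0.
have h1 : 0 <= p ^+ 2 * th * nsq (zh - mh) by rewrite !mulr_ge0 ?sqr_ge0 ?dot_ge0.
have h2 : 0 <= p ^+ 2 * (th * (2 - th)) * nsq (u - zh).
  by rewrite !mulr_ge0 ?sqr_ge0 ?dot_ge0//; lra.
have h3 : 0 <= p * (1 - p) * (th * (1 - th)) * nsq (u - zh).
  by rewrite !mulr_ge0 ?dot_ge0.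
have e1 : nsq (u + th *: (zh - u) - zh) = (1 - th) ^+ 2 * nsq (u - zh).
  rewrite (_ : u + th *: (zh - u) - zh = (1 - th) *: (u - zh)).
    by rewrite dotZl dotZr mulrA expr2.
  by apply/rowP => i; rewrite !mxE; ring.
have e2 : nsq (u + th *: (zh - u) - mh) = (1 - th) * nsq (u - mh) + th * nsq (zh - mh)
    - th * (1 - th) * nsq (u - zh).
  rewrite !(dotDl, dotDr, dotNl, dotNr, dotZl, dotZr).
  rewrite ?(dotC zh mh) ?(dotC u mh) ?(dotC u zh); ring.
have e3 : dot f (u + th *: (zh - u) - x) = (1 - th) * dot f (u - x) + th * dot f (zh - x).
  by rewrite !(dotDr, dotNr, dotZr); ring.
rewrite e1 e2 e3; move: (dot f _) (dot f _) h1 h2 h3 => a1 a2.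
move: (nsq (zh - mh)) (nsq (u - zh)) (nsq (u - mh)) => a3 a4 a5; lra.
Qed.

Lemma shadow_residual_next (p th : R) zh mh u (N n : 'rV[R]_d) :
  p * (nsq n + 2 * p * dot N (u + th *: (zh - u) - zh) + 3 * (th * - dot N (zh - u)))
  + (1 - p) * (nsq n + 2 * p * dot N (u + th *: (zh - u) - mh) + 3 * (th * - dot N (zh - u))) =
  nsq n + 2 * p * (1 - p) * dot N (u - mh) + 2 * p ^+ 2 * - dot N (zh - u)
  + th * ((3 - 2 * p) * - dot N (zh - u)).
Proof. by rewrite !(dotDr N, dotNr N, dotZr _ N); ring. Qed.

Lemma dot_add3_le (u v w : 'rV[R]_d) :
  nsq (u + v + w) <= 3 * nsq u + 3 * nsq v + 3 * nsq w.
Proof.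
have := dot_ge0 (u - v); have := dot_ge0 (v - w); have := dot_ge0 (u - w).
rewrite !(dotDl, dotDr, dotNl, dotNr) ?(dotC v u) ?(dotC w u) ?(dotC w v); lra.
Qed.

Lemma dot_split_half (w v x : 'rV[R]_d) : nsq (w - x) <= 3 / 2 * nsq (v - x) + 3 * nsq (w - v).
Proof.
have t1 : (0 : R) < 1 / 2 by rewrite divr_gt0.
have := dot_addr_le (v - x) (w - v) t1; rewrite [v - x + _]addrC addrA subrK.
by rewrite (_ : (1 / 2)^-1 = 2); [lra | field].
Qed.

Lemma dot_split_tenth (w v x : 'rV[R]_d) : nsq (w - x) <= 11 / 10 * nsq (v - x) + 11 * nsq (w - v).
Proof.
have t1 : (0 : R) < 1 / 10 by rewrite divr_gt0.
have := dot_addr_le (v - x) (w - v) t1; rewrite [v - x + _]addrC addrA subrK.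
by rewrite (_ : (1 / 10)^-1 = 10); [lra | field].
Qed.

End ShadowAlgebra.

(** * Scalar budgets of one outer step in the small-step regime *)

Section Bookkeeping.
Variable R : realFieldType.

(** Energy and residual each have a descent estimate, used with the old weight, and a direct
    estimate, used for the increment of the weight. The increment for the energy is paid by [phi],
    released by the distance estimate; the increment for the residual is paid by [D2] and [h],
    released by the energy, and by [bb]. *)
Lemma potential_residual_budget (p B Bn B2 w2 w3 EQ EX Q Xi t D2 h d bb k2 phi : R) :
  0 <= p -> 0 <= B -> 40 * B <= Bn -> 40 * Bn <= B2 -> 10 * B <= p * Bn -> 10 * Bn <= p * B2 ->
  42 * B <= 1 / 100 ->
  40 * Bn <= w2 -> w2 <= 40 * Bn + 42 * B -> B2 <= w3 -> w3 <= B2 + 43 / 20 * Bn ->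
  0 <= t -> 0 <= D2 -> 0 <= h -> 0 <= d -> 0 <= bb -> 0 <= k2 -> 0 <= phi ->
  EQ <= Q - 11 / 20 * D2 - 9 / 10 * d - 9 / 20 * p ^+ 2 * h + k2 ->
  EQ <= phi + p / 2 * h + 1 / 20 * D2 + 1 / 100 * k2 + 1 / 100 * d ->
  EX <= Xi - t + k2 - 2 * p ^+ 2 * bb - d ->
  EX <= 17 / 5 * D2 + 6 * p ^+ 2 * h + 3 * k2 + 2 * p * bb + 1 / 5 * d ->
  w2 * EQ + w3 * EX <= 40 * Bn * Q + B2 * Xi + 1 / 100 * phi - B2 * d
    + (40 * Bn + B2 + 13 / 2 * Bn) * k2.
Proof.
move=> p0 B0 B1 Bn1 pB pBn Bs w2l w2u w3l w3u t0 D0 h0 d0 b0 k0 f0 Q1 Q2 X1 X2.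
have Bn0 : 0 <= Bn := le_trans (mulr_ge0 (ler0n R 40) B0) B1.
have B20 : 0 <= B2 := le_trans (mulr_ge0 (ler0n R 40) Bn0) Bn1.
have w2l' : 0 <= w2 - 40 * Bn by rewrite subr_ge0.
have w3l' : 0 <= w3 - B2 by rewrite subr_ge0.
have w2u' : w2 - 40 * Bn <= 42 * B by rewrite lerBlDl.
have w3u' : w3 - B2 <= 43 / 20 * Bn by rewrite lerBlDl.
have d1 : 0 <= Bn - 40 * B by rewrite subr_ge0.
have d2 : 0 <= p * Bn - 10 * B by rewrite subr_ge0.
have d3 : 0 <= p * B2 - 10 * Bn by rewrite subr_ge0.
have R2 : 0 <= phi + p / 2 * h + 1 / 20 * D2 + 1 / 100 * k2 + 1 / 100 * d.
  by have := mulr_ge0 p0 h0; lra.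
have R4 : 0 <= 17 / 5 * D2 + 6 * p ^+ 2 * h + 3 * k2 + 2 * p * bb + 1 / 5 * d.
  by have := mulr_ge0 p0 b0; have := mulr_ge0 (sqr_ge0 p) h0; lra.
have s1 : w2 * EQ <= 40 * Bn * (Q - 11 / 20 * D2 - 9 / 10 * d - 9 / 20 * p ^+ 2 * h + k2)
    + 42 * B * (phi + p / 2 * h + 1 / 20 * D2 + 1 / 100 * k2 + 1 / 100 * d).
  have e1 := ler_wpM2l (mulr_ge0 (ler0n R 40) Bn0) Q1; have e2 := ler_wpM2l w2l' Q2.
  have e3 := ler_wpM2r R2 w2u'.
  have -> : w2 * EQ = 40 * Bn * EQ + (w2 - 40 * Bn) * EQ by ring.
  exact: lerD e1 (le_trans e2 e3).
have s2 : w3 * EX <= B2 * (Xi - t + k2 - 2 * p ^+ 2 * bb - d)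
    + 43 / 20 * Bn * (17 / 5 * D2 + 6 * p ^+ 2 * h + 3 * k2 + 2 * p * bb + 1 / 5 * d).
  have e1 := ler_wpM2l B20 X1; have e2 := ler_wpM2l w3l' X2.
  have e3 := ler_wpM2r R4 w3u'.
  have -> : w3 * EX = B2 * EX + (w3 - B2) * EX by ring.
  exact: lerD e1 (le_trans e2 e3).
have g1 := mulr_ge0 d1 D0.
have g2 := mulr_ge0 Bn0 D0.
have g3 := mulr_ge0 (mulr_ge0 p0 d2) h0.
have g4 := mulr_ge0 (mulr_ge0 p0 B0) h0.
have g5 := mulr_ge0 (mulr_ge0 p0 d3) b0.
have g6 := mulr_ge0 (mulr_ge0 p0 Bn0) b0.
have g7 := mulr_ge0 d1 d0.
have g8 := mulr_ge0 Bn0 d0; have g9 := mulr_ge0 B0 d0.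
have g10 := mulr_ge0 d1 k0.
have g11 := mulr_ge0 B20 t0; have g12 := mulr_ge0 B0 k0.
have g13 := ler_wpM2r f0 Bs; have g14 := mulr_ge0 B0 D0.
clear Q1 Q2 X1 X2 R2 R4 w2l w2u w3l w3u w2l' w2u' w3l' w3u' d1 d2 d3.
move: s1 s2 g1 g2 g3 g4 g5 g6 g7 g8 g9 g10 g11 g12 g13 g14; lra.
Qed.

(** [T] stands for 1 / (p t^2). The fall 2 T of the distance weight pays the loss a2 <= T + y/16, as
    5/4 * 3/2 < 2; the growth and the part y/16 are paid by the strong monotonicity term 3/2 y
    UX. *)
Lemma distance_budget (p y th T a2 om w1 ZX MX UX UZ UM phi : R) :
  0 <= p -> p <= 1 / 4 -> 0 <= y -> y <= p / 100 * (1 / 100) -> 0 <= th -> th <= 1 -> 0 <= T -> T <= p / 100 ->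
  a2 <= T + y / 16 -> 1 <= w1 -> w1 <= 5 / 4 -> w1 - om <= 31 / 50 * y - 2 * T ->
  0 <= ZX -> 0 <= MX -> 0 <= UX -> 0 <= UZ -> 0 <= UM -> 0 <= phi ->
  UX <= 3 / 2 * ZX + 3 * UZ -> ZX <= 11 / 10 * UX + 11 * UZ -> MX <= 11 / 10 * UX + 11 * UM ->
  w1 * (ZX + (1 - th) * MX - 1 / 2 * UZ - p / 2 * UM - phi - 3 / 2 * y * UX + a2 * UX)
  <= om * (ZX + (1 - th) * MX) - 12 / 25 * UZ - 49 / 100 * p * UM - phi - y / 20 * UX.
Proof.
move=> p0 p1 y0 y1 th0 th1 T0 T1 ha w11 w12 hw ZX0 MX0 UX0 UZ0 UM0 f0 c1 c2 c3.
have V0 : 0 <= (1 - th) * MX by rewrite mulr_ge0// subr_ge0.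
have V1 : (1 - th) * MX <= MX by have := mulr_ge0 th0 MX0; lra.
have VV : 0 <= ZX + (1 - th) * MX by rewrite addr_ge0.
have e1 := ler_wpM2r VV hw.
have w10 : 0 <= w1 := le_trans ler01 w11.
have s1 : 0 <= w1 - 1 by lra.
have e2 := ler_wpM2l w10 (ler_wpM2r UX0 ha).
have e3 := mulr_ge0 s1 (mulr_ge0 y0 UX0).
have e4 := ler_wpM2r (mulr_ge0 T0 UX0) w12.
have e5 := ler_wpM2l T0 c1; have e6 := ler_wpM2r UZ0 T1.
have e7 := ler_wpM2l y0 c2; have e8 := ler_wpM2l y0 c3; have e9 := ler_wpM2l y0 V1.
have e10 := ler_wpM2r UZ0 y1; have e11 := ler_wpM2r UM0 y1.
have e12 := ler_wpM2r UZ0 p1; have e13 := mulr_ge0 p0 UM0.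
have e14 := mulr_ge0 s1 UZ0; have e15 := mulr_ge0 s1 e13; have e16 := mulr_ge0 s1 f0.
have e17 := mulr_ge0 T0 V0.
have e18 := mulr_ge0 y0 UX0; have e19 := mulr_ge0 p0 UZ0; have e20 := mulr_ge0 T0 ZX0.
clear ha w11 w12 hw c1 c2 c3.
move: e1 e2 e3 e4 e5 e6 e7 e8 e9 e10 e11 e12 e13 e14 e15 e16 e17 e18 e19 e20 UZ0; lra.
Qed.

(** Where the constant 240 comes from: the force part of the inner deviation costs 5/4 * 32/120 =
    1/3 of B2 d, so half of B2 d suffices for it and the smaller terms. *)
Lemma error_budget (p y l ep th nu2 B2 w1 w4 KZ UZ UM d : R) :
  0 <= p -> p <= 1 / 4 -> 0 <= y -> y <= p / 100 * (1 / 100) -> 0 <= l -> 0 <= ep ->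
  ep <= 1 / 100 * (1 / 100) * (1 / 100) -> 0 <= th -> th <= 2 * ep -> 0 <= nu2 ->
  B2 = 240 * (p * ep * nu2) -> B2 * l <= 1 / 100 -> B2 * l ^+ 2 <= y / 500 ->
  0 <= w1 -> w1 <= 5 / 4 -> 0 <= w4 -> w4 <= 11 / 5 * B2 ->
  0 <= KZ -> 0 <= UZ -> 0 <= UM -> 0 <= d ->
  w1 * (2 * p * nu2 * (th ^+ 2 * KZ + ep * (2 * KZ + 40 * l * UZ + 32 * d)))
  + 6 * w4 * (2 * (ep * (2 * KZ + 40 * l * UZ + 32 * d)) + 16 * l ^+ 2 * UM + 32 * l ^+ 2 * ep * UZ)
  <= B2 / 20 * KZ + 1 / 50 * UZ + p / 100 * UM + B2 / 2 * d.
Proof.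
move=> p0 p1 y0 y1 l0 ep0 ep1 th0 th1 n0 BE Bl Bl2 w10 w11 w40 w41 KZ0 UZ0 UM0 d0.
have B0 : 0 <= B2 by rewrite BE; exact: mulr_ge0 (ler0n R 240) (mulr_ge0 (mulr_ge0 p0 ep0) n0).
have ll0 := sqr_ge0 l.
have D0 : 0 <= 2 * KZ + 40 * l * UZ + 32 * d.
  by have := mulr_ge0 l0 UZ0; move: KZ0 d0; clear; lra.
have pn : 0 <= 2 * p * nu2 := mulr_ge0 (mulr_ge0 (ler0n R 2) p0) n0.
have ep2 : th ^+ 2 <= 4 * ep * ep.
  rewrite expr2 (_ : 4 * ep * ep = (2 * ep) * (2 * ep)); last by ring.
  exact: ler_pM.
have s1 : w1 * (2 * p * nu2 * (th ^+ 2 * KZ + ep * (2 * KZ + 40 * l * UZ + 32 * d))) <=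
    5 / 4 * (B2 / 120 * (4 * ep * KZ + (2 * KZ + 40 * l * UZ + 32 * d))).
  have e1 := ler_wpM2l pn (ler_wpM2r KZ0 ep2).
  have e2 : 2 * p * nu2 * (th ^+ 2 * KZ + ep * (2 * KZ + 40 * l * UZ + 32 * d)) <=
      B2 / 120 * (4 * ep * KZ + (2 * KZ + 40 * l * UZ + 32 * d)) by rewrite BE; move: e1; lra.
  have e3 : 0 <= 2 * p * nu2 * (th ^+ 2 * KZ + ep * (2 * KZ + 40 * l * UZ + 32 * d)).
    by rewrite mulr_ge0// addr_ge0// mulr_ge0// sqr_ge0.
  by apply: ler_pM.
have s2 : 6 * w4 * (2 * (ep * (2 * KZ + 40 * l * UZ + 32 * d)) + 16 * l ^+ 2 * UM + 32 * l ^+ 2 * ep * UZ)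
    <= 66 / 5 * B2 * (2 * (ep * (2 * KZ + 40 * l * UZ + 32 * d)) + 16 * l ^+ 2 * UM + 32 * l ^+ 2 * ep * UZ).
  apply: ler_wpM2r; last by move: w41; clear; lra.
  by have h1 := mulr_ge0 ep0 D0; have h2 := mulr_ge0 ll0 UM0; have h3 := mulr_ge0 (mulr_ge0 ll0 ep0) UZ0; lra.
have t1 := ler_wpM2r (mulr_ge0 B0 KZ0) ep1; have t2 := ler_wpM2r (mulr_ge0 B0 d0) ep1.
have t3 := ler_wpM2r UZ0 Bl; have t4 := ler_wpM2r UM0 Bl2; have t5 := ler_wpM2r UZ0 Bl2.
have t6 := ler_wpM2r (mulr_ge0 (mulr_ge0 B0 l0) UZ0) ep1.
have t7 := ler_wpM2r (mulr_ge0 (mulr_ge0 B0 ll0) UZ0) ep1.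
have t8 := ler_wpM2r UM0 y1; have t9 := ler_wpM2r UZ0 y1; have t10 := ler_wpM2r UZ0 p1.
have t11 := mulr_ge0 B0 KZ0; have t12 := mulr_ge0 B0 d0; have t13 := mulr_ge0 p0 UM0.
clear th1 BE Bl Bl2 w11 w41 ep2 y1 ep1.
move: s1 s2 t1 t2 t3 t4 t5 t6 t7 t8 t9 t10 t11 t12 t13 UZ0; lra.
Qed.

Lemma shadow_error_coef (p K4 w4 KZ : R) : 0 <= p -> p <= 1 / 4 -> 0 <= K4 ->
  w4 <= (1 + 8 / 25 * p) * K4 -> 0 <= KZ -> 8 * p * w4 * (p * KZ) <= 27 / 50 * K4 * KZ.
Proof.
move=> p0 p1 K0 w41 KZ0; have pK : p * K4 <= 1 / 4 * K4 by rewrite ler_wpM2r.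
have h : 8 * p * w4 * p <= 27 / 50 * K4.
  have h1 := ler_wpM2l (mulr_ge0 p0 p0) w41.
  have h2 : p * p * K4 <= 1 / 16 * K4 by have := ler_wpM2l p0 pK; lra.
  have h3 := ler_wpM2r p0 h2; lra.
by have := ler_wpM2r KZ0 h; lra.
Qed.

Lemma anchor_error_coef (p K4 w4 KM : R) : 0 <= p -> p <= 1 / 4 -> 0 <= K4 ->
  w4 <= (1 + 8 / 25 * p) * K4 -> 0 <= KM ->
  8 * p * w4 * ((1 - p) * KM) + 173 / 40 * (p ^+ 2 * K4) * KM <= 8 * p * K4 * KM.
Proof.
move=> p0 p1 K0 w41 KM0.
have h : 8 * w4 * (1 - p) + 173 / 40 * (p * K4) <= 8 * K4.
  have q0 : 0 <= 1 - p by lra.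
  have h1 := ler_wpM2r q0 w41; have h2 := mulr_ge0 (mulr_ge0 p0 p0) K0.
  have h3 := mulr_ge0 p0 K0; lra.
by have := ler_wpM2r (mulr_ge0 p0 KM0) h; lra.
Qed.

Lemma weight_budget (p w4 Bn B2 : R) : p <= 1 / 4 -> 0 <= Bn -> 40 * Bn <= B2 ->
  w4 <= (1 + 8 / 25 * p) * (40 * Bn + B2) ->
  [/\ 0 <= 40 * Bn + B2, 40 * Bn + B2 <= 2 * B2, w4 <= 11 / 5 * B2, 0 <= B2 & B2 <= 40 * Bn + B2] /\
  (0 <= 40 * Bn + B2 + 13 / 2 * Bn /\ 40 * Bn + B2 + 13 / 2 * Bn <= 173 / 160 * (40 * Bn + B2)).
Proof.
move=> p1 Bn0 BnB w41; have K0 : 0 <= 40 * Bn + B2 by lra.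
by have := ler_wpM2r K0 p1; do !split; lra.
Qed.

(** Closes the accounts: the inner loop resets the distance to the shadow iterate, so its whole
    previous value, weighted by 6, is available to pay for the perturbation [k2], while the anchor
    term, weighted by 8 p, is released at rate [p]. *)
Lemma outer_budget (p y l ep th nu2 T a2 om w1 w4 Bn B2 ZX MX UX UZ UM KZ KM d k2 phi : R) :
  0 <= p -> p <= 1 / 4 -> 0 <= y -> y <= p / 100 * (1 / 100) -> 0 <= l -> 0 <= ep ->
  ep <= 1 / 100 * (1 / 100) * (1 / 100) -> 0 <= th -> th <= 2 * ep -> 0 <= nu2 ->
  0 <= T -> T <= p / 100 -> a2 <= T + y / 16 -> 1 <= w1 -> w1 <= 5 / 4 -> w1 - om <= 31 / 50 * y - 2 * T ->
  B2 = 240 * (p * ep * nu2) -> B2 * l <= 1 / 100 -> B2 * l ^+ 2 <= y / 500 ->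
  0 <= Bn -> 40 * Bn <= B2 -> 0 <= w4 -> w4 <= (1 + 8 / 25 * p) * (40 * Bn + B2) ->
  0 <= ZX -> 0 <= MX -> 0 <= UX -> 0 <= UZ -> 0 <= UM -> 0 <= KZ -> 0 <= KM -> 0 <= d -> 0 <= phi ->
  UX <= 3 / 2 * ZX + 3 * UZ -> ZX <= 11 / 10 * UX + 11 * UZ -> MX <= 11 / 10 * UX + 11 * UM ->
  k2 <= 4 * KZ + 4 * p ^+ 2 * KM + 4 * l ^+ 2 * UM + 4 * l ^+ 2 * MX ->
  w1 * (ZX + (1 - th) * MX - 1 / 2 * UZ - p / 2 * UM - phi - 3 / 2 * y * UX + a2 * UX
     + 2 * p * nu2 * (th ^+ 2 * KZ + ep * (2 * KZ + 40 * l * UZ + 32 * d)))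
  + 6 * w4 * (2 * (ep * (2 * KZ + 40 * l * UZ + 32 * d)) + 16 * l ^+ 2 * UM + 32 * l ^+ 2 * ep * UZ)
  + 8 * p * w4 * (p * KZ + (1 - p) * KM)
  + (1 / 100 * phi - B2 * d + (40 * Bn + B2 + 13 / 2 * Bn) * k2)
  <= om * (ZX + (1 - th) * MX) + (40 * Bn + B2) * (6 * KZ + 8 * p * KM).
Proof.
move=> p0 p1 y0 y1 l0 ep0 ep1 th0 th1 n0 T0 T1 ha w11 w12 hw BE Bl Bl2 Bn0 BnB w40 w41.
move=> ZX0 MX0 UX0 UZ0 UM0 KZ0 KM0 d0 f0 c1 c2 c3 hk.
have w10 : 0 <= w1 := le_trans ler01 w11.
have th1' : th <= 1 by move: th1 ep1; clear; lra.
have [[K40 K4B w42 B20 BK] [K46 K47]] := weight_budget p1 Bn0 BnB w41.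
have [K4 K4E] : exists K, 40 * Bn + B2 = K by eexists.
rewrite !K4E in w41 K40 K4B BK K46 K47 *.
have s3 : (K4 + 13 / 2 * Bn) * k2 <= 173 / 160 * K4 * (4 * KZ + 4 * p ^+ 2 * KM + 4 * l ^+ 2 * UM + 4 * l ^+ 2 * MX).
  have c0 : 0 <= 4 * KZ + 4 * p ^+ 2 * KM + 4 * l ^+ 2 * UM + 4 * l ^+ 2 * MX.
    have h1 := mulr_ge0 (sqr_ge0 p) KM0; have h2 := mulr_ge0 (sqr_ge0 l) UM0.
    by have h3 := mulr_ge0 (sqr_ge0 l) MX0; move: KZ0 h1 h2 h3; clear; lra.
  apply: (@le_trans _ _ ((K4 + 13 / 2 * Bn) * (4 * KZ + 4 * p ^+ 2 * KM + 4 * l ^+ 2 * UM + 4 * l ^+ 2 * MX))).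
    exact: ler_wpM2l K46 _ _ hk.
  exact: ler_wpM2r c0 _ _ K47.
have kl : K4 * l ^+ 2 <= y / 250.
  by have := ler_wpM2r (sqr_ge0 l) K4B; move: Bl2; clear; lra.
have t1 := ler_wpM2r UM0 kl; have t2 := ler_wpM2r MX0 kl; have t3 := ler_wpM2l y0 c3.
have t4 := shadow_error_coef p0 p1 K40 w41 KZ0.
have t5 := anchor_error_coef p0 p1 K40 w41 KM0.
have t6 := ler_wpM2r UM0 y1; have t7 := mulr_ge0 p0 UM0; have t8 := mulr_ge0 y0 UX0.
have t9 := ler_wpM2r KZ0 BK.
have t10 := mulr_ge0 K40 KZ0; have t11 := mulr_ge0 B20 d0.
have s1 := distance_budget p0 p1 y0 y1 th0 th1' T0 T1 ha w11 w12 hw ZX0 MX0 UX0 UZ0 UM0 f0 c1 c2 c3.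
have s2 := error_budget p0 p1 y0 y1 l0 ep0 ep1 th0 th1 n0 BE Bl Bl2 w10 w12 w40 w42 KZ0 UZ0 UM0 d0.
clear ha w11 w12 hw BE Bl Bl2 BnB w41 K4B w42 B20 BK K46 K47 c1 c2 c3 hk kl.
move: s1 s2 s3 t1 t2 t3 t4 t5 t6 t7 t8 t9 t10 t11 UZ0 f0.
lra.
Qed.

End Bookkeeping.

(** * Time-dependent weights *)

Section Schedule.
Variables (R : rcfType) (p y ep X l t : R).
Hypotheses (p_gt0 : 0 < p) (p_le : p <= 1 / 4) (y_gt0 : 0 < y) (yp : y <= p / 100 * (1 / 100)).
Hypotheses (t_ge : 10 <= p * t).

Definition cap : R := Num.sqrt (16 / (p * y)).
(** Linear growth until p y nu^2 = 16, when 1 / (p nu^2) reaches y/16 and strong monotonicity can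
    pay the loss; the cap also keeps B nu^2 l small, as [l] is of order y X p. *)
Definition sched (t : R) : R := Num.min t cap.
(** The surplus over 1 drops by at least 2 / (p t^2) per unit of time: it is a discrete tail of the
    summable losses. *)
Definition dist_weight (t : R) : R := 1 + 2 / (p * (t - 1)).

Local Notation nu := (sched t).
Local Notation nu' := (sched (t + 1)).
Local Notation g := (51 / 100 * y).

Let py : 0 < p * y. Proof. exact: mulr_gt0. Qed.

Let capE : p * y * cap ^+ 2 = 16.
Proof. by rewrite sqr_sqrtr ?divr_ge0 ?(ltW py)// mulrCA mulfV ?mulr1// gt_eqF. Qed.

Let cap0 : 0 <= cap. Proof. exact: sqrtr_ge0. Qed.

Let pcap : 10 <= p * cap.
Proof.
have h0 : 0 <= p * cap by rewrite mulr_ge0 ?(ltW p_gt0).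
rewrite leNgt; apply/negP => h.
have h1 : (p * cap) ^+ 2 <= 100.
  have := mulr_ge0 (_ : 0 <= 10 - p * cap) (_ : 0 <= 10 + p * cap).
  by move=> /(_ ltac:(lra) ltac:(lra)); lra.
have h2 := ler_wpM2l (ltW y_gt0) h1.
have h3 : y * (p * cap) ^+ 2 = p * 16 by rewrite -capE; ring.
by move: h2 p_gt0 yp; rewrite h3; lra.
Qed.

Lemma sched_ge : 10 <= p * nu.
Proof. by rewrite /sched; case: (leP t cap). Qed.

Let t0 : 0 < t. Proof. by rewrite -(pmulr_rgt0 _ p_gt0); apply: lt_le_trans t_ge. Qed.

Lemma sched_gt : 40 <= nu.
Proof.
have := sched_ge; have n0 : 0 <= nu by rewrite le_min (ltW t0) cap0.
by have := ler_wpM2r n0 p_le; lra.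
Qed.

Lemma sched_step : nu <= nu' <= nu + 1.
Proof. by rewrite /sched; have c0 := cap0; case: (leP t cap) => ?; case: (leP (t + 1) cap) => ?; apply/andP; split; lra. Qed.

Lemma sched_le_cap : p * y * nu ^+ 2 <= 16.
Proof.
rewrite -capE ler_wpM2l ?(ltW py)// lerXn2r ?nnegrE//; last by rewrite ge_min lexx orbT.
by have := sched_gt; lra.
Qed.

Lemma sched_inv_le : (p * nu ^+ 2)^-1 <= (p * t ^+ 2)^-1 + y / 16.
Proof.
have c1 : 0 < cap by rewrite -(pmulr_rgt0 _ p_gt0); apply: lt_le_trans pcap.
rewrite /sched; case: (leP t cap) => _; first by rewrite lerDl divr_ge0 ?ltW.
have -> : (p * cap ^+ 2)^-1 = y / 16.
  by rewrite -capE; field; rewrite !gt_eqF.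
by rewrite lerDr invr_ge0 mulr_ge0 ?sqr_ge0 ?(ltW p_gt0).
Qed.

Lemma time_inv_le : (p * t ^+ 2)^-1 <= p / 100.
Proof.
have pt : 0 < p * t ^+ 2 by rewrite mulr_gt0 ?exprn_gt0.
rewrite -[leLHS]mul1r ler_pdivrMr//.
have e : p / 100 * (p * t ^+ 2) = (p * t) * (p * t) / 100 by field.
rewrite e; have := ler_pM (_ : 0 <= 10) (_ : 0 <= 10) t_ge t_ge.
by move=> /(_ (ler0n _ _) (ler0n _ _)); lra.
Qed.

Lemma y_sched : y * nu <= 1 / 25.
Proof.
have n0 : 0 <= nu by have := sched_gt; lra.
have h0 : 0 <= y * nu by rewrite mulr_ge0 ?(ltW y_gt0).
rewrite leNgt; apply/negP => h.
have h1 : y * nu * (y * nu) <= 16 / 100 * (1 / 100).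
  rewrite -(ler_pM2l p_gt0).
  have e : p * (y * nu * (y * nu)) = y * (p * y * nu ^+ 2) by ring.
  rewrite e; have := ler_wpM2l (ltW y_gt0) sched_le_cap; move: yp; lra.
have h2 := mulr_gt0 (_ : 0 < y * nu - 1 / 25) (_ : 0 < y * nu + 1 / 25).
by have {}h2 := h2 ltac:(lra) ltac:(lra); lra.
Qed.

Let g0 : 0 <= g. Proof. by have := y_gt0; lra. Qed.
Let y_small : y <= 1 / 100. Proof. by move: yp p_le; lra. Qed.

Lemma linear_weight : nu <= (1 + g) * nu' /\ (1 + g) * nu' <= nu + 21 / 20.
Proof.
have /andP[h1 h2] := sched_step; have h3 := y_sched; have n4 := sched_gt.
have e1 := ler_wpM2l g0 h1; have e2 := ler_wpM2l g0 h2; have y1 := y_small.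
have e3 := mulr_ge0 g0 (_ : 0 <= nu); have {}e3 := e3 ltac:(lra).
by split; lra.
Qed.

Lemma quadratic_weight : nu ^+ 2 <= (1 + g) * nu' ^+ 2 /\
  (1 + g) * nu' ^+ 2 <= nu ^+ 2 + 43 / 20 * nu.
Proof.
have /andP[h1 h2] := sched_step; have h3 := y_sched; have n4 := sched_gt.
have n0 : 0 <= nu by lra.
have n1 : 0 <= nu' by lra.
have s1 : nu ^+ 2 <= nu' ^+ 2 by rewrite lerXn2r ?nnegrE.
have s2 : nu' ^+ 2 <= (nu + 1) ^+ 2 by rewrite lerXn2r ?nnegrE//; lra.
have e1 := mulr_ge0 g0 (sqr_ge0 nu'); have y1 := y_small.
have e2 := ler_wpM2l (_ : 0 <= 1 + g) s2; have {}e2 := e2 ltac:(move: g0; lra).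
have e3 := ler_wpM2r n0 h3.
by split; lra.
Qed.

Let pt0 : 0 < p * t. Proof. exact: mulr_gt0. Qed.

Let t1 : 0 < t - 1.
Proof. by have := ler_wpM2r (ltW t0) p_le; move: t_ge; lra. Qed.

Lemma dist_weight_ge1 : 1 <= (1 + g) * dist_weight (t + 1).
Proof.
have h : 0 <= 2 / (p * (t + 1 - 1)) by rewrite addrK divr_ge0 // ltW.
by rewrite /dist_weight; have := mulr_ge0 g0 h; move: g0 h; lra.
Qed.

Let dw : 2 / (p * t) <= 1 / 5.
Proof. by rewrite ler_pdivrMr//; move: t_ge; lra. Qed.

Lemma dist_weight_le : (1 + g) * dist_weight (t + 1) <= 5 / 4.
Proof.
rewrite /dist_weight addrK; have := ler_wpM2l g0 dw; move: dw y_small y_gt0.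
by move: (2 / (p * t)) => x; lra.
Qed.

Lemma dist_weight_drop :
  (1 + g) * dist_weight (t + 1) - dist_weight t <= 31 / 50 * y - 2 * (p * t ^+ 2)^-1.
Proof.
rewrite /dist_weight addrK; have h1 := ler_wpM2l g0 dw.
have h2 : 2 * (p * t ^+ 2)^-1 + 2 / (p * t) <= 2 / (p * (t - 1)).
  have e : 2 / (p * (t - 1)) - (2 * (p * t ^+ 2)^-1 + 2 / (p * t)) = 2 / (p * t ^+ 2 * (t - 1)).
    by field; rewrite !gt_eqF.
  by rewrite -subr_ge0 e ltW// divr_gt0// !mulr_gt0.
move: h1 h2; move: (2 / (p * t)) (2 / (p * (t - 1))) (p * t ^+ 2)^-1 => x1 x2 x3.
move: y_gt0; lra.
Qed.

Lemma dist_weight_old : 1 <= dist_weight t.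
Proof. by rewrite /dist_weight lerDl divr_ge0// mulr_ge0 ?(ltW p_gt0) ?(ltW t1). Qed.

End Schedule.

Lemma weight_bounds (R : realFieldType) (p B n n' g : R) : 0 <= p -> 0 <= B -> 40 <= n -> 10 <= p * n ->
  n <= g * n' -> g * n' <= n + 21 / 20 -> n ^+ 2 <= g * n' ^+ 2 -> g * n' ^+ 2 <= n ^+ 2 + 43 / 20 * n ->
  let W2 := g * (40 * (B * n')) in let W3 := g * (B * n' ^+ 2) in
  [/\ 40 * B <= B * n, 40 * (B * n) <= B * n ^+ 2, 10 * B <= p * (B * n)
    & 10 * (B * n) <= p * (B * n ^+ 2)] /\
  [/\ 40 * (B * n) <= W2, W2 <= 40 * (B * n) + 42 * B, B * n ^+ 2 <= W3,
    W3 <= B * n ^+ 2 + 43 / 20 * (B * n)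
    & W2 + W3 <= (1 + 8 / 25 * p) * (40 * (B * n) + B * n ^+ 2)].
Proof.
move=> p0 B0 n40 pn h1 h2 h3 h4 /=.
have n0 : 0 <= n by lra.
have Bn0 : 0 <= B * n by rewrite mulr_ge0.
have e1 := ler_wpM2l B0 n40; have e2 := ler_wpM2l Bn0 n40.
have e3 := ler_wpM2l B0 pn; have e4 := ler_wpM2l Bn0 pn.
have f1 := ler_wpM2l B0 h1; have f2 := ler_wpM2l B0 h2; have f3 := ler_wpM2l B0 h3.
have f4 := ler_wpM2l B0 h4.
clear h1 h2 h3 h4 pn n40; move: e1 e2 e3 e4 f1 f2 f3 f4 => e1 e2 e3 e4 f1 f2 f3 f4.
by split; split; lra.
Qed.

Lemma combine_budgets (R : realFieldType) (P W V C Q Xi f e k G : R) :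
  P + (f - e + k) <= V + C -> W <= Q + Xi + f - e + k -> G = P + W -> G <= V + Q + Xi + C.
Proof. by move=> h1 h2 ->; lra. Qed.

(** Since 51/100 exceeds 1/2, (1 + 51/100 y) (1 - y/2) >= 1 for y <= 1/100. Comparing weights after
    growth by 1 + 51/100 y avoids dividing by the rate. *)
Lemma cancel_growth (R : realFieldType) (y e W : R) : 0 <= y -> y <= 1 / 100 -> 0 <= W ->
  (1 + 51 / 100 * y) * e <= W -> e <= (1 - y / 2) * W.
Proof.
move=> y0 y1 W0 h; have g0 : 0 < 1 + 51 / 100 * y by lra.
rewrite -(ler_pM2l g0); apply: le_trans h _.
have h1 : 0 <= y * (1 / 100 - 51 / 200 * y) by apply: mulr_ge0 => //; lra.
have := mulr_ge0 h1 W0; lra.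
Qed.

(** * Decay along the outer loop *)

Section OuterLoop.
Variables (R : realType) (c : regime) (d n r M H : nat).
Variables (Z : set 'rV[R]_d) (F : 'I_n -> 'I_M -> 'rV[R]_d -> 'rV[R]_d) (i1 : 'I_n).
Variables (gamma p q b L mu ep rho : R) (hat : 'rV[R]_d -> 'rV[R]_d -> 'rV[R]_d) (x : 'rV[R]_d).
Local Notation nsq v := (dot v v).
Let lw : forall a : draw n H, outcome c d r M a -> R := draw_law p q.
Hypotheses (Z_nonempty : Z !=set0) (Z_closed : closed Z) (Z_convex : convex_set Z).
Hypothesis lw_sum : forall a : draw n H, \sum_(o : outcome c d r M a) lw o = 1.
Hypothesis lw_ge0 : forall (a : draw n H) (o : outcome c d r M a), 0 <= lw o.
Hypothesis hc : regime_ok c d n r.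
Hypotheses (n_gt0 : (0 < n)%N) (M_gt0 : (0 < M)%N) (H_gt0 : (0 < H)%N).
Hypotheses (L_gt0 : 0 < L) (mu_gt0 : 0 < mu) (gamma_gt0 : 0 < gamma).
Hypotheses (p_gt0 : 0 < p) (p_le : p <= 1 / 4).
Hypotheses (b_gt0 : 0 < b) (b_le : b <= 1 / 2).
Hypotheses (q_def : q = 4 * b ^+ 2 * (1 + gamma * L) ^+ 2) (q_le1 : q <= 1).
Hypothesis F_lip : mean_square_lipschitz Z F L.
Hypothesis F_mono : forall i, monotone_on Z (node_op F i).
Hypothesis F_strong : strongly_monotone_on Z (full_op F) mu.
Hypothesis x_sol : solves_VI Z (full_op F) x.
Hypothesis hatP : forall z m, is_hat Z F i1 gamma p z m (hat z m).
Hypotheses (rho_ge0 : 0 <= rho) (rho_le1 : 2 * rho <= 3 / 4 * q) (rho_le2 : 2 * rho <= b).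
Hypothesis fast : (1 - rho) ^+ H <= ep.
Hypothesis gmu : gamma * mu <= p / 3.

Local Notation fin := (('rV[R]_d * 'rV[R]_d) * (R * R))%type.
Local Notation op s := (chain_op q (ext_step Z F i1 gamma p q b (st_z s) (st_m s))).
Local Notation E s f := (iter H (op s) f (ext_start (st_z s))).
Local Notation step := (@state_step R c d n r M H Z F i1 gamma p q b hat x).
Local Notation uh s := (st_hat hat s).

Let Zx : Z x. Proof. by case: x_sol. Qed.

Let q0 : 0 <= q. Proof. exact: (q_ge0 q_def). Qed.

Lemma hat_in s : Z (uh s). Proof. by case: (hatP (st_z s) (st_m s)). Qed.

Lemma mean_sq_error s : Z (st_z s) ->
  E s (fun fi : fin => nsq (fi.1.1 - uh s)) <= 2 * ep * nsq (st_z s - uh s).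
Proof.
move=> Zz; have := inner_contraction Z_nonempty Z_closed Z_convex M_gt0 L_gt0 gamma_gt0 b_gt0 b_le
  F_lip F_mono (hatP (st_z s) (st_m s)) q_def q_le1 H_gt0 Zz rho_ge0 rho_le1 rho_le2.
move=> h; apply: le_trans h _; have n0 := dot_ge0 (st_z s - uh s).
by have := ler_wpM2r n0 fast; lra.
Qed.

Lemma full_strong y : Z y -> mu * nsq (y - x) <= dot (full_op F y) (y - x) - dot (full_op F x) (y - x).
Proof.
move=> Zy; have := F_strong Zy Zx; rewrite enorm_sqr.
by move: (full_op F y) (full_op F x) => v1 v2; rewrite [X in _ <= X]dotDl dotNl.
Qed.

Lemma sol_ge0 y : Z y -> 0 <= dot (full_op F x) (y - x).
Proof. by case: x_sol => _; apply. Qed.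

Definition state_ok s := [/\ Z (st_z s), Z (st_m s), Z (st_zh s), Z (st_mh s) &
  0 <= st_t s /\ forall y, Z y -> dot (st_n s - gamma *: full_op F x) (y - st_zh s) <= st_t s].

Lemma state_ok_start z0 : Z z0 -> state_ok (state_start x z0).
Proof.
move=> Z0; split => //=; split => // y Zy.
rewrite sub0r dotNl oppr_le0 dotZl mulr_ge0 ?(ltW gamma_gt0)//.
exact: sol_ge0.
Qed.

Lemma state_ok_step y k s : state_ok s -> state_ok (step y k s).
Proof.
case=> Zz Zm Zzh Zmh [t0 hn].
have [Zf _ [th0 th1 _ th2 _]] : fin_in Z q b (inner_run Z F i1 gamma p q b k s y).
  apply: (inner_fold_Inv (Inv := @fin_in R d Z q b)).
    move=> j co fi; exact: (fin_in_step F i1 p (st_z s) (st_m s) Z_nonempty Z_closed L_gt0 gamma_gt0 b_gt0 b_le q_def q_le1).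
  exact: (fin_in_start q b_gt0 b_le).
rewrite /state_step; set fi := inner_run _ _ _ _ _ _ _ _ _ _ in Zf th0 th1 th2 *.
have th3 := le_trans th1 th2.
have d0 := dd_ge0 (hatP (st_z s) (st_m s)) Zzh.
split => /=.
- exact: proj_in.
- by case: (y _).
- exact: (segment_in Z_convex (hatP _ _) Zzh th0 th3).
- by case: (y _).
split; first exact: mulr_ge0.
move=> w Zw; have := normal_le (hatP (st_z s) (st_m s)) Zw.
rewrite -/(st_hat hat s) -/(st_N F i1 gamma p hat s) /st_next_zh /st_d addrAC subrr add0r opprD addrA.
move: (st_N _ _ _ _ _ _) => v.
by rewrite [X in _ -> X <= _]dotDr dotNr dotZr; lra.
Qed.

(** * Large steps *)

Section LargeStep.
Variable S : R.
Hypotheses (F_sim : mean_square_similar Z F S) (kap : gamma ^+ 2 * S ^+ 2 <= p / 16).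
Hypothesis large : 14 * ep <= gamma * mu.

Let V (s : state R d) := nsq (st_z s - x) + nsq (st_m s - x).

(** Young's inequality with gamma mu / 4 handles the cross term. As the mean squared inner error is
    2 ep |z - u|^2 and ep <= gamma mu / 14, the total cost is 17/28 |z - u|^2, less than the gain (1
    - p) |z - u|^2. *)
Lemma large_step_le k s v : Z (st_z s) -> Z (st_m s) -> Z (st_zh s) ->
  avg lw (step_draws n H k) (fun y => V (step y k s)) v <= (1 - gamma * mu / 2) * V s.
Proof.
move=> Zz Zm Zzh; set z := st_z s in Zz *; set m := st_m s in Zm *.
pose G (co : bool) (fi : fin) := nsq ((if co then z else m) - x).
have gm0 : 0 < gamma * mu by rewrite mulr_gt0.
have ep0 : 0 <= ep by apply: le_trans fast; rewrite exprn_ge0//; move: b_le rho_le2; lra.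
apply: (le_trans (avg_state_step (x := x) Z_nonempty Z_closed Z_convex lw_sum lw_ge0 hc n_gt0 F_sim hatP L_gt0
  gamma_gt0 b_gt0 b_le q_def q_le1 k (f := V) (c1 := 1) (c2 := 0) (G := G) v ler01 (lexx 0) Zz Zm Zzh _ Zx)).
  by move=> zn co fi; rewrite /V /G /= mul1r mul0r addr0; case: co.
pose u := uh s; have Zu : Z u by exact: hat_in.
pose C := (1 - p) * (nsq (z - x) - nsq (u - z)) + p * nsq (m - x) - 3 / 4 * p * nsq (u - m)
  - 3 / 2 * (gamma * mu) * nsq (u - x) + p * nsq (z - x) + (1 - p) * nsq (m - x).
(* 4 / (gamma mu) comes from Young's inequality; the remaining quarter covers the other error terms,
   as 1 / (gamma mu) >= 12. *)
pose D := 17 / 4 / (gamma * mu).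
apply: (@le_trans _ _ (E s (fun fi => C + D * nsq (fi.1.1 - u)))).
  apply: (iter_chain_mono q0 q_le1 H (Inv := @fin_in R d Z q b)).
  - move=> fi j co; exact: (fin_in_step F i1 p z m Z_nonempty Z_closed L_gt0 gamma_gt0 b_gt0 b_le q_def q_le1).
  - exact: (fin_in_start q b_gt0 b_le).
  move=> fi [Zf _ _]; rewrite mul1r mul0r addr0 /G.
  have := noisy_sq_le i1 p n_gt0 M_gt0 F_sim gamma_gt0 mu_gt0 z x Zm Zu Zf.
  have h1 := normal_le (hatP z m) Zx; rewrite -/u in h1.
  have h2 := full_strong Zu; have h3 := sol_ge0 Zu.
  have h4 : 0 <= dot (normal_of F i1 gamma p z m u) (u - x).
    by rewrite -(opprB x u) dotNr oppr_ge0.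
  have h5 := ler_wpM2l (ltW gamma_gt0) h2; have h6 := mulr_ge0 (ltW gamma_gt0) h3.
  have t0 : 0 < gamma * mu / 4 by rewrite divr_gt0.
  have h7 := dot_young (u - x) (fi.1.1 - u) t0.
  have e7 : (gamma * mu / 4)^-1 = 4 / (gamma * mu) by field; rewrite !gt_eqF.
  rewrite e7 in h7.
  have n0 := dot_ge0 (fi.1.1 - u); have n1 := dot_ge0 (u - m).
  have h8 : (2 + 4 * (gamma ^+ 2 * S ^+ 2) + 4 * (gamma ^+ 2 * S ^+ 2) / (gamma * mu) + 4 / (gamma * mu))
      * nsq (fi.1.1 - u) <= D * nsq (fi.1.1 - u).
    rewrite ler_wpM2r// /D.
    have ig : 12 <= (gamma * mu)^-1.
      rewrite -[12]invrK lef_pV2 ?posrE ?invr_gt0//.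
      by rewrite (_ : 12^-1 = 1 / 12) ?mul1r//; move: gmu p_le; lra.
    have kap0 : 0 <= 1 / 64 - gamma ^+ 2 * S ^+ 2 by move: kap p_le; lra.
    have ig0 : 0 <= (gamma * mu)^-1 by apply: le_trans ig.
    have := mulr_ge0 ig0 kap0; move: ig kap0.
    move: (gamma * mu)^-1 (gamma ^+ 2 * S ^+ 2) => ig K; lra.
  have h9 := ler_wpM2r n1 kap.
  rewrite -/D; move: h4 h5 h6 h7 h8 h9; rewrite /C.
  set K := gamma ^+ 2 * S ^+ 2; set e := fi.1.1 - u.
  set A := 4 * K / (gamma * mu); set B := 4 / (gamma * mu).
  move: K A B (D) => K A B D0; lra.
rewrite iter_chainD iter_chain_cst // iter_chainZ.
have hD : 0 <= D by rewrite divr_ge0 ?(ltW gm0).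
have h1 := ler_wpM2l hD (mean_sq_error Zz); rewrite -/u in h1.
have n0 := dot_ge0 (z - u).
have h2 : D * (2 * ep * nsq (z - u)) <= 17 / 28 * nsq (z - u).
  have h : ep / (gamma * mu) <= 1 / 14 by rewrite ler_pdivrMr//; move: large; lra.
  by rewrite mulrA ler_wpM2r// /D; move: h; move: (gamma * mu)^-1 => ig; lra.
have h3 : nsq (z - x) <= 3 / 2 * nsq (u - x) + 3 * nsq (z - u).
  have t : (0 : R) < 1 / 2 by lra.
  have := dot_addr_le (u - x) (z - u) t; rewrite addrC addrA subrK.
  by rewrite (_ : (1 / 2)^-1 = 2); [lra | field].
have h4 : nsq (m - x) <= 3 / 2 * nsq (u - x) + 3 * nsq (u - m).
  have t : (0 : R) < 1 / 2 by lra.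
  have := dot_addr_le (u - x) (m - u) t; rewrite addrC addrA subrK (dot_subC m u).
  by rewrite (_ : (1 / 2)^-1 = 2); [lra | field].
have h5 := ler_wpM2l (ltW gm0) h3; have h6 := ler_wpM2l (ltW gm0) h4.
have h7 := ler_wpM2r n0 gmu; have h8 := ler_wpM2r (dot_ge0 (u - m)) gmu.
have h9 := ler_wpM2r n0 p_le; have h10 := mulr_ge0 (ltW p_gt0) (dot_ge0 (u - m)).
rewrite (dot_subC u z) in C *; rewrite /C /V -/z -/m.
move: n0 h1 h2 h5 h6 h7 h8 h9 h10; lra.
Qed.

Theorem large_step_bound z0 K v : Z z0 ->
  avg lw (all_draws n H K) (fun w => nsq (st_z (run step (state_start x z0) w K) - x)) v
  <= (1 - gamma * mu / 2) ^+ K * (2 * nsq (z0 - x)).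
Proof.
move=> Zz0; have ok0 := state_ok_start Zz0.
have local := @state_step_local R c d n r M H Z F i1 gamma p q b hat x.
have r0 : 0 <= 1 - gamma * mu / 2 by move: gmu p_le; lra.
have := avg_run_le lw_ge0 local (Inv := state_ok) state_ok_step (W := fun=> V) v K ok0 r0.
have e : V (state_start x z0) = 2 * nsq (z0 - x) by rewrite /V /=; ring.
rewrite e => h; apply: le_trans (h _) => [|k s v' [Zz Zm Zzh _ _]]; last exact: large_step_le.
by apply: avg_le => // w _; rewrite /V lerDl dot_ge0.
Qed.

End LargeStep.

(** * Small steps *)

Section SmallStep.
Variable X : R.
Hypotheses (X_ge : 160 <= X) (epX : ep * X ^+ 3 = 1) (LX : 40 * L = X * (mu * p)).
Hypotheses (Xp : 40 <= X * p) (small : gamma * mu <= 14 * ep).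
Hypothesis slow : (1 - 3 / 16 * q) ^+ H <= ep.
Local Notation l := (gamma * L).

Let l0 : 0 < l. Proof. exact: mulr_gt0. Qed.
Let y0 : 0 < gamma * mu. Proof. exact: mulr_gt0. Qed.
Let X0 : 0 < X. Proof. by apply: lt_le_trans X_ge; rewrite ltr0n. Qed.
Let ep0 : 0 < ep.
Proof. by rewrite -(pmulr_lgt0 _ (exprn_gt0 3 X0)) epX ltr01. Qed.

Let epX_le : ep * X <= 1 / 100 * (1 / 100).
Proof.
have A0 := mulr_gt0 ep0 X0.
have X1 : 100 <= X by move: X_ge; lra.
have h1 := ler_wpM2l (ltW A0) X1.
have h2 := ler_wpM2l (ltW (mulr_gt0 A0 X0)) X1.
have e : ep * X * X * X = 1 by rewrite -epX; ring.
rewrite e in h2; lra.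
Qed.

Let ep_le : ep <= 1 / 100 * (1 / 100) * (1 / 100).
Proof.
have X1 : 100 <= X by move: X_ge; lra.
by have := ler_wpM2l (ltW ep0) X1; move: epX_le; lra.
Qed.

Let lE : 40 * l = gamma * mu * (X * p).
Proof. by rewrite mulrCA LX; ring. Qed.

(** In this regime gamma L is of order p X^-2, so the inner operator is a slight perturbation of the
    identity plus the normal cone; this justifies the linear recursion of the weights. *)
Let l_le_ep : l <= 7 / 20 * p * (ep * X).
Proof.
have h : 0 <= X * p by rewrite mulr_ge0 ?ltW.
by have := ler_wpM2r h small; move: lE; lra.
Qed.

Let l_le_p : l <= p / 100 * (1 / 100).
Proof.
have := ler_wpM2l (ltW p_gt0) epX_le; have := mulr_gt0 p_gt0 (mulr_gt0 ep0 X0).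
by move: l_le_ep; lra.
Qed.

Let l_small : l <= 1 / 320.
Proof. by move: l_le_p p_le; lra. Qed.

(* l^2 / (gamma mu) = l X p / 40 is small as well. *)
Let l2_le : l ^+ 2 <= gamma * mu * (p * p / 100 * (1 / 100)).
Proof.
have h1 : l ^+ 2 = gamma * mu * (l * (X * p) / 40).
  have e : l = gamma * mu * (X * p) / 40 by rewrite -lE; field.
  by rewrite expr2 [X in X * _ = _]e; ring.
rewrite h1 ler_wpM2l ?(ltW y0)//.
have h2 : 0 <= X * p by rewrite mulr_ge0 ?ltW.
have h3 := ler_wpM2r h2 l_le_ep.
have A0 := mulr_gt0 ep0 X0.
have h4 : ep * X * X <= 1 / 100.
  have X1 : 100 <= X by move: X_ge; lra.
  have h2' := ler_wpM2l (ltW (mulr_gt0 A0 X0)) X1.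
  have e : ep * X * X * X = 1 by rewrite -epX; ring.
  rewrite e in h2'; lra.
have pp0 : 0 <= p * p by rewrite mulr_ge0 ?ltW.
by have := ler_wpM2l pp0 h4; lra.
Qed.

Let F_sim2 : mean_square_similar Z F (2 * L).
Proof. exact: (F_similar_of_lip n_gt0 M_gt0 F_lip). Qed.

(** The mean final weight theta, a number common to all states because only the coins enter. *)
Definition meanw : R :=
  iter H (chain_op q (fun (_ : 'I_M) co th => weight_step q b co th)) (fun th => th.1) (1, 1).

Lemma E_weight s : E s (fun fi : fin => fi.2.1) = meanw.
Proof.
exact: (iter_chain_factor q H (fun th => th.1) (ext_start (st_z s)) (stepT := weight_step q b)).
Qed.

Let start (y : 'rV[R]_d) := State y y y y (0 : 'rV[R]_d) 0.

Let E_le s (f g : fin -> R) : Z (st_z s) ->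
  (forall fi, fin_in Z q b fi -> f fi <= g fi) -> E s f <= E s g.
Proof.
move=> Zz fg; apply: (iter_chain_mono q0 q_le1 H (Inv := @fin_in R d Z q b)) => //.
- move=> fi j co; exact: (fin_in_step F i1 p (st_z s) (st_m s) Z_nonempty Z_closed L_gt0 gamma_gt0 b_gt0 b_le q_def q_le1).
- exact: (fin_in_start q b_gt0 b_le).
Qed.

Lemma meanw_ge0 : 0 <= meanw.
Proof.
rewrite -(E_weight (start x)).
have := @E_le (start x) (fun=> 0) (fun fi => fi.2.1) Zx; rewrite iter_chain_cst //; apply.
by move=> fi [_ _ []].
Qed.

Lemma meanw_le : meanw <= 2 * ep.
Proof.
rewrite -(E_weight (start x)).
have := mean_weight_le H F i1 p x Z_nonempty Z_closed M_gt0 L_gt0 gamma_gt0 b_gt0 b_le q_def q_le1 Zx l_small.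
by have := ler_wpM2r (ler0n R 2) slow; rewrite /= => h1 h2; apply: le_trans h2 _; lra.
Qed.

Lemma meanw_le1 : 0 <= 1 - meanw.
Proof. by have := meanw_le; move: ep_le; lra. Qed.

Lemma dev_bound s : Z (st_z s) -> Z (st_zh s) ->
  E s (fun fi : fin => nsq (fi.1.1 - uh s - fi.2.1 *: (st_zh s - uh s))) <=
  ep * (2 * nsq (st_z s - st_zh s) + 40 * l * nsq (st_z s - uh s)
    + 32 * st_d F i1 gamma p hat s).
Proof.
move=> Zz Zzh; have hh := hatP (st_z s) (st_m s).
have := inner_deviation Z_nonempty Z_closed Z_convex M_gt0 L_gt0 gamma_gt0 b_gt0 b_le
  F_lip F_mono hh q_def q_le1 H_gt0 Zz l_small Zzh.
move=> h; apply: le_trans h _; apply: ler_wpM2r => //.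
have d0 := dd_ge0 hh Zzh; have l0' := ltW l0.
by repeat first [assumption | exact: dot_ge0 | exact: ler0n | apply: addr_ge0 | apply: mulr_ge0].
Qed.

Section OneStep.
Variable s : state R d.
Hypotheses (Zz : Z (st_z s)) (Zm : Z (st_m s)) (Zzh : Z (st_zh s)) (Zmh : Z (st_mh s)).
Local Notation z := (st_z s).
Local Notation m := (st_m s).
Local Notation zh := (st_zh s).
Local Notation mh := (st_mh s).
Local Notation u := (uh s).
Local Notation N := (st_N F i1 gamma p hat s).
Local Notation Fx := (full_op F x).
Local Notation dev fi := (fi.1.1 - u - fi.2.1 *: (zh - u)).

Let Zu : Z u. Proof. exact: hat_in. Qed.

Let kapE : gamma ^+ 2 * (2 * L) ^+ 2 = 4 * l ^+ 2.
Proof. by ring. Qed.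

Lemma shadow_error_pointwise (fi : fin) : fin_in Z q b fi ->
  noisy_sq F i1 gamma (2 * L) m fi.1.1 (st_next_zh hat s fi) <=
  2 * nsq (dev fi) + 16 * l ^+ 2 * nsq (u - m) + 16 * l ^+ 2 * nsq (fi.1.1 - u).
Proof.
case=> Zf _ _; rewrite /noisy_sq /st_next_zh.
have -> : fi.1.1 - (u + fi.2.1 *: (zh - u)) = dev fi by rewrite opprD addrA.
have h2 : 2 * gamma * dot (dev fi) (gap F i1 m fi.1.1) <=
    nsq (dev fi) + gamma ^+ 2 * ((2 * L) ^+ 2 * nsq (fi.1.1 - m)).
  have := dot_young (dev fi) (gamma *: gap F i1 m fi.1.1) ltr01.
  rewrite [dot (dev fi) (gamma *: _)]dotZr [dot (gamma *: _) _]dotZl dotZr invr1 !mul1r.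
  have := ler_wpM2l (sqr_ge0 gamma) (gap_le i1 n_gt0 M_gt0 F_sim2 Zf Zm); lra.
have h3 : nsq (fi.1.1 - m) <= 2 * nsq (u - m) + 2 * nsq (fi.1.1 - u).
  have -> : fi.1.1 - m = (u - m) + (fi.1.1 - u) by rewrite [RHS]addrC addrA subrK.
  exact: dot_addr_le2.
have h4 := ler_wpM2l (sqr_ge0 l) h3.
rewrite mulrA kapE in h2 *; lra.
Qed.

(** Within the cross term only the deviation is subjected to Young's inequality, with a free
    parameter [a]; the part along zh - u stays as an exact linear term in the weight. *)
Lemma distance_pointwise (fi : fin) (a : R) : fin_in Z q b fi -> 0 < a ->
  noisy_sq F i1 gamma (2 * L) m fi.1.1 x <=
  (1 - p) * (nsq (z - x) - nsq (u - z)) + p * nsq (m - x) - (p - 16 * l ^+ 2) * nsq (u - m)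
  - 2 * dot N (u - x) - 2 * gamma * dot (full_op F u) (u - x)
  + gamma * mu / 4 * nsq (u - x) + a * nsq (u - x) + 2 * dot (u - x) (zh - u) * fi.2.1
  + a^-1 * nsq (dev fi) + 3 * nsq (fi.1.1 - u).
Proof.
move=> [Zf _ _] a0.
have := noisy_sq_le i1 p n_gt0 M_gt0 F_sim2 gamma_gt0 mu_gt0 z x Zm Zu Zf.
rewrite kapE -/N.
have h1 := dot_young (u - x) (dev fi) a0.
have e1 : dot (u - x) (fi.1.1 - u) = fi.2.1 * dot (u - x) (zh - u) + dot (u - x) (dev fi).
  by rewrite -dotZr -dotDr; congr dot; rewrite [RHS]addrC subrK.
have pp : p * p <= 1 / 16.
  by have := ler_wpM2l (ltW p_gt0) p_le; move: p_le; lra.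
have l2 : l ^+ 2 <= 1 / 100.
  have : gamma * mu <= 1 by move: gmu p_le; lra.
  have pp0 : 0 <= p * p by rewrite mulr_ge0 ?ltW.
  by move=> /(ler_wpM2r pp0); move: l2_le pp; lra.
have h2 : (2 + 4 * (4 * l ^+ 2) + 4 * (4 * l ^+ 2) / (gamma * mu)) * nsq (fi.1.1 - u) <=
    3 * nsq (fi.1.1 - u).
  rewrite ler_wpM2r ?dot_ge0//.
  have : 4 * (4 * l ^+ 2) / (gamma * mu) <= 1 / 100.
    rewrite ler_pdivrMr//; have := ler_wpM2l (ltW y0) pp; move: l2_le y0; lra.
  move: l2; lra.
rewrite e1; move: h1 h2; move: (4 * (4 * l ^+ 2) / (gamma * mu)) => A; lra.
Qed.

Definition dev_size : R :=
  ep * (2 * nsq (z - zh) + 40 * l * nsq (u - z) + 32 * st_d F i1 gamma p hat s).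

Let E_dev : E s (fun fi : fin => nsq (dev fi)) <= dev_size.
Proof. by have := dev_bound Zz Zzh; rewrite (dot_subC z u). Qed.

Let E_sq : E s (fun fi : fin => nsq (fi.1.1 - u)) <= 2 * ep * nsq (u - z).
Proof. by have := mean_sq_error Zz; rewrite (dot_subC z u). Qed.

Lemma shadow_error_le : E s (fun fi : fin => noisy_sq F i1 gamma (2 * L) m fi.1.1 (st_next_zh hat s fi))
  <= 2 * dev_size + 16 * l ^+ 2 * nsq (u - m) + 32 * l ^+ 2 * ep * nsq (u - z).
Proof.
apply: (@le_trans _ _ (E s (fun fi => 16 * l ^+ 2 * nsq (u - m) +
    (2 * nsq (dev fi) + 16 * l ^+ 2 * nsq (fi.1.1 - u))))).
  by apply: E_le => // fi /shadow_error_pointwise; lra.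
rewrite iter_chainD iter_chain_cst // iter_chainD !iter_chainZ.
have c0 : 0 <= 16 * l ^+ 2 by rewrite mulr_ge0 ?sqr_ge0.
have h1 := ler_wpM2l (ler0n R 2) E_dev; have h2 := ler_wpM2l c0 E_sq.
move: h1 h2; lra.
Qed.

(** The left side includes the anchor term averaged over the coin. The weight 1 - meanw is forced:
    the identity for zh - u moves meanw p from |m - x|^2 to |z - x|^2, and with this weight both
    coefficients close up exactly. *)
Lemma distance_le (a : R) : 0 < a ->
  E s (fun fi : fin => noisy_sq F i1 gamma (2 * L) m fi.1.1 x)
    + (p * ((1 - meanw) * nsq (z - x)) + (1 - p) * ((1 - meanw) * nsq (m - x))) <=
  nsq (z - x) + (1 - meanw) * nsq (m - x) - 1 / 2 * nsq (u - z) - p / 2 * nsq (u - m)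
  - gamma * dot Fx (u - x) - 3 / 2 * (gamma * mu) * nsq (u - x) + 2 * a * nsq (u - x)
  + a^-1 * (meanw ^+ 2 * nsq (z - zh) + dev_size).
Proof.
move=> a0; have th0 := meanw_ge0; have th1 := meanw_le.
pose CV := (1 - p) * (nsq (z - x) - nsq (u - z)) + p * nsq (m - x) - (p - 16 * l ^+ 2) * nsq (u - m)
  - 2 * dot N (u - x) - 2 * gamma * dot (full_op F u) (u - x)
  + gamma * mu / 4 * nsq (u - x) + a * nsq (u - x).
have hE : E s (fun fi : fin => noisy_sq F i1 gamma (2 * L) m fi.1.1 x) <=
    CV + (2 * dot (u - x) (zh - u) * meanw + (a^-1 * dev_size + 3 * (2 * ep * nsq (u - z)))).
  apply: (@le_trans _ _ (E s (fun fi => CV + (2 * dot (u - x) (zh - u) * fi.2.1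
      + (a^-1 * nsq (dev fi) + 3 * nsq (fi.1.1 - u)))))).
    by apply: E_le => // fi /distance_pointwise /(_ a0); rewrite /CV; lra.
  rewrite iter_chainD iter_chain_cst // iter_chainD iter_chainZ iter_chainD !iter_chainZ E_weight.
  have ai : 0 <= a^-1 by rewrite invr_ge0 ltW.
  have h1 := ler_wpM2l ai E_dev; have h2 := ler_wpM2l (ler0n R 3) E_sq.
  by move: h1 h2; lra.
have hN : 0 <= dot N (u - x).
  by have := normal_le (hatP z m) Zx; rewrite -(opprB u x) dotNr oppr_le0.
have hF := ler_wpM2l (ltW gamma_gt0) (full_strong Zu).
have hP := mulr_ge0 (ltW gamma_gt0) (sol_ge0 Zu).
(* The drift of the weight pulls along zh - u, which the optimality of u expresses
   through the operator, the normal and the anchor m. *)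
have hL : dot (u - x) (zh - u) = dot N (u - x) + gamma * dot (full_op F u) (u - x)
    + gamma * dot (u - x) (gap F i1 m u) - p * dot (u - x) (m - z) - dot (u - x) (z - zh).
  have -> : zh - u = N + gamma *: full_op F u + gamma *: gap F i1 m u - p *: (m - z) - (z - zh).
    rewrite /st_N /normal_of /drift /gap -/u.
    move: (full_op F u) (full_op F m) (node_op F i1 u) (node_op F i1 m) => v1 v2 v3 v4.
    by apply/rowP => i; rewrite !mxE; ring.
  rewrite (dotC N) (dotC (full_op F u)).
  move: N (full_op F u) (gap F i1 m u) (m - z) (z - zh) (u - x) => v1 v2 v3 v4 v5 v6.
  by rewrite !(dotDr, dotNr, dotZr).
have hA : 2 * dot (u - x) (m - z) = nsq (u - z) - nsq (u - m) + nsq (m - x) - nsq (z - x).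
  rewrite !(dotDl, dotDr, dotNl, dotNr) ?(dotC z u) ?(dotC m u) ?(dotC x u) ?(dotC x z) ?(dotC x m).
  ring.
have y1 : gamma * mu <= 1 by move: gmu p_le; lra.
have pp0 : 0 <= p * p by rewrite mulr_ge0 ?ltW.
have pp : p * p <= p / 4 by have := ler_wpM2l (ltW p_gt0) p_le; lra.
have hG : 2 * gamma * dot (u - x) (gap F i1 m u) <= gamma * mu * nsq (u - x) + p / 100 * nsq (u - m).
  have := dot_young (u - x) (gamma *: gap F i1 m u) y0.
  rewrite [dot (u - x) (gamma *: _)]dotZr [dot (gamma *: _) _]dotZl dotZr.
  have g1 := ler_wpM2l (sqr_ge0 gamma) (gap_le i1 n_gt0 M_gt0 F_sim2 Zu Zm).
  rewrite mulrA kapE in g1.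
  have yi : 0 <= (gamma * mu)^-1 by rewrite invr_ge0 ltW.
  have g2 := ler_wpM2l yi g1.
  have g3 : (gamma * mu)^-1 * (4 * l ^+ 2 * nsq (u - m)) <= p / 100 * nsq (u - m).
    rewrite mulrA ler_wpM2r ?dot_ge0// ler_pdivrMl//.
    have := ler_wpM2l (ltW y0) pp; have := mulr_gt0 y0 p_gt0; move: l2_le; lra.
  move: g2 g3; move: (gamma * mu)^-1 => iy; lra.
have hK : - (2 * meanw * dot (u - x) (z - zh)) <= a * nsq (u - x) + a^-1 * (meanw ^+ 2 * nsq (z - zh)).
  have := dot_young (u - x) (- (meanw *: (z - zh))) a0.
  rewrite dotNr [dot (- _) (- _)]dotNl dotNr opprK.
  by rewrite (dotZr meanw (u - x)) (dotZl meanw (z - zh)) (dotZr meanw (z - zh)); lra.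
have th2 : meanw <= 1 / 100 by move: th1 ep_le; lra.
have s1 : 0 <= 1 - meanw by lra.
have s2 : 0 <= 1 / 100 - meanw by lra.
have UX0 := dot_ge0 (u - x); have UM0 := dot_ge0 (u - m); have UZ0 := dot_ge0 (u - z).
have f1 := mulr_ge0 s1 hN.
have f2 := ler_wpM2l s1 hF.
have f3 := mulr_ge0 s2 hP.
have f4 := ler_wpM2l th0 hG.
have f5 := mulr_ge0 s2 (mulr_ge0 (ltW y0) UX0).
have f6 := mulr_ge0 s2 (mulr_ge0 (ltW p_gt0) UM0).
have f7 := mulr_ge0 th0 (mulr_ge0 (ltW p_gt0) UZ0).
have f8 : 16 * l ^+ 2 * nsq (u - m) <= p / 100 * nsq (u - m).
  rewrite ler_wpM2r//; have := ler_wpM2r pp0 y1; move: l2_le pp; lra.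
have f9 : ep * nsq (u - z) <= 1 / 100 * nsq (u - z) by rewrite ler_wpM2r//; move: ep_le; lra.
have f10 : 2 * dot (u - x) (zh - u) * meanw = meanw * (2 * (dot N (u - x) + gamma * dot (full_op F u) (u - x)))
   + meanw * (2 * gamma * dot (u - x) (gap F i1 m u))
   - meanw * (p * (nsq (u - z) - nsq (u - m) + nsq (m - x) - nsq (z - x)))
   - 2 * meanw * dot (u - x) (z - zh).
  by rewrite hL -hA; ring.
have f11 := ler_wpM2r UZ0 p_le.
have f12 := mulr_ge0 (ltW y0) UX0.
have f13 := mulr_ge0 (ltW p_gt0) UM0.
rewrite /CV f10 in hE.
move: UZ0 hE hK hP f1 f2 f3 f4 f5 f6 f7 f8 f9 f11 f12 f13.
move: (E s _) => E0.
move: (dot N (u - x)) (dot (full_op F u) (u - x)) (dot (u - x) (gap F i1 m u)) (dot (u - x) (z - zh))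
  (dot Fx (u - x)) (nsq (u - x)) (nsq (u - m)) (nsq (u - z)) (nsq (m - x)) (nsq (z - x)) (nsq (z - zh))
  (dev_size) (meanw) => v1 v2 v3 v4 v5 v6 v7 v8 v9 v10 v11 v12 th; lra.
Qed.

(** The perturbation of the shadow step: with [kvec] zero, [u] would be the anchored proximal step
    from (zh, mh) for the constant operator F(x). *)
Definition kvec : 'rV[R]_d :=
  (1 - p) *: (z - zh) + p *: (m - mh) - gamma *: (drift F i1 m u - Fx).

(** The energy of the shadow iterate. Its linear part is nonnegative on [Z] and zero at [x], because
    [x] solves the variational inequality. *)
Definition potential (y w : 'rV[R]_d) : R := gamma * dot Fx (y - x) + p / 2 * nsq (y - w).

Local Notation D2 := (nsq (u - zh)).
Local Notation hm := (nsq (u - mh)).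
Local Notation dd := (st_d F i1 gamma p hat s).
Local Notation bb := (dot N (u - mh)).
Local Notation newn := (gamma *: Fx + N).

Definition next_potential : R := (1 - meanw) * potential u mh + meanw * potential zh mh
  - p ^+ 2 / 2 * (1 - meanw) * hm + p ^+ 2 / 2 * D2.

Definition next_residual : R := nsq newn + 2 * p * (1 - p) * bb + 2 * p ^+ 2 * dd
  + meanw * ((3 - 2 * p) * dd).

Let deltaE : u - zh = p *: (mh - zh) + kvec - newn.
Proof.
rewrite /kvec /st_N /normal_of -/u.
move: (drift F i1 m u) Fx => v1 v2.
by apply/rowP => i; rewrite !mxE; ring.
Qed.

Let ddE : dd = dot N (u - zh).
Proof. by rewrite /st_d -dotNr opprB. Qed.

Let dd0 : 0 <= dd.
Proof. exact: (dd_ge0 (hatP z m) Zzh). Qed.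

Let bb0 : 0 <= bb.
Proof. by have := normal_le (hatP z m) Zmh; rewrite -(opprB u mh) dotNr oppr_le0. Qed.

Let th_small : 0 <= meanw <= 1 / 100.
Proof. by rewrite meanw_ge0 /=; have := meanw_le; move: ep_le; lra. Qed.

Let cross_le : dot kvec (u - zh) <= 1 / 4 * D2 + nsq kvec.
Proof.
have t : (0 : R) < 2 by [].
have := dot_young kvec (u - zh) t; lra.
Qed.

Let cross_ge : - dot kvec (u - zh) <= 1 / 4 * D2 + nsq kvec.
Proof.
have t : (0 : R) < 2 by [].
have := dot_young (- kvec) (u - zh) t; rewrite !(dotNl, dotNr); lra.
Qed.

Let potE : potential u mh = potential zh mh - (1 - p / 2) * D2 + dot kvec (u - zh) - dd.
Proof. by rewrite ddE; exact: (shadow_potential x deltaE). Qed.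

Let p2 : p ^+ 2 <= 1 / 16.
Proof. by have := ler_wpM2l (ltW p_gt0) p_le; move: p_le; lra. Qed.

Lemma potential_le1 : next_potential <=
  potential zh mh - 11 / 20 * D2 - 9 / 10 * dd - 9 / 20 * p ^+ 2 * hm + nsq kvec.
Proof.
have /andP[t0 t1] := th_small; have s1 : 0 <= 1 - meanw by lra.
have s2 : 0 <= 1 / 100 - meanw by lra.
have g0 := dot_ge0 (u - zh); have g1 := dot_ge0 kvec.
have h0 : 0 <= p ^+ 2 * hm by rewrite mulr_ge0 ?sqr_ge0 ?dot_ge0.
have f1 := ler_wpM2l s1 cross_le; have f2 := mulr_ge0 s2 h0; have f3 := mulr_ge0 s2 g0.
have f4 := mulr_ge0 s2 dd0; have f5 := ler_wpM2r g0 p2; have f6 := ler_wpM2r g0 p_le.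
have f7 := mulr_ge0 t0 g1; have f8 := mulr_ge0 s1 (mulr_ge0 (_ : 0 <= 1 / 4 - p) g0).
rewrite subr_ge0 in f8; have {}f8 := f8 p_le.
rewrite /next_potential potE.
move: dd0; move: f1 f2 f3 f4 f5 f6 f7 f8 g0; lra.
Qed.

Lemma potential_le2 : next_potential <= gamma * dot Fx (u - x) + p / 2 * hm
  + 1 / 20 * D2 + 1 / 100 * nsq kvec + 1 / 100 * dd.
Proof.
have /andP[t0 t1] := th_small; have s1 : 0 <= 1 - meanw by lra.
have s2 : 0 <= 1 / 100 - meanw by lra.
have g0 := dot_ge0 (u - zh); have g1 := dot_ge0 kvec.
have h0 : 0 <= p ^+ 2 * hm by rewrite mulr_ge0 ?sqr_ge0 ?dot_ge0.
have f1 := ler_wpM2l t0 cross_ge; have f2 := mulr_ge0 s1 h0; have f3 := mulr_ge0 s2 g0.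
have f4 := mulr_ge0 s2 dd0; have f5 := ler_wpM2r g0 p2; have f6 := mulr_ge0 s2 g1.
have f7 := mulr_ge0 t0 (mulr_ge0 (ltW p_gt0) g0).
have e : potential zh mh = potential u mh + (1 - p / 2) * D2 - dot kvec (u - zh) + dd.
  by rewrite potE; ring.
rewrite /next_potential e /potential.
move: f1 f2 f3 f4 f5 f6 f7 g0; lra.
Qed.

Hypothesis t_ge0 : 0 <= st_t s.
Hypothesis almost_normal : forall y, Z y -> dot (st_n s - gamma *: Fx) (y - zh) <= st_t s.

(** Up to the pull of the anchor and [kvec], [st_n] is minus the last displacement towards the exact
    solution. The pairing with zh - mh is at least - st_t by almost normality, so 3 st_t keeps the
    sum nonnegative. *)
Definition residual : R := nsq (st_n s) + 2 * p * dot (st_n s - gamma *: Fx) (zh - mh) + 3 * st_t s.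

Lemma residual_ge0 : 0 <= residual.
Proof.
have h := almost_normal Zmh; rewrite -(opprB zh mh) dotNr in h.
have h2 := ler_wpM2l (ltW p_gt0) h; have h3 := ler_wpM2r t_ge0 p_le.
by have := dot_ge0 (st_n s); have := t_ge0; rewrite /residual; lra.
Qed.

Lemma residual_le1 : next_residual <= residual - st_t s + nsq kvec - 2 * p ^+ 2 * bb - dd.
Proof.
have /andP[t0 t1] := th_small.
have h := shadow_residual p kvec (mh - zh) (almost_normal Zu).
have e : kvec + p *: (mh - zh) - (u - zh) = newn.
  by rewrite deltaE; move: newn => v; apply/rowP => i; rewrite !mxE; ring.
rewrite e [newn - _]addrAC subrr add0r -(opprB zh mh) !dotNr -ddE in h.
have e2 : bb = dot N (u - zh) + dot N (zh - mh) by rewrite -dotDr addrA subrK.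
rewrite -ddE in e2.
have f1 := mulr_ge0 (_ : 0 <= 1 / 100 - meanw) dd0; rewrite subr_ge0 in f1; have {}f1 := f1 t1.
have f2 := ler_wpM2r dd0 p2; have f3 := ler_wpM2r dd0 p_le.
have f4 := mulr_ge0 t0 (mulr_ge0 (ltW p_gt0) dd0).
have e3 : 2 * p * bb = 2 * p * dd + 2 * p * dot N (zh - mh) by rewrite e2; ring.
rewrite /next_residual /residual; move: dd0; move: h e3 f1 f2 f3 f4.
move: (dot N (zh - mh)) (dot (st_n s - _) (zh - mh)) => v1 v2; lra.
Qed.

Lemma residual_le2 : next_residual <=
  17 / 5 * D2 + 6 * p ^+ 2 * hm + 3 * nsq kvec + 2 * p * bb + 1 / 5 * dd.
Proof.
have /andP[t0 t1] := th_small.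
have e : newn = kvec + p *: (mh - zh) + (- (u - zh)).
  by rewrite deltaE; move: newn => v; apply/rowP => i; rewrite !mxE; ring.
have h := dot_add3_le kvec (p *: (mh - zh)) (- (u - zh)).
have eN : nsq (- (u - zh)) = D2 by rewrite dotNl dotNr opprK.
have eZ : nsq (p *: (mh - zh)) = p ^+ 2 * nsq (mh - zh) by rewrite dotZl dotZr mulrA.
rewrite -e eN eZ in h.
have h2 : nsq (mh - zh) <= 2 * hm + 2 * D2.
  have := dot_addr_le2 (mh - u) (u - zh); rewrite (dot_subC mh u).
  by rewrite addrA subrK.
have h3 := ler_wpM2l (sqr_ge0 p) h2.
have f1 := mulr_ge0 (_ : 0 <= 1 / 100 - meanw) dd0; rewrite subr_ge0 in f1; have {}f1 := f1 t1.
have f2 := ler_wpM2r dd0 p2; have f4 := mulr_ge0 t0 (mulr_ge0 (ltW p_gt0) dd0).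
have f5 := mulr_ge0 (sqr_ge0 p) bb0.
have g0 := dot_ge0 (u - zh); have f6 := ler_wpM2r g0 p2.
rewrite /next_residual; move: dd0; move: h h3 f1 f2 f4 f5 f6 g0; lra.
Qed.

Lemma kvec_le : nsq kvec <= 4 * nsq (z - zh) + 4 * p ^+ 2 * nsq (m - mh)
  + 4 * l ^+ 2 * nsq (u - m) + 4 * l ^+ 2 * nsq (m - x).
Proof.
pose v1 := (1 - p) *: (z - zh); pose v2 := p *: (m - mh); pose v3 := gamma *: (drift F i1 m u - Fx).
have h1 : nsq kvec <= 2 * (2 * nsq v1 + 2 * nsq v2) + 2 * nsq v3.
  apply: (le_trans (dot_addr_le2 (v1 + v2) (- v3))).
  rewrite [nsq (- v3)]dotNl dotNr opprK lerD2r ler_pM2l//; exact: dot_addr_le2.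
have e1 : nsq v1 = (1 - p) ^+ 2 * nsq (z - zh) by rewrite dotZl dotZr mulrA.
have e2 : nsq v2 = p ^+ 2 * nsq (m - mh) by rewrite dotZl dotZr mulrA.
have h3 : nsq v3 <= 2 * (l ^+ 2 * nsq (u - m)) + 2 * (l ^+ 2 * nsq (m - x)).
  have -> : v3 = gamma *: (node_op F i1 u - node_op F i1 m) + gamma *: (full_op F m - Fx).
    by rewrite -scalerDr /v3 /drift addrA.
  apply: le_trans (dot_addr_le2 _ _) _; rewrite ![nsq (gamma *: _)]dotZl !(dotZr gamma).
  have g1 := ler_wpM2l (sqr_ge0 gamma) (node_op_lip F_lip i1 Zu Zm).
  have g2 := ler_wpM2l (sqr_ge0 gamma) (full_op_lip n_gt0 F_lip Zm Zx).
  move: g1 g2; lra.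
have h4 : (1 - p) ^+ 2 * nsq (z - zh) <= nsq (z - zh).
  rewrite -[leRHS]mul1r ler_wpM2r ?dot_ge0//.
  by have := mulr_ge0 (ltW p_gt0) (_ : 0 <= 2 - p); move=> /(_ ltac:(move: p_le; lra)); lra.
rewrite e1 e2 in h1; move: h1 h3 h4; lra.
Qed.

End OneStep.

Definition level (w1 w2 w3 w4 : R) s := w1 * (nsq (st_z s - x) + (1 - meanw) * nsq (st_m s - x))
  + w2 * potential (st_zh s) (st_mh s) + w3 * residual s
  + w4 * (6 * nsq (st_z s - st_zh s) + 8 * p * nsq (st_m s - st_mh s)).

Lemma level_step k s v (w1 w2 w3 w4 a : R) : state_ok s ->
  0 <= w1 -> 0 <= w2 -> 0 <= w3 -> 0 <= w4 -> 0 < a ->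
  avg lw (step_draws n H k) (fun y => level w1 w2 w3 w4 (step y k s)) v <=
  w1 * (nsq (st_z s - x) + (1 - meanw) * nsq (st_m s - x) - 1 / 2 * nsq (uh s - st_z s)
    - p / 2 * nsq (uh s - st_m s) - gamma * dot (full_op F x) (uh s - x)
    - 3 / 2 * (gamma * mu) * nsq (uh s - x) + 2 * a * nsq (uh s - x)
    + a^-1 * (meanw ^+ 2 * nsq (st_z s - st_zh s) + dev_size s))
  + 6 * w4 * (2 * dev_size s + 16 * l ^+ 2 * nsq (uh s - st_m s)
      + 32 * l ^+ 2 * ep * nsq (uh s - st_z s))
  + 8 * p * w4 * (p * nsq (st_z s - st_zh s) + (1 - p) * nsq (st_m s - st_mh s))
  + (w2 * next_potential s + w3 * next_residual s).
Proof.
move=> [Zz Zm Zzh Zmh [t0 hn]] w10 w20 w30 w40 a0.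
pose G (co : bool) (fi : fin) := let s' := next_state F i1 gamma p hat x s x co fi in
  w1 * ((1 - meanw) * nsq (st_m s' - x)) + w2 * potential (st_zh s') (st_mh s')
  + w3 * residual s' + w4 * (8 * p * nsq (st_m s' - st_mh s')).
have c20 : 0 <= 6 * w4 by rewrite mulr_ge0.
apply: (le_trans (avg_state_step (x := x) Z_nonempty Z_closed Z_convex lw_sum lw_ge0 hc n_gt0 F_sim2 hatP L_gt0
  gamma_gt0 b_gt0 b_le q_def q_le1 k (f := level w1 w2 w3 w4) (c1 := w1) (c2 := 6 * w4) (G := G) v w10 c20 Zz Zm Zzh _ Zx)).
  by move=> zn co fi; rewrite /level /G /= /residual /=; ring.
pose C0 := w1 * (p * ((1 - meanw) * nsq (st_z s - x)) + (1 - p) * ((1 - meanw) * nsq (st_m s - x)))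
  + 8 * p * w4 * (p * nsq (st_z s - st_zh s) + (1 - p) * nsq (st_m s - st_mh s))
  + w2 * (potential (uh s) (st_mh s) - p ^+ 2 / 2 * nsq (uh s - st_mh s) + p ^+ 2 / 2 * nsq (uh s - st_zh s))
  + w3 * (nsq (gamma *: full_op F x + st_N F i1 gamma p hat s)
      + 2 * p * (1 - p) * dot (st_N F i1 gamma p hat s) (uh s - st_mh s)
      + 2 * p ^+ 2 * st_d F i1 gamma p hat s).
pose C1 := w2 * (potential (st_zh s) (st_mh s) - potential (uh s) (st_mh s)
    + p ^+ 2 / 2 * nsq (uh s - st_mh s)) + w3 * ((3 - 2 * p) * st_d F i1 gamma p hat s).
apply: (@le_trans _ _ (E s (fun fi => C0 + (C1 * fi.2.1
   + (w1 * noisy_sq F i1 gamma (2 * L) (st_m s) fi.1.1 x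
     + 6 * w4 * noisy_sq F i1 gamma (2 * L) (st_m s) fi.1.1 (st_next_zh hat s fi)))))).
  apply: E_le => // fi [_ _ [th0 th1 _ th2 _]]; have th3 := le_trans th1 th2.
  have p1 : p <= 1 by move: p_le; lra.
  have h1 := shadow_potential_next gamma (st_zh s) (st_mh s) (uh s) x (full_op F x) (ltW p_gt0) p1 th0 th3.
  have h2 := shadow_residual_next p fi.2.1 (st_zh s) (st_mh s) (uh s) (st_N F i1 gamma p hat s)
    (gamma *: full_op F x + st_N F i1 gamma p hat s).
  have h3 := ler_wpM2l w20 h1; have h4 := congr1 (fun r => w3 * r) h2.
  rewrite /= in h4.
  have eN : gamma *: full_op F x + st_N F i1 gamma p hat s - gamma *: full_op F x = st_N F i1 gamma p hat s.
    by rewrite addrAC subrr add0r.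
  rewrite /G /residual /= eN /C0 /C1 /potential.
  move: h3 h4; rewrite /st_next_zh /st_d.
  lra.
rewrite iter_chainD iter_chain_cst // iter_chainD iter_chainZ iter_chainD !iter_chainZ E_weight.
have h1 := ler_wpM2l w10 (distance_le Zz Zm Zzh a0).
have h2 := ler_wpM2l c20 (shadow_error_le Zz Zm Zzh).
rewrite /C0 /C1 /next_potential /next_residual; move: h1 h2.
by move: (iter _ _ _ _) => e1; move: (iter _ _ _ _) => e2; lra.
Qed.

Local Notation y := (gamma * mu).
Local Notation B := (240 * (p * ep)).
(** The offset 10 / p gives p t >= 10 from the start, so that the weights change slowly and the
    initial distance weight is at most 121/100. *)
Definition time k : R := k%:R + 10 / p.
Local Notation nu k := (sched p y (time k)).

(** Energy and residual are weighted by nu and nu^2. The factor B = 240 p ep makes B nu^2 equal to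
    120 ep / a for the Young parameter [a] of the distance estimate, so the decrease of the residual
    pays for the inner deviation. The distance to the shadow iterate carries the sum of both
    weights, since it perturbs both. *)
Definition lyapunov k : state R d -> R := level (dist_weight p (time k)) (40 * (B * nu k))
  (B * nu k ^+ 2) (40 * (B * nu k) + B * nu k ^+ 2).

Let timeS k : time k.+1 = time k + 1.
Proof. by rewrite /time -natr1 addrAC. Qed.

Let time_ge k : 10 <= p * time k.
Proof.
rewrite mulrDr mulrCA mulfV ?gt_eqF// mulr1.
by have := mulr_ge0 (ltW p_gt0) (ler0n R k); lra.
Qed.

Let ep_p : ep <= p / 100 * (1 / 100) * (1 / 40).
Proof.
have h := ler_wpM2l (ltW ep0) Xp.
by have := ler_wpM2r (ltW p_gt0) epX_le; lra.
Qed.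

Let y_p : y <= p / 100 * (1 / 100).
Proof. by have := p_gt0; move: ep_p small; lra. Qed.

Let y_small : y <= 1 / 100. Proof. by move: y_p p_le; lra. Qed.

Let B0 : 0 < B.
Proof. by apply: mulr_gt0; [rewrite ltr0n | exact: mulr_gt0]. Qed.

Let B_small : 42 * B <= 1 / 100.
Proof. by have := ler_wpM2r (ltW ep0) p_le; move: ep_le; lra. Qed.

Section OneTime.
Variable k : nat.
Local Notation nuk := (nu k).

Let nu40 : 40 <= nuk. Proof. exact: (sched_gt p_gt0 p_le y0 y_p (time_ge k)). Qed.

Let cap16 : p * y * nuk ^+ 2 <= 16.
Proof. exact: (sched_le_cap p_gt0 p_le y0 y_p (time_ge k)). Qed.

Let B2l : B * nuk ^+ 2 * l <= 1 / 100.
Proof.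
have e : B * nuk ^+ 2 * l = 6 * (ep * X) * p * (p * y * nuk ^+ 2).
  have -> : l = y * (X * p) / 40 by rewrite -lE; field.
  by field.
have c0 : 0 <= 6 * (ep * X) * p by rewrite !mulr_ge0 ?ltW.
rewrite e; have := ler_wpM2l c0 cap16.
have := ler_wpM2r (ltW p_gt0) epX_le; move: p_le; lra.
Qed.

Let B2l2 : B * nuk ^+ 2 * l ^+ 2 <= y / 500.
Proof.
have e : B * nuk ^+ 2 * l ^+ 2 = 3 / 20 * (ep * X * X) * (p * p) * y * (p * y * nuk ^+ 2).
  have -> : l = y * (X * p) / 40 by rewrite -lE; field.
  by field.
have A0 := mulr_gt0 ep0 X0.
have h4 : ep * X * X <= 1 / 100.
  have X1 : 100 <= X by move: X_ge; lra.
  have h2' := ler_wpM2l (ltW (mulr_gt0 A0 X0)) X1.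
  have e' : ep * X * X * X = 1 by rewrite -epX; ring.
  rewrite e' in h2'; lra.
have pp0 : 0 <= p * p by rewrite mulr_ge0 ?ltW.
have pp : p * p <= 1 / 16 by have := ler_wpM2l (ltW p_gt0) p_le; move: p_le; lra.
have c0 : 0 <= 3 / 20 * (ep * X * X) * (p * p) * y.
  have u1 := ltW y0; have u2 := ltW X0; have u3 := ltW ep0.
  by repeat first [assumption | apply: mulr_ge0 | lra].
rewrite e; have := ler_wpM2l c0 cap16.
have h5 : ep * X * X * (p * p) <= 1 / 100 * (1 / 16).
  by apply: ler_pM => //; rewrite mulr_ge0 ?(ltW A0) ?(ltW X0).
have := ler_wpM2r (ltW y0) h5; move: y0; lra.
Qed.

Lemma lyapunov_step s v : state_ok s ->
  avg lw (step_draws n H k) (fun w => lyapunov k.+1 (step w k s)) v <= (1 - y / 2) * lyapunov k s.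
Proof.
move=> ok; have [Zz Zm Zzh Zmh [t0 hn]] := ok.
have nu0 : 0 < nuk by apply: lt_le_trans nu40; rewrite ltr0n.
have n2 : 0 < p * nuk ^+ 2 by rewrite mulr_gt0 ?exprn_gt0.
have g0 : 0 <= 51 / 100 * y by rewrite mulr_ge0 ?(ltW y0)//; lra.
have [q1 q2] := linear_weight p_gt0 p_le y0 y_p (time_ge k).
have [q3 q4] := quadratic_weight p_gt0 p_le y0 y_p (time_ge k).
have q5 := dist_weight_ge1 p_gt0 y0 (time_ge k).
have q6 := dist_weight_le p_gt0 p_le y0 y_p (time_ge k).
have q7 := dist_weight_drop p_gt0 p_le y0 (time_ge k).
have q8 := sched_ge p_gt0 y0 y_p (time_ge k).
have q9 := sched_inv_le (time k) p_gt0 y0 y_p.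
have q10 := time_inv_le p_gt0 (time_ge k).
have q11 := dist_weight_old p_gt0 p_le (time_ge k).
rewrite -timeS in q1 q2 q3 q4 q5 q6 q7.
have p0 := ltW p_gt0; have y0' := ltW y0; have BB := ltW B0; have n0 := ltW nu0.
(* The loss 2 a = 1 / (p nu^2) is at most 1 / (p t^2) + y/16: the first part is paid by the drop of
   [dist_weight], the second by strong monotonicity. *)
pose a := (2 * (p * nuk ^+ 2))^-1.
have a0 : 0 < a by rewrite invr_gt0 mulr_gt0.
have aE : a^-1 = 2 * p * nuk ^+ 2 by rewrite invrK mulrA.
have a2 : 2 * a = (p * nuk ^+ 2)^-1 by rewrite /a; field; rewrite !gt_eqF.
have g1 : 0 < 1 + 51 / 100 * y by apply: ltr_pwDl.
have n10 : 0 <= nu k.+1 by rewrite -(pmulr_rge0 _ g1); apply: le_trans q1.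
have Bn0 : 0 <= B * nuk by rewrite mulr_ge0.
have w10 : 0 <= dist_weight p (time k.+1) by rewrite -(pmulr_rge0 _ g1); apply: le_trans q5.
have w20 : 0 <= 40 * (B * nu k.+1) by exact: (mulr_ge0 (ler0n R 40) (mulr_ge0 BB n10)).
have w30 : 0 <= B * nu k.+1 ^+ 2 by rewrite mulr_ge0 ?sqr_ge0.
have := level_step k v ok w10 w20 w30 (addr_ge0 w20 w30) a0.
set RHS := (X in _ <= X -> _) => hE.
have W0 : 0 <= lyapunov k s.
  have r0 := residual_ge0 Zmh t0 hn.
  have f0 : 0 <= potential (st_zh s) (st_mh s).
    by rewrite addr_ge0// mulr_ge0 ?dot_ge0 ?divr_ge0 ?(ltW gamma_gt0)// sol_ge0.
  have om0 : 0 <= dist_weight p (time k) by apply: le_trans q11.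
  have th1 := meanw_le1.
  have K0 : 0 <= 40 * (B * nuk) by apply: mulr_ge0.
  have B20 : 0 <= B * nuk ^+ 2 by rewrite mulr_ge0 ?sqr_ge0.
  rewrite /lyapunov /level.
  by repeat first [assumption | exact: dot_ge0 | exact: ler0n | apply: addr_ge0 | apply: mulr_ge0].
have big : (1 + 51 / 100 * y) * RHS <= lyapunov k s.
  pose u := uh s; have Zu : Z u by exact: hat_in.
  have [[c1 c2 c3 c4] [c5 c6 c7 c8 c9]] := weight_bounds p0 BB nu40 q8 q1 q2 q3 q4.
  have d0 : 0 <= st_d F i1 gamma p hat s by exact: (dd_ge0 (hatP _ _) Zzh).
  have b0' : 0 <= dot (st_N F i1 gamma p hat s) (u - st_mh s).
    by have := normal_le (hatP (st_z s) (st_m s)) Zmh; rewrite -(opprB u (st_mh s)) dotNr oppr_le0.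
  have f0 : 0 <= gamma * dot (full_op F x) (u - x).
    by rewrite mulr_ge0 ?(ltW gamma_gt0)// sol_ge0.
  have S1 := potential_residual_budget p0 BB c1 c2 c3 c4 B_small c5 c6 c7 c8 t0 (dot_ge0 (u - st_zh s))
    (dot_ge0 (u - st_mh s)) d0 b0' (dot_ge0 (kvec s)) f0 (potential_le1 Zzh) (potential_le2 Zzh)
    (residual_le1 Zzh hn) (residual_le2 Zzh Zmh).
  have k1 := dot_split_half u (st_z s) x.
  have k2 := dot_split_tenth (st_z s) u x; rewrite (dot_subC (st_z s) u) in k2.
  have k3 := dot_split_tenth (st_m s) u x; rewrite (dot_subC (st_m s) u) in k3.
  have T0 : 0 <= (p * time k ^+ 2)^-1 by rewrite invr_ge0 mulr_ge0 ?sqr_ge0.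
  have W40 : 0 <= (1 + 51 / 100 * y) * (40 * (B * nu k.+1)) + (1 + 51 / 100 * y) * (B * nu k.+1 ^+ 2).
    by rewrite -mulrDr; exact: (mulr_ge0 (ltW g1) (addr_ge0 w20 w30)).
  have a2' : 2 * a <= (p * time k ^+ 2)^-1 + y / 16 by rewrite a2.
  have B2E : B * nuk ^+ 2 = 240 * (p * ep * nuk ^+ 2) by ring.
  have S2 := outer_budget p0 p_le y0' y_p (ltW l0) (ltW ep0) ep_le meanw_ge0 meanw_le (sqr_ge0 nuk) T0 q10 a2'
    q5 q6 q7 B2E B2l B2l2 Bn0 c2 W40 c9
    (dot_ge0 (st_z s - x)) (dot_ge0 (st_m s - x)) (dot_ge0 (u - x)) (dot_ge0 (u - st_z s))
    (dot_ge0 (u - st_m s)) (dot_ge0 (st_z s - st_zh s)) (dot_ge0 (st_m s - st_mh s)) d0 f0 k1 k2 k3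
    (kvec_le Zm).
  rewrite /lyapunov /level; apply: (combine_budgets S2 S1).
  by rewrite /RHS aE /dev_size -/u; ring.
by apply: (le_trans hE); exact: (cancel_growth y0' y_small W0 big).
Qed.

End OneTime.

(** Serves to separate the two distances, of which the Lyapunov function controls a combination
    only. Young's inequality with 4 ep turns the mean inner error 2 ep |z - u|^2 into half of |z -
    u|^2 and leaves 8 ep |z - x|^2. *)
Lemma gap_step k s v : Z (st_z s) -> Z (st_m s) -> Z (st_zh s) ->
  avg lw (step_draws n H k) (fun w => nsq (st_z (step w k s) - x) - nsq (st_m (step w k s) - x)) v <=
  (1 - 2 * p) * (nsq (st_z s - x) - nsq (st_m s - x)) + 8 * ep * nsq (st_z s - x).
Proof.
move=> Zz Zm Zzh; pose G (co : bool) (fi : fin) := - nsq ((if co then st_z s else st_m s) - x).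
apply: (le_trans (avg_state_step (x := x) Z_nonempty Z_closed Z_convex lw_sum lw_ge0 hc n_gt0 F_sim2 hatP L_gt0
  gamma_gt0 b_gt0 b_le q_def q_le1 k (f := fun s => nsq (st_z s - x) - nsq (st_m s - x))
  (c1 := 1) (c2 := 0) (G := G) v ler01 (lexx 0) Zz Zm Zzh _ Zx)).
  by move=> zn co fi; rewrite /G /= mul1r mul0r addr0; case: co.
pose u := uh s; have Zu : Z u by exact: hat_in.
(* Placing the shadow iterate at [u] makes the direction zh - u vanish, so the deviation is the full
   inner error. *)
pose s' := State (st_z s) (st_m s) u u (0 : 'rV[R]_d) 0.
have e4 : 0 < 4 * ep by rewrite mulr_gt0.
pose C := (1 - p) * (nsq (st_z s - x) - nsq (u - st_z s)) + p * nsq (st_m s - x)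
  - (p - 16 * l ^+ 2) * nsq (u - st_m s) - 7 / 4 * y * nsq (u - x) + 4 * ep * nsq (u - x)
  - (p * nsq (st_z s - x) + (1 - p) * nsq (st_m s - x)).
pose D := (4 * ep)^-1 + 3.
apply: (@le_trans _ _ (E s (fun fi => C + D * nsq (fi.1.1 - u)))).
  apply: E_le => // fi hfi.
  have := @distance_pointwise s' Zm fi _ hfi e4.
  rewrite /= -/u subrr scaler0 subr0 dot0r mulr0 mul0r addr0.
  have hN : 0 <= dot (st_N F i1 gamma p hat s') (u - x).
    by have := normal_le (hatP (st_z s) (st_m s)) Zx; rewrite -(opprB x u) dotNr oppr_ge0.
  have h2 := ler_wpM2l (ltW gamma_gt0) (full_strong Zu).
  have h3 := mulr_ge0 (ltW gamma_gt0) (sol_ge0 Zu).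
  rewrite /G /C /D /noisy_sq; move: hN h2 h3; lra.
rewrite iter_chainD iter_chain_cst // iter_chainZ.
have D0 : 0 <= D by rewrite addr_ge0 ?invr_ge0 ?(ltW e4)//.
have h1 := ler_wpM2l D0 (mean_sq_error Zz).
have eD : D * (2 * ep * nsq (st_z s - u)) = (1 / 2 + 6 * ep) * nsq (st_z s - u).
  by rewrite /D; field; rewrite gt_eqF.
rewrite -/u eD (dot_subC (st_z s) u) in h1.
have h2 : nsq (u - x) <= 2 * nsq (st_z s - x) + 2 * nsq (u - st_z s).
  have := dot_addr_le2 (st_z s - x) (u - st_z s).
  by rewrite [st_z s - x + _]addrC addrA subrK.
have h3 := ler_wpM2l (ltW ep0) h2.
have UZ0 := dot_ge0 (u - st_z s); have UM0 := dot_ge0 (u - st_m s).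
have h4 := ler_wpM2r UZ0 ep_le; have h5 := ler_wpM2r UZ0 p_le.
have h6 : 16 * l ^+ 2 <= p.
  have hy : y <= 1 by move: y_p p_le; lra.
  have pp0 : 0 <= p * p by rewrite mulr_ge0 ?(ltW p_gt0).
  have := ler_wpM2r pp0 hy; have := ler_wpM2l (ltW p_gt0) p_le; have := p_gt0; move: l2_le; lra.
have h7 := ler_wpM2r UM0 h6; have h8 := mulr_ge0 (ltW y0) (dot_ge0 (u - x)).
rewrite /C; move: h1 h3 h4 h5 h7 h8 UZ0; lra.
Qed.

Lemma level_ge k s : state_ok s ->
  nsq (st_z s - x) + (1 - meanw) * nsq (st_m s - x) <= lyapunov k s.
Proof.
case=> Zz Zm Zzh Zmh [t0 hn].
have r0 := residual_ge0 Zmh t0 hn.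
have f0 : 0 <= potential (st_zh s) (st_mh s).
  by rewrite addr_ge0// mulr_ge0 ?dot_ge0 ?divr_ge0 ?(ltW gamma_gt0) ?(ltW p_gt0)// sol_ge0.
have n0 : 0 <= nu k by apply: le_trans (sched_gt p_gt0 p_le y0 y_p (time_ge k)); rewrite ler0n.
have th1 := meanw_le1.
have V0 : 0 <= nsq (st_z s - x) + (1 - meanw) * nsq (st_m s - x).
  by rewrite addr_ge0 ?mulr_ge0 ?dot_ge0.
have BB := ltW B0; have p0 := ltW p_gt0.
have h1 := ler_wpM2r V0 (dist_weight_old p_gt0 p_le (time_ge k)); rewrite mul1r in h1.
apply: (le_trans h1); rewrite /lyapunov /level -!addrA lerDl addrA.
by repeat first [assumption | exact: dot_ge0 | exact: ler0n | exact: sqr_ge0 | apply: addr_ge0 | apply: mulr_ge0].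
Qed.

(** Both shadow iterates start at [x], so energy and residual vanish and the distance to the shadow
    is |z0 - x|. The distance part contributes at most 2 * 121/100, the shadow part at most 8 *
    156/1000. *)
Lemma lyapunov_start z0 : Z z0 -> lyapunov 0 (state_start x z0) <= 37 / 10 * nsq (z0 - x).
Proof.
move=> Zz0; rewrite /lyapunov /level /potential /residual /=.
rewrite !subrr !dot0r !mulr0 !addr0.
have p0 := p_gt0; set S0 := nsq (z0 - x); have S00 : 0 <= S0 by exact: dot_ge0.
have th0 := meanw_ge0.
have tE : time 0 = 10 / p by rewrite /time add0r.
have w0 : dist_weight p (time 0) <= 121 / 100.
  rewrite /dist_weight tE (_ : p * (10 / p - 1) = 10 - p); last by field; rewrite gt_eqF.
  have h : 0 < 10 - p by move: p_le; lra.
  by have : 2 / (10 - p) <= 21 / 100; [rewrite ler_pdivrMr//; move: p_le; lra | lra].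
have n0 : 0 <= nu 0 by apply: le_trans (sched_gt p_gt0 p_le y0 y_p (time_ge 0)); rewrite ler0n.
have n1 : p * nu 0 <= 10.
  have h : nu 0 <= time 0 by rewrite ge_min lexx.
  by have := ler_wpM2l (ltW p0) h; rewrite {2}tE mulrCA mulfV ?mulr1// gt_eqF.
have pn0 : 0 <= p * nu 0 by rewrite mulr_ge0 ?(ltW p0).
have b1 : B * nu 0 <= 24 / 100 * (1 / 100).
  have -> : B * nu 0 = 240 * ep * (p * nu 0) by ring.
  have h := ler_wpM2l (ltW ep0) n1; move: ep_le; lra.
have b2 : B * nu 0 ^+ 2 <= 6 / 100.
  have -> : B * nu 0 ^+ 2 = 240 * ep * (nu 0 * (p * nu 0)) by ring.
  have h1 := ler_wpM2l n0 n1; have h2 := ler_wpM2r n0 ep_p.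
  by have := ler_wpM2l (ltW ep0) h1; lra.
have d0 : 0 <= S0 * (p * 1) by rewrite mulr1 mulr_ge0 ?(ltW p0).
have e1 := ler_wpM2r S00 w0; have e2 := ler_wpM2r S00 b1; have e3 := ler_wpM2r S00 b2.
have w1 : 1 <= dist_weight p (time 0) by exact: (dist_weight_old p_gt0 p_le (time_ge 0)).
have e4 := mulr_ge0 (mulr_ge0 (le_trans ler01 w1) th0) S00.
have Bn0 : 0 <= B * nu 0 by rewrite mulr_ge0 ?(ltW B0).
have Bn20 : 0 <= B * nu 0 ^+ 2 by rewrite mulr_ge0 ?sqr_ge0 ?(ltW B0).
have e5 := ler_wpM2r (mulr_ge0 Bn0 S00) p_le; have e6 := ler_wpM2r (mulr_ge0 Bn20 S00) p_le.
rewrite -/S0; move: e1 e2 e3 e4 e5 e6; lra.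
Qed.

Theorem small_step_bound z0 K v : Z z0 ->
  avg lw (all_draws n H K) (fun w => nsq (st_z (run step (state_start x z0) w K) - x)) v
  <= (1 - y / 2) ^+ K * (2 * nsq (z0 - x)).
Proof.
move=> Zz0; set S0 := nsq (z0 - x); set s0 := state_start x z0; set rt := 1 - y / 2.
have S00 : 0 <= S0 by exact: dot_ge0.
have r0 : 0 <= rt by rewrite /rt; move: y_small; lra.
have ok0 : state_ok s0 := state_ok_start Zz0.
have local := @state_step_local R c d n r M H Z F i1 gamma p q b hat x.
have okS := state_ok_step.
pose zk k := avg lw (all_draws n H k) (fun w => nsq (st_z (run step s0 w k) - x)) v.
pose Wk k := avg lw (all_draws n H k) (fun w => lyapunov k (run step s0 w k)) v.
pose gk k := avg lw (all_draws n H k) (fun w => nsq (st_z (run step s0 w k) - x)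
   - nsq (st_m (run step s0 w k) - x)) v.
have th0 := meanw_ge0; have th1 : meanw <= 1 / 100 by have := meanw_le; move: ep_le; lra.
have hW k : Wk k <= rt ^+ k * (37 / 10 * S0).
  apply: (le_trans (avg_run_le lw_ge0 local (Inv := state_ok) okS (W := lyapunov) v k ok0 r0 _)).
    by move=> k' s v' ok; exact: lyapunov_step.
  by rewrite ler_wpM2l ?exprn_ge0//; exact: lyapunov_start.
have zW k : zk k <= Wk k.
  apply: avg_le => // w _; have ok := run_Inv okS w k ok0.
  apply: le_trans (level_ge k ok); rewrite lerDl mulr_ge0 ?dot_ge0//; lra.
have hg k : gk k <= 1 / 100 * (rt ^+ k * S0).
  elim: k => [|k ih]; first by rewrite /gk /= subrr mulr_ge0 ?mul1r//; lra.
  apply: (@le_trans _ _ (avg lw (all_draws n H k) (fun w => (1 - 2 * p) *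
      (nsq (st_z (run step s0 w k) - x) - nsq (st_m (run step s0 w k) - x))
      + 8 * ep * nsq (st_z (run step s0 w k) - x)) v)).
    apply: (avg_run_succ lw_ge0 local (Inv := state_ok) okS v ok0
      (f := fun s => nsq (st_z s - x) - nsq (st_m s - x))
      (g := fun s => (1 - 2 * p) * (nsq (st_z s - x) - nsq (st_m s - x)) + 8 * ep * nsq (st_z s - x))).
    by move=> s v' [Zz Zm Zzh _ _]; exact: gap_step.
  rewrite avgD !avgZ -/(gk k) -/(zk k).
  have c1 : 0 <= 1 - 2 * p by move: p_le; lra.
  have h1 := ler_wpM2l c1 ih; have h2 := ler_wpM2l (ltW ep0) (le_trans (zW k) (hW k)).
  have rS : 0 <= rt ^+ k * S0 by rewrite mulr_ge0 ?exprn_ge0.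
  have h3 := ler_wpM2r rS ep_p; have h4 := ler_wpM2r rS y_p; have h5 := mulr_ge0 (ltW p_gt0) rS.
  have e : rt ^+ k.+1 * S0 = rt ^+ k * S0 - y / 2 * (rt ^+ k * S0) by rewrite exprS {1}/rt; ring.
  rewrite e; move: h1 h2 h3 h4 h5.
  by move: (rt ^+ k) (gk k) (zk k) => rk g z; lra.
(* The two bounds give (2 - meanw) E |z - x|^2 <= (37/10 + 1/100) rt^K |z0 - x|^2, and 371/100 <= 2
   (2 - 1/100). *)
have key : (2 - meanw) * zk K = avg lw (all_draws n H K) (fun w =>
      nsq (st_z (run step s0 w K) - x) + (1 - meanw) * nsq (st_m (run step s0 w K) - x)) v
    + (1 - meanw) * gk K.
  by rewrite /zk /gk -!avgZ -avgD; apply: avg_eq => w _; ring.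
have hV : avg lw (all_draws n H K) (fun w =>
      nsq (st_z (run step s0 w K) - x) + (1 - meanw) * nsq (st_m (run step s0 w K) - x)) v <= Wk K.
  by apply: avg_le => // w _; apply: level_ge; exact: (run_Inv okS w K ok0).
have c2 : 0 <= 1 - meanw by lra.
have h1 := ler_wpM2l c2 (hg K); have h2 := hW K.
have rS : 0 <= rt ^+ K * S0 by rewrite mulr_ge0 ?exprn_ge0.
have h3 := mulr_ge0 th0 rS; have h4 : 0 < 2 - meanw by lra.
have h5 : meanw * (rt ^+ K * S0) <= 1 / 100 * (rt ^+ K * S0) by rewrite ler_wpM2r.
rewrite -(ler_pM2l h4) -/(zk K) key.
move: hV h1 h2 h3 h5; move: (avg _ _ _ _) (rt ^+ K) (gk K) (Wk K) => e rk g W; lra.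
Qed.

End SmallStep.

End OuterLoop.

Theorem theoremC15 (R : realType) (d n r M H : nat) (c : regime)
  (hn : (0 < n)%N) (hM : (0 < M)%N) (hH : (0 < H)%N)
  (hc : regime_ok c d n r)
  (Z : set 'rV[R]_d) (Z_nonempty : Z !=set0) (Z_closed : closed Z)
  (Z_convex : convex_set Z)
  (F : 'I_n -> 'I_M -> 'rV[R]_d -> 'rV[R]_d)
  (L mu delta : R) (L_gt0 : 0 < L) (mu_gt0 : 0 < mu) (delta_gt0 : 0 < delta)
  (F_strongly_monotone : strongly_monotone_on Z (full_op F) mu)
  (F_nodes_monotone : forall i : 'I_n, monotone_on Z (node_op F i))
  (F_lipschitz : mean_square_lipschitz Z F L)
  (F_similar : mean_square_similar Z F delta)
  (zstar : 'rV[R]_d) (zstar_sol : solves_VI Z (full_op F) zstar)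
  (gamma eta tau alpha p q : R)
  (gamma_gt0 : 0 < gamma) (eta_gt0 : 0 < eta) (p_gt0 : 0 < p)
  (tau_def : tau = p) (p_le : p <= 4%:R^-1)
  (gamma_def : gamma =
     Num.min (p / (3%:R * mu))
       (Num.min (Num.sqrt p / (4%:R * delta))
          (L^-1 * (H%:R / (12%:R * Num.sqrt M%:R * ln (40%:R * L / (mu * p)))
                   - 1))))
  (eta_def : eta = (2%:R * Num.sqrt M%:R * (L + gamma^-1))^-1)
  (q_def : q = M%:R^-1) (alpha_def : alpha = 1 - M%:R^-1)
  (H_ge : 16%:R * M%:R * ln (40%:R * L / (mu * p)) <= H%:R)
  (z0 : 'rV[R]_d) (z0_in : Z z0)
  (disp : measure_display) (Omega : measurableType disp)
  (P : probability Omega R)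
  (X : forall a : draw n H, Omega -> outcome c d r M a)
  (X_law : has_law P X (draw_law p q))
  (X_indep : mutually_independent P X)
  (K : nat) :
  ('E_P[fun w => (enorm ((iterates Z F (Ordinal hn) gamma eta tau alpha z0
                            (fun a => X a w) K).1 - zstar) ^+ 2)%R]
   <= ((1 - gamma * mu / 2%:R) ^+ K * (2%:R * enorm (z0 - zstar) ^+ 2))%:E)%E.
Proof.
set E0 := fun w => _.
have lw_ge0 := law_ge0 X_law; have lw_sum := law_sum X_law.
have q_le1 := q_le_one hM q_def.
have alphaE : alpha = 1 - q by rewrite alpha_def q_def.
pose b := eta / gamma.
have etaE : eta = gamma * b by rewrite /b mulrC divfK// gt_eqF.
have [hat hatP] : {hat & forall z m, is_hat Z F (Ordinal hn) gamma p z m (hat z m)}.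
  have h (zm : 'rV[R]_d * 'rV[R]_d) : exists u, is_hat Z F (Ordinal hn) gamma p zm.1 zm.2 u.
    by eapply hat_exists; eauto.
  have [f fP] := choice h.
  by exists (fun z m => f (z, m)) => z m; exact: (fP (z, m)).
pose step := @state_step R c d n r M H Z F (Ordinal hn) gamma p q b hat zstar.
pose zK y := st_z (run step (state_start zstar z0) y K).
pose f y := dot (zK y - zstar) (zK y - zstar).
have E0E : E0 = fun w => f (fun a => X a w).
  apply: funext => w; rewrite /E0 enorm_sqr.
  by rewrite (iterates_run Z F (Ordinal hn) hat zstar z0 _ K (lt0r_neq0 gamma_gt0) etaE tau_def alphaE).
have f_local : depends_on (all_draws n H K) f.
  move=> y y' yy; rewrite /f /zK (run_local _ _ yy)// => *; exact: state_step_local.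
(* The base assignment is arbitrary: every draw that [f] reads is averaged over. *)
rewrite E0E (expectation_avg X_law X_indep (fun a => X a point) (uniq_all_draws n H K) f_local); last first.
  by move=> y; rewrite /f -enorm_sqr sqr_ge0.
rewrite lee_fin enorm_sqr.
have [Zx _] := zstar_sol.
(* If [Z] is a single point, mu <= L may fail, but then all iterates equal [zstar]. *)
have [[u [v [Zu Zv uv]]]|Z1] := pselect (exists u v, [/\ Z u, Z v & u != v]); last first.
  have Zeq u : Z u -> u = zstar.
    by move=> Zu; apply: contrapT => h; apply: Z1; exists u, zstar; split=> //; apply/eqP.
  rewrite (avg_const _ (c := 0)) => [||y _]//.
    by rewrite (Zeq z0 z0_in) subrr dot0l !mulr0.
  rewrite /f (Zeq (zK y)) ?subrr ?dot0l//.
  by rewrite /zK; case: (K) => [|k]//=; exact: proj_in.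
have mu_le := strong_le_lip hn hM (ltW L_gt0) (ltW mu_gt0) F_strongly_monotone F_lipschitz Zu Zv uv.
pose x := 40 * L / (mu * p).
have mp0 : 0 < mu * p by rewrite mulr_gt0.
have x0 : 0 < x by rewrite divr_gt0// mulr_gt0.
have epx : x ^- 3 * x ^+ 3 = 1 by rewrite mulVf// expf_neq0// gt_eqF.
have Lx : 40 * L = x * (mu * p) by rewrite /x divfK// gt_eqF.
have xp : 40 <= x * p.
  by rewrite -(ler_pM2l mu_gt0) mulrCA -Lx mulrC ler_pM2l.
have p_le' : p <= 1 / 4 by rewrite mul1r.
have [fr1 fr2] := fast_rate_le gamma eta q.
have gd := gamma_delta delta_gt0 gamma_gt0 p_gt0 gamma_def.
have gm := gamma_mu mu_gt0 gamma_def.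
have b0 := step_ratio_gt0 hM L_gt0 gamma_gt0 eta_def.
have b1 := step_ratio_le hM L_gt0 gamma_gt0 eta_def.
have qe := qE hM L_gt0 gamma_gt0 eta_def q_def.
have fr0 := fast_rate_ge0 hM L_gt0 gamma_gt0 eta_def q_def.
have frd := fast_decay hM L_gt0 mu_gt0 gamma_gt0 p_gt0 p_le gamma_def eta_def q_def H_ge mu_le.
have sld := slow_decay hM mu_gt0 p_gt0 p_le q_def H_ge mu_le.
have xge := ratio_ge mu_gt0 p_gt0 p_le mu_le.
have [large|small] := leP (14 * x ^- 3) (gamma * mu).
  exact: (large_step_bound Z_nonempty Z_closed Z_convex lw_sum lw_ge0 hc hn hM hH
    L_gt0 mu_gt0 gamma_gt0 p_gt0 p_le' b0 b1 qe q_le1 F_lipschitz F_nodes_monotone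
    F_strongly_monotone zstar_sol hatP fr0 fr1 fr2 frd gm F_similar gd large).
exact: (small_step_bound Z_nonempty Z_closed Z_convex lw_sum lw_ge0 hc hn hM hH
    L_gt0 mu_gt0 gamma_gt0 p_gt0 p_le' b0 b1 qe q_le1 F_lipschitz F_nodes_monotone
    F_strongly_monotone zstar_sol hatP fr0 fr1 fr2 frd gm xge epx Lx xp (ltW small) sld).
Qed.
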